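(* Let $f$ range over cubic surfaces having infinitely many singular points. For each rank $r$, the possible pairs (dimension, degree) of the singular locus of such an $f$ of rank $r$ are exactly the following (every listed pair occurs, and no other pair occurs): - $r=1$: $(2,1)$; - $r=2$: $(1,1)$; - $r=3$: $(2,1)$; - $r=4$: $(1,1)$, $(1,2)$, $(1,3)$; - $r=5$: $(1,1)$; - $r=6$: $(1,1)$, $(1,2)$; - $r=7$: $(1,1)$, $(1,2)$.
   Context: A cubic surface is a nonzero homogeneous polynomial $f$ of degree $3$ in four variables with complex coefficients, identified with its vanishing locus in $\mathbb{P}^3=\mathbb{P}^3_{\mathbb{C}}$. A point $p\in\mathbb{P}^3$ is a singular point of $f$ if all partial derivatives of $f$ vanish at $p$; the singular locus is the set of singular points, viewed as a (reduced) closed subvariety of $\mathbb{P}^3$, and its dimension and degree are the usual ones (the degree being that of the union of its top-dimensional components). The rank of $f$ is the smallest $r$ such that $f=l_1^3+\cdots+l_r^3$ with $l_i$ complex linear forms; the rank of a cubic surface is at most $7$. *)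

(* Defs.v *)
From mathcomp Require Import all_boot all_order all_algebra.
From mathcomp Require Import complex.
From mathcomp Require Import boolp classical_sets cardinality reals.
From mathcomp Require Import mpoly.

Set Implicit Arguments.
Unset Strict Implicit.
Unset Printing Implicit Defensive.

Import GRing.Theory.

Local Open Scope ring_scope.
Local Open Scope classical_set_scope.

Section ProjectiveSpace.
Variable R : realType.
Local Notation C := R[i].

(* A point of P^3 is a line through the origin of C^4. *)
Definition P3 := {L : {vspace 'rV[C]_4} | \dim L == 1%N}.

(* Intended for homogeneous g, for which it amounts to the vanishing of g at
   any one nonzero vector of the line. *)
Definition vanishes_at (g : {mpoly C[4]}) (p : P3) : Prop :=
  forall v : 'rV[C]_4, v \in val p -> g.@[fun i => v 0 i] = 0.

Definition form (g : {mpoly C[4]}) : Prop := exists d : nat, g \is d.-homog.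

Definition zariski_closed (X : set P3) : Prop :=
  exists T : set {mpoly C[4]},
    T `<=` form /\ X = [set p | forall g, T g -> vanishes_at g p].

Definition irreducible_set (X : set P3) : Prop :=
  X !=set0 /\
  forall A B : set P3, zariski_closed A -> zariski_closed B ->
    X `<=` A `|` B -> X `<=` A \/ X `<=` B.

(* A chain Z_0 < ... < Z_m of irreducible closed subsets of X; used only for
   closed X, so that closed in X and closed in P^3 agree. *)
Definition has_chain (X : set P3) (m : nat) : Prop :=
  exists Z : nat -> set P3,
    (forall i, (i <= m)%N ->
       [/\ zariski_closed (Z i), irreducible_set (Z i) & Z i `<=` X]) /\
    (forall i, (i < m)%N -> Z i `<` Z i.+1).

(* Krull dimension of the Zariski topology on X (with the junk value 0 on the
   empty set). *)
Definition dimension (X : set P3) : nat :=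
  xget 0%N [set m | has_chain X m /\ ~ has_chain X m.+1].

(* The degree-d piece of the homogeneous ideal I(X) of all forms vanishing on
   X, as a subspace of the space of forms of degree d. *)
Definition ideal_piece (X : set P3) (d : nat) : {vspace dhomog 4 C d} :=
  xget 0%VS [set V : {vspace dhomog 4 C d} |
    forall g : dhomog 4 C d,
      g \in V <-> forall p, X p -> vanishes_at (mpoly_of_dhomog g) p].

Definition hilbert_function (X : set P3) (d : nat) : nat :=
  (\dim {: dhomog 4 C d} - \dim (ideal_piece X d))%N.

Definition hilbert_poly (X : set P3) : {poly rat} :=
  xget 0 [set P : {poly rat} |
    exists N : nat, forall d, (N <= d)%N ->
      P.[d%:R] = (hilbert_function X d)%:R].

(* (dim X)! times the leading coefficient of the Hilbert polynomial of X with
   its reduced structure.  Components of dimension < dim X do not affect the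
   leading coefficient, so this is the degree of the union of the
   top-dimensional components. *)
Definition degree (X : set P3) : rat :=
  (dimension X)`!%:R * lead_coef (hilbert_poly X).

Definition cubic_surface (f : {mpoly C[4]}) : Prop :=
  f != 0 /\ f \is 3.-homog.

Definition singular_locus (f : {mpoly C[4]}) : set P3 :=
  [set p | forall i : 'I_4, vanishes_at (mderiv i f) p].

Definition sum_of_cubes (f : {mpoly C[4]}) (r : nat) : Prop :=
  exists l : 'I_r -> {mpoly C[4]},
    (forall k, l k \is 1.-homog) /\ f = \sum_(k < r) l k ^+ 3.

Definition has_rank (f : {mpoly C[4]}) (r : nat) : Prop :=
  sum_of_cubes f r /\ forall s, sum_of_cubes f s -> (r <= s)%N.

End ProjectiveSpace.

(* The listed (dimension, degree) pairs for each rank. *)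
Definition listed_pairs (r : nat) : seq (nat * nat) :=
  match r with
  | 1 => [:: (2, 1)]
  | 2 => [:: (1, 1)]
  | 3 => [:: (2, 1)]
  | 4 => [:: (1, 1); (1, 2); (1, 3)]
  | 5 => [:: (1, 1)]
  | 6 => [:: (1, 1); (1, 2)]
  | 7 => [:: (1, 1); (1, 2)]
  | _ => [::]
  end%N.

(* Main.v *)
From HB Require Import structures.
Require Import Defs.
From mathcomp Require Import all_boot all_order all_algebra.
From mathcomp Require Import complex.
From mathcomp Require Import boolp classical_sets cardinality reals.
From mathcomp Require Import mpoly.
From mathcomp Require Import ring zify.

(** A cubic surface with infinitely many singular points is brought, by a linear
    change of coordinates, to one of a short list of normal forms; the rank, the
    dimension and the degree do not change, and are computed on the list.

    The normal forms come from five distinct singular points.  The partial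
    derivatives are quadrics, so if three singular points are collinear, their
    whole line is singular, and f = c(x,y) + p(x,y) z + q(x,y) w with c a binary
    cubic and p, q binary quadrics (classified_three_collinear).  A pencil of
    binary quadrics contains a square, and a case analysis on the pencil (p,q)
    leaves eleven types (classified_singular_line).  If no three singular
    points are collinear but four are coplanar, f vanishes on their plane: there f
    restricts to a multiple of xyz which is zero at a fourth point with nonzero
    coordinates.  The surface is then a plane and a quadric meeting in a smooth
    conic (classified_four_coplanar).  In general position, four of the points are
    the coordinate points, f is a combination of the four products of three
    coordinates, and the fifth point kills it (classified_general_position).

    The singular loci on the list are a plane, one, two or three lines through a
    point, and a smooth conic possibly with an extra point.  Their Hilbert
    functions are counted by exhibiting monomials that form a basis of the
    functions on the locus (hilbert_count).  The dimension is bounded below by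
    explicit chains.  It is bounded above because a chain of length m makes the
    Hilbert function grow like a polynomial of degree m (chain_growth): a form g
    of degree e vanishing on Z' but not on the irreducible Z embeds the degree d
    part of the coordinate ring of Z into the degree d + e part of the forms on Z
    vanishing on Z'.

    For the rank, write f as a sum of r cubes and let M be the 4 by r matrix of
    coefficients.  The vectors c with M c = 0 form a space of dimension at most
    r - k if f depends essentially on k variables.  Every second order operator
    that kills f gives such a vector, namely a combination of entrywise products
    of rows of M; in particular a singular point gives the entrywise square of a
    combination of rows, so it is nonzero unless the point is a vertex.  One
    singular point off the vertex therefore forces r > k (rank_sing), and when
    r - k is small, dependencies between the products force a dependency
    between the rows, which contradicts essentiality (proportional_of_relations,
    dependent_triple).  The matching upper bounds are explicit, and rest on
    x u^2 being, up to a multiple of x^3, a sum of two cubes (cubes_pair). *)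

Set Implicit Arguments.
Unset Strict Implicit.
Unset Printing Implicit Defensive.

Import Order.TTheory GRing.Theory Num.Theory.

Local Open Scope ring_scope.
Local Open Scope classical_set_scope.

(** * Points of projective space and cones *)

Section Basics.
Variable R : realType.
Local Notation C := R[i].
Local Notation V := 'rV[C]_4.
Local Notation Poly := {mpoly C[4]}.
Implicit Types (g h : Poly) (v w : V) (S : V -> Prop) (p : P3 R).

Definition ev g v : C := g.@[fun i => v 0 i].

Lemma evX (m : 'X_{1..4}) v : ev 'X_[m] v = \prod_i v 0 i ^+ m i.
Proof. exact: mevalX. Qed.
Lemma evE g v : ev g v = \sum_(m <- msupp g) g@_m * ev 'X_[m] v.
Proof. by rewrite /ev mevalE; apply: eq_bigr => m _; rewrite mevalX. Qed.
Lemma evXU i v : ev 'X_i v = v 0 i.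
Proof. exact: mevalXU. Qed.
Lemma evM g h v : ev (g * h) v = ev g v * ev h v.
Proof. exact: mevalM. Qed.
Lemma evD g h v : ev (g + h) v = ev g v + ev h v.
Proof. exact: mevalD. Qed.
Lemma evB g h v : ev (g - h) v = ev g v - ev h v.
Proof. exact: mevalB. Qed.
Lemma evZ a g v : ev (a *: g) v = a * ev g v.
Proof. exact: mevalZ. Qed.
Lemma evXn g k v : ev (g ^+ k) v = ev g v ^+ k.
Proof. exact: rmorphXn. Qed.
Lemma ev_sum (I : Type) (r : seq I) (P : pred I) (F : I -> Poly) v :
  ev (\sum_(i <- r | P i) F i) v = \sum_(i <- r | P i) ev (F i) v.
Proof. exact: raddf_sum. Qed.

Lemma ev_homog d g a v : g \is d.-homog -> ev g (a *: v) = a ^+ d * ev g v.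
Proof.
move=> /dhomogP hg; rewrite !evE big_distrr /= big_seq [RHS]big_seq.
apply: eq_bigr => m /hg hm; rewrite !evX mulrCA; congr (_ * _).
rewrite -(hm : mdeg m = d) mdegE -prodrXr -big_split /=; apply: eq_bigr => i _.
by rewrite mxE exprMn.
Qed.

Lemma P3_generator p : exists2 v, v != 0 & val p = <[v]>%VS.
Proof.
case: p => L /= hL; exists (vpick L).
  by rewrite vpick0 -dimv_eq0 (eqP hL).
apply/esym/eqP; rewrite eqEdim -memvE memv_pick (eqP hL) dim_vline.
by rewrite vpick0 -dimv_eq0 (eqP hL).
Qed.

Lemma line_proof v : v != 0 -> \dim <[v]> == 1%N.
Proof. by move=> hv; rewrite dim_vline hv. Qed.

Definition point_of v (hv : v != 0) : P3 R := exist _ <[v]>%VS (line_proof hv).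

Definition proj S : set (P3 R) := [set p : P3 R | forall v, v \in val p -> S v].

Definition cone S := forall a v, S v -> S (a *: v).

Lemma proj_point S v (hv : v != 0) : cone S -> proj S (point_of hv) <-> S v.
Proof.
move=> hS; split; first by apply; rewrite memv_line.
by move=> Sv w /vlineP[a ->]; apply: hS.
Qed.

(** Homogeneity lets one nonzero vector of the line decide vanishing. *)
Lemma vanishes_gen d g p v : g \is d.-homog -> v != 0 -> v \in val p ->
  vanishes_at g p <-> ev g v = 0.
Proof.
move=> hg v0 vp; split; first exact.
have [w w0 pw] := P3_generator p; move: vp; rewrite pw => /vlineP[a va].
move=> hv u; rewrite pw => /vlineP[b ->]; rewrite -/(ev _ _) (ev_homog _ _ hg).
have a0 : a != 0 by apply: contraNneq v0 => a0; rewrite va a0 scale0r.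
move/eqP: hv; rewrite va (ev_homog _ _ hg) mulf_eq0 expf_eq0 (negPf a0) andbF /=.
by move=> /eqP->; rewrite mulr0.
Qed.

(** This turns questions on subsets of projective space into questions on
    nonzero vectors of the corresponding cone. *)
Lemma vanishes_proj d g S : cone S -> g \is d.-homog ->
  (forall p, proj S p -> vanishes_at g p) <->
  (forall v, v != 0 -> S v -> ev g v = 0).
Proof.
move=> hS hg; split=> [H v v0 Sv|H p Sp].
  by have /(H _)/(_ v) := (proj_point v0 hS).2 Sv; apply; rewrite memv_line.
have [v v0 pv] := P3_generator p; have vp : v \in val p by rewrite pv memv_line.
by apply/(vanishes_gen hg v0 vp)/H => //; apply: Sp.
Qed.

Lemma closed_proj S (T : set Poly) : T `<=` @Defs.form R ->
  (forall v, S v <-> forall g, T g -> ev g v = 0) -> zariski_closed (proj S).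
Proof.
move=> hT hS; exists T; split=> //; apply/seteqP; split=> p /=.
  by move=> Sp g Tg v vp; apply: (hS v).1 g Tg; apply: Sp.
by move=> H v vp; apply/hS => g Tg; apply: H.
Qed.

Lemma eq_proj S S' : (forall v, S v <-> S' v) -> proj S = proj S'.
Proof. by move=> H; apply/seteqP; split=> p Sp v /Sp /H. Qed.

(** A subspace of maximal dimension among those contained in P exhausts P:
    adding to it a vector of P would increase the dimension. *)
Lemma vspace_ex (K : fieldType) (W : vectType K) (P : W -> Prop) :
  P 0 -> (forall a (x y : W), P x -> P y -> P (a *: x + y)) ->
  exists U : {vspace W}, forall x, x \in U <-> P x.
Proof.
move=> P0 Plin.
pose Q n := `[< exists2 U : {vspace W}, \dim U = n & forall x, x \in U -> P x >].
have exQ : exists n, Q n.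
  exists 0%N; apply/asboolP; exists 0%VS; first exact: dimv0.
  by move=> x; rewrite memv0 => /eqP->.
have bQ n : Q n -> (n <= \dim {: W})%N.
  by move=> /asboolP[U <- _]; rewrite dimvS ?subvf.
case: (ex_maxnP exQ bQ) => n /asboolP[U dU UP] max; exists U => u.
split; first exact: UP.
move=> Pu; apply: contrapT => /negP uU.
suff /max : Q (\dim (<[u]> + U)).
  rewrite leqNgt -dU => /negP; apply.
  rewrite ltnNge; apply: contra uU => le_d.
  have /eqP-> : U == (<[u]> + U)%VS by rewrite eqEdim addvSr.
  by rewrite memvE addvSl.
apply/asboolP; exists (<[u]> + U)%VS => // w /memv_addP[x /vlineP[a ->] [y yU ->]].
by apply: Plin => //; apply: UP.
Qed.

(** Vanishing on X is a linear condition, so the subspace chosen in the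
    definition of the ideal piece exists. *)
Lemma ideal_pieceP (X : set (P3 R)) d (g : dhomog 4 C d) :
  g \in ideal_piece X d <-> forall p, X p -> vanishes_at (mpoly_of_dhomog g) p.
Proof.
rewrite /ideal_piece; case: xgetP => [U -> /(_ g)//|/= noV].
have [|a u1 u2 H1 H2 p Xp v vp|U HU] := @vspace_ex _ (dhomog 4 C d)
  (fun u : dhomog 4 C d =>
     forall p, X p -> vanishes_at (mpoly_of_dhomog u) p).
- by move=> p _ v _; rewrite /= raddf0.
- have -> : mpoly_of_dhomog (a *: u1 + u2) = a *: (u1 : Poly) + (u2 : Poly) by [].
  rewrite mevalD mevalZ.
  by rewrite (H1 p Xp v vp) (H2 p Xp v vp) mulr0 addr0.
by case: (noV U).
Qed.

End Basics.

(** * Hilbert functions and dimension *)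

Section LinFun.
Variables (K : fieldType) (U W : vectType K) (f : U -> W) (f_lin : linear f).
HB.instance Definition _ := GRing.isLinear.Build K U W _ f f_lin.

(** Makes images and kernels of subspaces available for a function whose linearity
    is proved in the course of an argument. *)
Lemma linfun_ex : exists F : 'Hom(U, W), F =1 f.
Proof. by exists (linfun f) => u; rewrite lfunE. Qed.
End LinFun.

Section Hilbert.
Variable R : realType.
Local Notation C := R[i].
Local Notation V := 'rV[C]_4.
Local Notation Poly := {mpoly C[4]}.
Implicit Types (g h : Poly) (v w : V) (S : V -> Prop) (p : P3 R).
Implicit Types (X Y Z : set (P3 R)).

Definition vanishes_on g X := forall p, X p -> vanishes_at g p.

Lemma vanishes_on0 X : vanishes_on 0 X.
Proof. by move=> p _ v _; rewrite meval0. Qed.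

(** The b j span a complement of the ideal piece: modulo forms vanishing on X they
    generate every monomial, hence every form, and they stay independent on X. *)
Lemma hilbert_count X d (J : finType) (b : J -> Poly) :
  (forall j, b j \is d.-homog) ->
  (forall m, mdeg m = d -> vanishes_on 'X_[m] X \/
     exists j, vanishes_on ('X_[m] - b j) X) ->
  (forall c : J -> C, vanishes_on (\sum_j c j *: b j) X -> forall j, c j = 0) ->
  hilbert_function X d = #|J|.
Proof.
move=> hb gen ind.
pose bb j : dhomog 4 C d := DHomog (hb j).
have sumbb (c : J -> C) : mpoly_of_dhomog (\sum_j c j *: bb j) = \sum_j c j *: b j.
  by rewrite raddf_sum.
pose B : #|J|.-tuple (dhomog 4 C d) := codom_tuple bb.
have sumB (k : 'I_#|J| -> C) :
    \sum_i k i *: B`_i = \sum_j k (enum_rank j) *: bb j.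
  rewrite (reindex_onto (@enum_rank J) (@enum_val J predT)) /=; last first.
    by move=> i _; rewrite enum_valK.
  apply: eq_big => [j|j _]; first by rewrite enum_rankK eqxx.
  by rewrite nth_codom enum_rankK.
have freeB : free B.
  apply/freeP => k; rewrite sumB => H i.
  rewrite -(enum_valK i) -/(_ (enum_val i)).
  apply: (ind (fun j => k (enum_rank j))); rewrite -sumbb H.
  exact: vanishes_on0.
have dimB : \dim <<B>> = #|J| by rewrite (eqP freeB) size_tuple.
pose I := ideal_piece X d.
have BI0 : (<<B>> :&: I)%VS = 0%VS.
  apply/eqP; rewrite -subv0; apply/subvP => u /memv_capP[/coord_span-> ].
  rewrite sumB => /ideal_pieceP; rewrite sumbb => /ind H.
  rewrite big1 ?mem0v // => j _.
  by rewrite (H j) scale0r.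
have BIT : (<<B>> + I)%VS = fullv.
  apply/eqP; rewrite eqEsubv subvf; apply/subvP => u0 _; pose g : dhomog 4 C d := u0; rewrite -/g.
  pose Q q := exists2 u : dhomog 4 C d, u \in (<<B>> + I)%VS &
                mpoly_of_dhomog u = q.
  suff [u uBI ug] : Q (mpoly_of_dhomog g) by rewrite -(val_inj ug : u = g).
  rewrite [mpoly_of_dhomog g]mpolyE big_seq; apply: big_ind.
  - by exists 0; rewrite ?mem0v // raddf0.
  - move=> _ _ [u1 H1 <-] [u2 H2 <-]; exists (u1 + u2); first exact: rpredD.
    by rewrite raddfD.
  have /dhomogP hg : mpoly_of_dhomog g \is d.-homog := valP g.
  move=> m /hg hm.
  have hX : ('X_[m] : Poly) \is d.-homog by rewrite dhomogX; apply/eqP.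
  exists ((mpoly_of_dhomog g)@_m *: (DHomog hX)); last by [].
  apply: rpredZ; case: (gen m hm) => [H|[j H]].
    by rewrite memvE (subv_trans _ (addvSr _ _)) // -memvE; apply/ideal_pieceP.
  have -> : DHomog hX = bb j + (DHomog hX - bb j) by rewrite addrC subrK.
  apply: memv_add.
    by apply/memv_span/codomP; exists j.
  by apply/ideal_pieceP; rewrite raddfB.
have := dimv_disjoint_sum BI0; rewrite BIT dimB /hilbert_function -/I => ->.
by rewrite addnK.
Qed.

Lemma hilbert_mono X Y d : X `<=` Y ->
  (hilbert_function X d <= hilbert_function Y d)%N.
Proof.
move=> XY; apply: leq_sub2l; apply/dimvS/subvP => u /ideal_pieceP H.
by apply/ideal_pieceP => p /XY /H.
Qed.

Lemma closed_vanish d g : g \is d.-homog -> zariski_closed (fun p => vanishes_at g p).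
Proof.
move=> hg; exists [set g]; split; first by move=> _ ->; exists d.
by apply/seteqP; split=> p /=; [move=> H _ -> | apply].
Qed.

Lemma irreducible_mul Z d e g h : irreducible_set Z ->
  g \is d.-homog -> h \is e.-homog -> vanishes_on (g * h) Z ->
  vanishes_on g Z \/ vanishes_on h Z.
Proof.
move=> [_ irr] hg hh gh.
apply: (irr _ _ (closed_vanish hg) (closed_vanish hh)) => p Zp.
have [v v0 pv] := P3_generator p; have vp : v \in val p by rewrite pv memv_line.
have /eqP := gh p Zp v vp; rewrite -/(ev _ _) evM mulf_eq0.
by case/orP => /eqP ?; [left|right]; apply/(vanishes_gen _ v0 vp); eassumption.
Qed.

(** Multiplication by g is injective modulo the ideal of the irreducible set Z,
    and its image consists of forms vanishing on Z'. *)
Lemma hilbert_step Z Z' d e g : irreducible_set Z -> Z' `<=` Z ->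
  g \is e.-homog -> vanishes_on g Z' -> ~ vanishes_on g Z ->
  (hilbert_function Z d + hilbert_function Z' (d + e) <=
   hilbert_function Z (d + e))%N.
Proof.
move=> irr Z'Z hg gZ' gZ.
have hug (u : dhomog 4 C d) : (mpoly_of_dhomog u * g) \is (d + e).-homog.
  by apply: dhomogM hg; apply: valP.
pose mulg (u : dhomog 4 C d) : dhomog 4 C (d + e) := DHomog (hug u).
have mulg_lin : linear mulg.
  move=> a u v; apply: val_inj.
  change ((a *: (u : Poly) + v) * g = a *: ((u : Poly) * g) + (v : Poly) * g).
  by rewrite mulrDl scalerAl.
have [mu muf] := linfun_ex mulg_lin.
have muE u : mpoly_of_dhomog (mu u) = mpoly_of_dhomog u * g by rewrite muf.
pose I := ideal_piece Z d; pose I1 := ideal_piece Z (d + e).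
pose I2 := ideal_piece Z' (d + e); pose K := (I^C)%VS.
have dK : hilbert_function Z d = \dim K by rewrite dimv_compl.
have inI u : mu u \in I1 -> u \in I.
  move=> /ideal_pieceP; rewrite muE => H; apply/ideal_pieceP.
  by case: (irreducible_mul irr (valP u) hg H).
have KI u : u \in K -> u \in I -> u = 0.
  move=> uK uI; apply/eqP; rewrite -memv0 -(capv_compl I).
  by rewrite memv_cap uI.
have dmu : \dim (mu @: K) = \dim K.
  apply: limg_dim_eq; apply/eqP; rewrite -subv0; apply/subvP => u.
  move=> /memv_capP[uK]; rewrite memv_ker => /eqP mu0.
  by rewrite (KI u uK) ?mem0v // inI // mu0 mem0v.
have cap0 : (mu @: K :&: I1)%VS = 0%VS.
  apply/eqP; rewrite -subv0; apply/subvP => _ /memv_capP[/memv_imgP[u uK ->]].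
  by move=> /inI uI; rewrite (KI u) // linear0 mem0v.
have sub : (mu @: K + I1 <= I2)%VS.
  rewrite subv_add; apply/andP; split; apply/subvP => u.
    move=> /memv_imgP[w wK ->]; apply/ideal_pieceP => p Z'p v vp.
    by rewrite muE mevalM (gZ' p Z'p v vp) mulr0.
  by move=> /ideal_pieceP H; apply/ideal_pieceP => p /Z'Z /H.
have := dimvS sub; rewrite dimv_disjoint_sum // dmu -dK.
move: (hilbert_function Z d) => hz; rewrite /hilbert_function -/I1 -/I2.
have := dimvS (subvf I1); have := dimvS (subvf I2).
set F := \dim {: dhomog 4 C (d + e)}; move: (\dim I1) (\dim I2) => a b; lia.
Qed.

Lemma hilbert_gt0 X d : X !=set0 -> (0 < hilbert_function X d)%N.
Proof.
move=> [p Xp]; rewrite subn_gt0 ltnNge; apply/negP => H.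
have : ideal_piece X d == fullv by rewrite eqEdim subvf.
move=> /eqP idE.
have [v v0 pv] := P3_generator p; have vp : v \in val p by rewrite pv memv_line.
have [i vi] : exists i, v 0 i != 0.
  apply/existsP; apply: contraNT v0; rewrite negb_exists => /forallP H0.
  by apply/eqP/rowP => i; rewrite mxE; apply/eqP; move: (H0 i); rewrite negbK.
have hX : ('X_i ^+ d : Poly) \is d.-homog.
  have := @dhomogMn 4 C mdeg 1 'X_i d; rewrite mul1n; apply.
  by rewrite dhomogX; apply/eqP; exact: mdeg1.
have : (DHomog hX : dhomog 4 C d) \in ideal_piece X d by rewrite idE memvf.
move=> /ideal_pieceP /(_ p Xp v vp) /=; rewrite -/(ev _ v) evXn evXU.
by move/eqP; rewrite expf_eq0 (negPf vi) andbF.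
Qed.

(** By induction on the chain: iterating hilbert_step along the powers of a form
    of degree E * e sums the values of the Hilbert function of the previous term of
    the chain, and the hockey stick identity sums the binomials. *)
Lemma chain_growth (Z : nat -> set (P3 R)) m :
  (forall i, (i <= m)%N -> zariski_closed (Z i) /\ irreducible_set (Z i)) ->
  (forall i, (i < m)%N -> Z i `<` Z i.+1) ->
  exists2 E, (0 < E)%N & forall n, ('C(n + m, m) <= hilbert_function (Z m) (E * n))%N.
Proof.
elim: m => [|m IH] HZ HS.
  exists 1%N => // n; rewrite bin0 hilbert_gt0 //.
  by have [_ []] := HZ 0%N (leqnn _).
have [||E E0 HE] := IH.
- by move=> i im; apply: HZ; apply: leqW.
- by move=> i im; apply: HS; apply: leqW.
have [[T [TF ZE]] irr'] := HZ m (leqW (leqnn _)).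
have [_ irr] := HZ m.+1 (leqnn _).
have [sub neq] := HS m (leqnn _).
have [g [Tg gZ]] : exists g, T g /\ ~ vanishes_on g (Z m.+1).
  apply: contrapT => /forallNP H; apply: neq => p Zp.
  rewrite ZE => g Tg; apply: contrapT => gp.
  by apply: (H g); split=> // gZ; apply: gp; apply: gZ.
have gZ' : vanishes_on g (Z m) by move=> p; rewrite ZE; apply.
have [e hg] := TF g Tg.
have e0 : (0 < e)%N.
  rewrite lt0n; apply/eqP => e0; subst e.
  have [[p Zp] _] := irr'; apply: gZ => q Zq v vq.
  have [w w0 pw] := P3_generator p; have wp : w \in val p by rewrite pw memv_line.
  rewrite -/(ev _ _) -(scale1r v).
  have := gZ' p Zp w wp; rewrite -/(ev _ _).
  have ev0 u : ev g u = ev g 0 by rewrite -(scale0r u) (ev_homog _ _ hg) expr0 mul1r.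
  by rewrite !ev0.
(* The power E makes the degree of gE a multiple of the step E of the previous
   term of the chain. *)
pose gE := g ^+ E; have hgE : gE \is (E * e).-homog by rewrite mulnC; apply: dhomogMn.
have gEv p v : v \in val p -> v != 0 -> gE.@[fun i => v 0 i] = 0 -> vanishes_at g p.
  move=> vp v0; rewrite -/(ev _ _) evXn => /eqP; rewrite expf_eq0 E0 /= => /eqP ?.
  exact/(vanishes_gen hg v0 vp).
have gEZ : ~ vanishes_on gE (Z m.+1).
  move=> H; apply: gZ => p Zp.
  have [v v0 pv] := P3_generator p; have vp : v \in val p by rewrite pv memv_line.
  by apply: (gEv p v vp v0); exact: (H p Zp v vp).
have gEZ' : vanishes_on gE (Z m).
  move=> p Zp v vp; rewrite -/(ev _ _) evXn.
  by rewrite (gZ' p Zp v vp : ev g v = 0) expr0n gtn_eqF.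
exists (E * e)%N; first by rewrite muln_gt0 E0.
elim=> [|n IHn]; first by rewrite binn hilbert_gt0 //; case: irr.
have -> : (E * e * n.+1 = E * e * n + E * e)%N by rewrite mulnS addnC.
apply: leq_trans (@hilbert_step _ _ (E * e * n)%N _ _ irr sub hgE gEZ' gEZ).
rewrite addSn binS; apply: leq_add => //; rewrite addnS -addSn.
rewrite -mulnSr -mulnA; apply: leq_trans (HE _).
apply: leq_bin2l; rewrite leq_add2r; exact: leq_pmull.
Qed.

Lemma has_chain_growth X m : has_chain X m ->
  exists2 E, (0 < E)%N & forall n, ('C(n + m, m) <= hilbert_function X (E * n))%N.
Proof.
move=> [Z [HZ HS]]; have [|E E0 HE] := @chain_growth Z m _ HS.
  by move=> i /HZ[].
exists E => // n; apply: (leq_trans (HE n)); apply: hilbert_mono.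
by have [] := HZ m (leqnn _).
Qed.

Lemma has_chainW X m k : (k <= m)%N -> has_chain X m -> has_chain X k.
Proof.
move=> km [Z [HZ HS]]; exists Z; split=> i ik.
  by apply: HZ; apply: leq_trans km.
by apply: HS; apply: leq_trans km.
Qed.

Lemma dimension_unique X m : has_chain X m -> ~ has_chain X m.+1 -> dimension X = m.
Proof.
move=> H1 H2; rewrite /dimension.
case: xgetP => [n -> [H3 H4]|/(_ m) []//].
apply/eqP; rewrite eqn_leq; apply/andP; split; rewrite leqNgt; apply/negP => lt.
  by apply: H2; apply: has_chainW H3.
by apply: H4; apply: has_chainW H1.
Qed.

(** Two polynomials that agree at all large integers are equal, so exhibiting one
    candidate determines the Hilbert polynomial. *)
Lemma hilbert_poly_unique X (P : {poly rat}) N :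
  (forall d, (N <= d)%N -> P.[d%:R] = (hilbert_function X d)%:R) ->
  hilbert_poly X = P.
Proof.
move=> HP; rewrite /hilbert_poly.
case: xgetP => [Q _ [M HQ]|/(_ P) []]; last by exists N.
apply/eqP; rewrite -subr_eq0; apply: contraT => nonzero_coef.
pose s := [seq (i + maxn M N)%:R : rat | i <- iota 0 (size (Q - P))].
have := @max_poly_roots _ (Q - P) s nonzero_coef.
rewrite size_map size_iota ltnn; apply.
  apply/allP => x /mapP[i _ ->]; rewrite rootE hornerD hornerN.
  by rewrite HP ?HQ ?subrr // (leq_trans _ (leq_addl _ _)) ?leq_maxl ?leq_maxr.
rewrite map_inj_uniq ?iota_uniq // => i j /eqP.
by rewrite eqr_nat eqn_add2r => /eqP.
Qed.

Definition dim_deg X (m : nat) (d : nat) :=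
  dimension X = m /\ degree X = d%:R.

(** A chain of length two would make the Hilbert function grow quadratically. *)
Lemma curve_dim_deg X a b N : (0 < a)%N -> has_chain X 1 ->
  (forall d, (N <= d)%N -> hilbert_function X d = (a * d + b)%N) ->
  dim_deg X 1 a.
Proof.
move=> a0 c1 hX.
have dX : dimension X = 1%N.
  apply: dimension_unique => // /has_chain_growth[E E0].
  (* At this argument n, (n + 2)(n + 1) / 2 exceeds a E n + b. *)
  move=> /(_ (N + 2 * a * E + 2 * b)%N).
  rewrite hX; last by rewrite (leq_trans _ (leq_pmull _ E0)) // -addnA leq_addr.
  set n := (_ + 2 * b)%N; rewrite leqNgt => /negP; apply.
  rewrite -(ltn_pmul2r (isT : 0 < 2)%N).
  have -> : ('C(n + 2, 2) * 2 = (n + 2) * (n + 1))%N.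
    by rewrite addn2 addn1 mulnC -(mul_bin_diag n.+2 1) bin1.
  rewrite /n; nia.
split=> //; rewrite /degree dX.
rewrite (@hilbert_poly_unique X (a%:R *: 'X + b%:R%:P) N); last first.
  by move=> d /hX->; rewrite !hornerE natrD natrM.
rewrite lead_coefDl ?lead_coefZ ?lead_coefX ?mulr1 ?mul1r //.
rewrite size_scale ?pnatr_eq0 -?lt0n // size_polyX size_polyC.
by case: (_ == 0).
Qed.

(** The Hilbert function is that of a plane; a chain of length three would make it
    grow cubically. *)
Lemma surface_dim_deg X : has_chain X 2 ->
  (forall d, hilbert_function X d = 'C(d + 2, 2)) ->
  dim_deg X 2 1.
Proof.
move=> c1 hX.
have bin2n n : ('C(n + 2, 2) * 2 = (n + 2) * (n + 1))%N.
  by rewrite addn2 addn1 mulnC -(mul_bin_diag n.+2 1) bin1.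
have dX : dimension X = 2%N.
  apply: dimension_unique => // /has_chain_growth[E E0].
  (* At this argument n, (n + 3)(n + 2)(n + 1) / 6 exceeds (E n + 2)(E n + 1) / 2. *)
  move=> /(_ (9 * E * E)%N).
  rewrite hX; set n := (9 * E * E)%N; rewrite leqNgt => /negP; apply.
  rewrite -(ltn_pmul2r (isT : 0 < 6)%N).
  have -> : ('C(n + 3, 3) * 6 = (n + 3) * ((n + 2) * (n + 1)))%N.
    rewrite -bin2n addn3 addn2; have := mul_bin_diag n.+3 2; rewrite /=; lia.
  have := bin2n (E * n)%N; rewrite /n; nia.
split=> //; rewrite /degree dX.
rewrite (@hilbert_poly_unique X (2^-1 *: (('X + 2%:P) * ('X + 1%:P))) 0); last first.
  move=> d _; rewrite hX hornerZ hornerM !hornerD hornerX !hornerC.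
  apply: (@mulIf _ 2) => //; rewrite -natrM bin2n natrM !natrD.
  by field.
by rewrite lead_coefZ lead_coefM !lead_coefXaddC !mulr1.
Qed.

End Hilbert.

(** * Linear changes of coordinates *)

Section Transport.
Variable R : realType.
Local Notation C := R[i].
Local Notation V := 'rV[C]_4.
Local Notation Poly := {mpoly C[4]}.
Implicit Types (g h : Poly) (v w : V) (S : V -> Prop) (p : P3 R).
Implicit Types (X Y Z : set (P3 R)) (A : 'M[C]_4).

Lemma poly_fun0 (q : {poly C}) : (forall t, q.[t] = 0) -> q = 0.
Proof.
move=> H; apply/eqP; apply: contraT => nonzero_coef.
pose s := [seq i%:R : C | i <- iota 0 (size q)].
have := @max_poly_roots _ q s nonzero_coef; rewrite size_map size_iota ltnn; apply.
  by apply/allP => x _; rewrite rootE H.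
by rewrite map_inj_uniq ?iota_uniq // => i j /eqP; rewrite eqr_nat => /eqP.
Qed.

Lemma digits_inj N a b c d : (a < N)%N -> (c < N)%N ->
  (a + N * b = c + N * d)%N -> a = c /\ b = d.
Proof.
move=> aN cN E; have ac : a = c.
  have := congr1 (modn^~ N) E.
  by rewrite ![(N * _)%N]mulnC ![(_ + _ * N)%N]addnC !modnMDl !modn_small.
split=> //; move: E; rewrite ac => /addnI /eqP; rewrite eqn_mul2l.
by case/orP => /eqP //; lia.
Qed.

(** Kronecker substitution: putting t to the power N^i for the i-th variable, with
    N larger than all exponents, sends distinct monomials to distinct powers of
    t, which reduces the claim to one variable. *)
Lemma ev_eq0 g : (forall v, ev g v = 0) -> g = 0.
Proof.
move=> H; pose N := msize g; pose i0 : 'I_4 := 0; pose i1 : 'I_4 := 1.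
pose i2 : 'I_4 := 2; pose i3 : 'I_4 := 3.
pose wt (e : 'I_4 -> nat) := (e i0 + N * (e i1 + N * (e i2 + N * e i3)))%N.
have bnd m i : m \in msupp g -> (m i < N)%N.
  move=> /msize_mdeg_lt; apply: leq_ltn_trans; rewrite mdegE (bigD1 i) //=.
  exact: leq_addr.
have E4 (f h : 'I_4 -> nat) : f i0 = h i0 -> f i1 = h i1 -> f i2 = h i2 ->
    f i3 = h i3 -> f =1 h.
  move=> e0 e1 e2 e3 [[|[|[|[|//]]]] lti].
  - by rewrite (_ : Ordinal lti = i0) //; apply: val_inj.
  - by rewrite (_ : Ordinal lti = i1) //; apply: val_inj.
  - by rewrite (_ : Ordinal lti = i2) //; apply: val_inj.
  - by rewrite (_ : Ordinal lti = i3) //; apply: val_inj.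
have wtI m m' : m \in msupp g -> m' \in msupp g -> wt m = wt m' -> m = m'.
  move=> mg m'g; rewrite /wt.
  case/digits_inj; try exact: bnd.
  move=> e0 /digits_inj[]; try exact: bnd.
  move=> e1 /digits_inj[]; try exact: bnd.
  by move=> e2 e3; apply/mnmP; apply: E4.
pose w (i : 'I_4) := [eta (fun=> 0%N) with i0 |-> 1%N, i1 |-> N, i2 |-> (N * N)%N, i3 |-> (N * N
    * N)%N] i.
pose q : {poly C} := \sum_(m <- msupp g) g@_m *: 'X^(wt m).
have q0 : q = 0.
  apply: poly_fun0 => t; have := H (\row_i t ^+ w i); rewrite evE => <-.
  rewrite horner_sum; apply: eq_bigr => m _.
  rewrite hornerZ hornerXn evX; congr (_ * _).
  rewrite (eq_bigr (fun i => t ^+ (w i * m i))); last by move=> i _; rewrite mxE exprM.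
  rewrite prodrXr; congr (_ ^+ _).
  rewrite !big_ord_recl big_ord0 /w /=.
  rewrite /wt.
  have -> : lift ord0 ord0 = i1 by apply: val_inj.
  have -> : lift ord0 (lift ord0 ord0) = i2 by apply: val_inj.
  have -> : lift ord0 (lift ord0 (lift ord0 ord0)) = i3 by apply: val_inj.
  by rewrite (_ : ord0 = i0) //=; ring.
apply/mpolyP => m; rewrite mcoeff0; apply/eqP; apply: contraT.
rewrite -mcoeff_msupp => mg; move: (congr1 (fun q1 : {poly C} => q1`_(wt m)) q0).
rewrite coef0 coef_sum (bigD1_seq m) //= coefZ coefXn eqxx mulr1.
rewrite big_seq_cond big1 ?addr0 => [E|m' /andP[m'g ne]].
  by rewrite mcoeff_msupp E eqxx in mg.
rewrite coefZ coefXn; case: eqP => [/wtI E|]; last by rewrite mulr0.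
by rewrite E ?eqxx in ne.
Qed.

(** Composition of g with the linear map v |-> v *m A (see ev_linear_subst). *)
Definition linear_subst A g : Poly :=
  g \mPo [tuple \sum_k A k j *: 'X_k | j < 4].

Lemma ev_linear_subst A g v : ev (linear_subst A g) v = ev g (v *m A).
Proof.
rewrite /ev /linear_subst comp_mpoly_meval; apply: meval_eq => j.
rewrite tnth_mktuple raddf_sum mxE; apply: eq_bigr => k _.
by rewrite /= mevalZ mevalXU mulrC.
Qed.

Lemma dhomog_prod_seq (I : Type) (r : seq I) (d : I -> nat) (F : I -> Poly) :
  (forall i, F i \is (d i).-homog) ->
  \prod_(i <- r) F i \is (\sum_(i <- r) d i).-homog.
Proof.
move=> H; elim: r => [|i r IH]; first by rewrite !big_nil dhomog1.
by rewrite !big_cons; apply: dhomogM.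
Qed.

Lemma linear_homog (a : 'I_4 -> C) : (\sum_k a k *: 'X_k : Poly) \is 1.-homog.
Proof.
apply: rpred_sum => k _; apply: rpredZ; rewrite dhomogX.
by apply/eqP; exact: mdeg1.
Qed.

Lemma linear_subst_homog A d g : g \is d.-homog -> linear_subst A g \is d.-homog.
Proof.
move=> /dhomogP hg; rewrite /linear_subst comp_mpolyEX big_seq.
apply: rpred_sum => m /hg hm; apply: rpredZ.
rewrite comp_mpolyX -(hm : mdeg m = d) mdegE.
apply: dhomog_prod_seq => i; rewrite tnth_mktuple.
by have := dhomogMn (m i) (linear_homog (A^~ i)); rewrite mul1n.
Qed.

Definition mulmx_fun A : 'End(V) := linfun (mulmxr A).

Lemma act_proof A (hA : A \in unitmx) p : \dim (mulmx_fun A @: val p) == 1%N.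
Proof.
rewrite limg_dim_eq; first exact: (valP p).
apply/eqP; rewrite -subv0; apply/subvP => v /memv_capP[_].
rewrite memv_ker lfunE /= => /eqP H.
by rewrite -(mulmxK hA v) H mul0mx mem0v.
Qed.

(** The projective transformation induced by v |-> v *m A. *)
Definition act A (hA : A \in unitmx) p : P3 R :=
  exist (fun L : {vspace V} => \dim L == 1%N) _ (act_proof hA p).

Lemma mem_act A (hA : A \in unitmx) p v :
  (v *m A \in val (act hA p)) = (v \in val p).
Proof.
apply/idP/idP => [/memv_imgP[w wp]|vp].
  by rewrite lfunE /= => /(can_inj (mulmxK hA))->.
by apply/memv_imgP; exists v => //; rewrite lfunE.
Qed.

Lemma vanishes_linear_subst A (hA : A \in unitmx) g p :
  vanishes_at (linear_subst A g) p <-> vanishes_at g (act hA p).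
Proof.
split=> H v vp; last by rewrite -/(ev _ _) ev_linear_subst; apply: H; rewrite mem_act.
have := H (v *m invmx A); rewrite -/(ev _ _) ev_linear_subst mulmxKV //; apply.
by rewrite -(mem_act hA) mulmxKV.
Qed.

Definition preim_act A (hA : A \in unitmx) X : set (P3 R) := fun p => X (act hA p).

Lemma act_inv A (hA : A \in unitmx) (hI : invmx A \in unitmx) p :
  act hA (act hI p) = p.
Proof.
apply: val_inj; apply/vspaceP => v.
by rewrite -(mulmxKV hA v) mem_act mem_act mulmxKV.
Qed.

Lemma inv_act A (hA : A \in unitmx) (hI : invmx A \in unitmx) p :
  act hI (act hA p) = p.
Proof.
apply: val_inj; apply/vspaceP => v.
by rewrite -{1}(mulmxK hA v) mem_act mem_act.
Qed.

Lemma pre_proj A (hA : A \in unitmx) S :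
  preim_act hA (proj S) = proj (fun v => S (v *m A)).
Proof.
apply/seteqP; split=> p Sp v.
  by rewrite -(mem_act hA); apply: Sp.
by rewrite -(mulmxKV hA v) mem_act; apply: Sp.
Qed.

Lemma pre_inv A (hA : A \in unitmx) (hI : invmx A \in unitmx) X :
  preim_act hI (preim_act hA X) = X.
Proof. by apply/funext => p; rewrite /preim_act act_inv. Qed.

Lemma closed_pre A (hA : A \in unitmx) X : zariski_closed X -> zariski_closed (preim_act hA X).
Proof.
move=> [T [TF ->]]; exists [set linear_subst A g | g in T]; split.
  by move=> _ [g /TF[d hd] <-]; exists d; apply: linear_subst_homog.
apply/seteqP; split=> p /= H.
  by move=> _ [g Tg <-]; apply/(vanishes_linear_subst hA); apply: H.
by move=> g Tg; apply/(vanishes_linear_subst hA); apply: H; exists g.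
Qed.

Lemma irreducible_pre A (hA : A \in unitmx) X :
  irreducible_set X -> irreducible_set (preim_act hA X).
Proof.
have hI : invmx A \in unitmx by rewrite unitmx_inv.
move=> [[p Xp] irr]; split; first by exists (act hI p); rewrite /preim_act act_inv.
move=> B1 B2 c1 c2 sub.
have [|H|H] := irr _ _ (closed_pre hI c1) (closed_pre hI c2).
- by move=> q Xq; apply: sub; rewrite /preim_act act_inv.
- by left=> q /H; rewrite /preim_act inv_act.
- by right=> q /H; rewrite /preim_act inv_act.
Qed.

Lemma chain_pre A (hA : A \in unitmx) X m : has_chain X m -> has_chain (preim_act hA X) m.
Proof.
move=> [Z [HZ HS]]; exists (fun i => preim_act hA (Z i)); split=> i im.
  have [c irr sub] := HZ i im; split; first exact: closed_pre.
    exact: irreducible_pre.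
  by move=> p /sub.
have [sub nsub] := HS i im; split; first by move=> p /sub.
have hI : invmx A \in unitmx by rewrite unitmx_inv.
by move=> H; apply: nsub => p; rewrite -(act_inv hA hI p); apply: H.
Qed.

(** Substitution maps the forms vanishing on X injectively to those vanishing on
    its preimage.  Applied to the inverse matrix as well, it gives equality. *)
Lemma ideal_pre A (hA : A \in unitmx) X d :
  (\dim (ideal_piece X d) <= \dim (ideal_piece (preim_act hA X) d))%N.
Proof.
pose s (u : dhomog 4 C d) : dhomog 4 C d := DHomog (linear_subst_homog A (valP u)).
have s_lin : linear s.
  move=> a u v; apply: val_inj.
  change (linear_subst A (a *: (u : Poly) + (v : Poly)) =
          a *: linear_subst A (u : Poly) + linear_subst A (v : Poly)).
  by rewrite /linear_subst comp_mpolyD comp_mpolyZ.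
have [f fs] := linfun_ex s_lin.
have inj : (ideal_piece X d :&: lker f)%VS = 0%VS.
  apply/eqP; rewrite -subv0; apply/subvP => u /memv_capP[_].
  rewrite memv_ker fs => /eqP su0; rewrite memv0; apply/eqP/val_inj => /=.
  apply: ev_eq0 => v; rewrite -(mulmxKV hA v) -ev_linear_subst.
  have -> : linear_subst A (mpoly_of_dhomog u) = 0 by exact: (congr1 (@mpoly_of_dhomog _ _ _)
      su0).
  exact: meval0.
rewrite -(limg_dim_eq inj); apply/dimvS/subvP => _ /memv_imgP[u /ideal_pieceP H ->].
apply/ideal_pieceP => p Xp; rewrite fs; apply/(vanishes_linear_subst hA).
exact: H.
Qed.

Lemma hilbert_pre A (hA : A \in unitmx) X d :
  hilbert_function (preim_act hA X) d = hilbert_function X d.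
Proof.
have hI : invmx A \in unitmx by rewrite unitmx_inv.
rewrite /hilbert_function; congr (_ - _)%N; apply/eqP.
rewrite eqn_leq ideal_pre andbT -{2}(pre_inv hA hI X).
exact: ideal_pre.
Qed.

Lemma dim_deg_transport S A m d : A \in unitmx ->
  dim_deg (proj S) m d -> dim_deg (proj (fun v => S (v *m A))) m d.
Proof.
move=> hA; rewrite -(pre_proj hA).
have hI : invmx A \in unitmx by rewrite unitmx_inv.
have dE : dimension (preim_act hA (proj S)) = dimension (proj S).
  rewrite /dimension; congr (xget _ _); apply/funext => n /=.
  suff E k : has_chain (preim_act hA (proj S)) k <-> has_chain (proj S) k.
    by rewrite (propext (E n)) (propext (E n.+1)).
  split=> H; last exact: chain_pre.
  by rewrite -(pre_inv hA hI (proj S)); apply: chain_pre.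
have hpolyE : hilbert_poly (preim_act hA (proj S)) = hilbert_poly (proj S).
  rewrite /hilbert_poly; congr (xget _ _); apply/funext => P /=.
  apply/propext; split=> -[N HN]; exists N => k /HN.
    by rewrite hilbert_pre.
  by rewrite hilbert_pre.
by rewrite /dim_deg /degree dE hpolyE.
Qed.

End Transport.

(** * Planes, lines and conics: irreducibility and chains *)

Section Models.
Variable R : realType.
Local Notation C := R[i].
Local Notation V := 'rV[C]_4.
Local Notation Poly := {mpoly C[4]}.
Implicit Types (g h : Poly) (v w : V) (S : V -> Prop) (p : P3 R).
Implicit Types (X Y Z : set (P3 R)) (A : 'M[C]_4).

Lemma ord4P (P : 'I_4 -> Prop) : P 0 -> P 1 -> P 2 -> P 3 -> forall i, P i.
Proof.
move=> p0 p1 p2 p3 [[|[|[|[|//]]]] lti].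
- by rewrite (_ : Ordinal lti = 0) //; apply: val_inj.
- by rewrite (_ : Ordinal lti = 1) //; apply: val_inj.
- by rewrite (_ : Ordinal lti = 2) //; apply: val_inj.
- by rewrite (_ : Ordinal lti = 3) //; apply: val_inj.
Qed.

Lemma big4 (T : Type) (x : T) (op : Monoid.law x) (F : 'I_4 -> T) :
  \big[op/x]_(i < 4) F i = op (op (op (F 0) (F 1)) (F 2)) (F 3).
Proof.
rewrite !big_ord_recl big_ord0 Monoid.mulm1 !Monoid.mulmA.
by congr (op (op (op (F _) (F _)) (F _)) (F _)); apply: val_inj.
Qed.

Definition hornerEs := (@hornerD C, @hornerN C, @hornerM C, @hornerZ C, @hornerX C, @hornerC C,
    @horner_exp C, @horner0 C).

Definition vec (a b c d : C) : V := \row_i [:: a; b; c; d]`_i.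

Lemma vec0 a b c d : vec a b c d 0 0 = a. Proof. by rewrite mxE. Qed.
Lemma vec1 a b c d : vec a b c d 0 1 = b. Proof. by rewrite mxE. Qed.
Lemma vec2 a b c d : vec a b c d 0 2 = c. Proof. by rewrite mxE. Qed.
Lemma vec3 a b c d : vec a b c d 0 3 = d. Proof. by rewrite mxE. Qed.
Definition vecE := (vec0, vec1, vec2, vec3).

Lemma vecP v w : v 0 0 = w 0 0 -> v 0 1 = w 0 1 -> v 0 2 = w 0 2 ->
  v 0 3 = w 0 3 -> v = w.
Proof. by move=> e0 e1 e2 e3; apply/rowP; apply: ord4P. Qed.

Lemma vec_eta v : v = vec (v 0 0) (v 0 1) (v 0 2) (v 0 3).
Proof. by apply: vecP; rewrite vecE. Qed.

Lemma vecD x y z t x' y' z' t' :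
  vec x y z t + vec x' y' z' t' = vec (x + x') (y + y') (z + z') (t + t').
Proof. by apply: vecP; rewrite mxE !vecE. Qed.

Lemma evX4 (m : 'X_{1..4}) v : ev 'X_[m] v =
  v 0 0 ^+ m 0 * v 0 1 ^+ m 1 * v 0 2 ^+ m 2 * v 0 3 ^+ m 3.
Proof. by rewrite evX big4. Qed.

Lemma mdeg4 (m : 'X_{1..4}) : mdeg m = (m 0%R + m 1%R + m 2%R + m 3%R)%N.
Proof. by rewrite mdegE big4. Qed.

Lemma XnU_homog (i : 'I_4) n : ('X_i ^+ n : Poly) \is n.-homog.
Proof.
have := @dhomogMn 4 C mdeg 1 'X_i n; rewrite mul1n; apply.
rewrite dhomogX; apply/eqP; exact: mdeg1.
Qed.

Lemma poly_nonroot (q : {poly C}) : q != 0 -> exists t, q.[t] != 0.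
Proof.
move=> q0; apply: contrapT => H; move/negP: q0; apply; apply/eqP.
apply: poly_fun0 => t; apply/eqP; apply: contrapT => qt; apply: H.
by exists t; apply/negP.
Qed.

(** The restriction of g to the polynomial curve c, as a polynomial in the
    parameter. *)
Definition along g (c : 'I_4 -> {poly C}) : {poly C} :=
  \sum_(m <- msupp g) g@_m *: \prod_i c i ^+ m i.

Lemma alongE g c t : (along g c).[t] = ev g (\row_i (c i).[t]).
Proof.
rewrite horner_sum evE; apply: eq_bigr => m _.
rewrite hornerZ evX horner_prod; congr (_ * _); apply: eq_bigr => i _.
by rewrite horner_exp mxE.
Qed.

(** A set is irreducible if any two of its points lie on a polynomial curve
    inside it.  If X is in neither of two closed sets, take a form of each that is
    nonzero at some point of X; along a curve through the two points, both restrict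
    to nonzero polynomials, so at some parameter both are nonzero.  The factor c i in
    the proof avoids parameters where the curve passes through the origin. *)
Lemma irreducible_curves S : cone S -> (exists2 v, v != 0 & S v) ->
  (forall v w, v != 0 -> w != 0 -> S v -> S w ->
     exists c : 'I_4 -> {poly C}, [/\ forall t, S (\row_i (c i).[t]),
        \row_i (c i).[0] = v & \row_i (c i).[1] = w]) ->
  irreducible_set (proj S).
Proof.
move=> cS [u u0 Su] Hc; split.
  by exists (point_of u0); apply/proj_point.
move=> _ _ [TA [FA ->]] [TB [FB ->]] sub.
have wit T : T `<=` @Defs.form R ->
    ~ (proj S `<=` [set p | forall g, T g -> vanishes_at g p]) ->
    exists g v, [/\ T g, v != 0, S v & ev g v != 0].
  move=> FT /existsNP[p /not_implyP[Sp /existsNP[g /not_implyP[Tg gp]]]].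
  have [v v0 pv] := P3_generator p; have vp : v \in val p by rewrite pv memv_line.
  exists g, v; split=> //; first exact: Sp.
  by apply/negP => /eqP H; apply: gp; have [d hd] := FT g Tg; apply/(vanishes_gen hd v0 vp).
apply: contrapT => /not_orP[/(wit _ FA)[g [v [Tg v0 Sv gv]]]].
move=> /(wit _ FB)[h [w [Th w0 Sw hw]]].
have [c [Sc c0 c1]] := Hc v w v0 w0 Sv Sw.
have [i vi] : exists i, v 0 i != 0.
  apply/existsP; apply: contraNT v0; rewrite negb_exists => /forallP H0.
  by apply/eqP/rowP => i; rewrite mxE; apply/eqP; move: (H0 i); rewrite negbK.
have [t] : exists t, (along g c * along h c * c i).[t] != 0.
  apply: poly_nonroot; rewrite !mulf_neq0 //.
  - by apply: contraNneq gv => E; rewrite -c0 -alongE E horner0.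
  - by apply: contraNneq hw => E; rewrite -c1 -alongE E horner0.
  by apply: contraNneq vi => E; rewrite -c0 mxE E horner0.
rewrite !hornerM !alongE !mulf_eq0 !negb_or => /andP[/andP[gt ht] ct].
pose x : V := \row_i (c i).[t].
have x0 : x != 0 by apply: contraNneq ct => /rowP/(_ i); rewrite !mxE => ->.
have xp : x \in val (point_of x0) by rewrite memv_line.
case: (sub (point_of x0)); first by apply/proj_point => //; apply: Sc.
  by move=> /(_ g Tg x xp) H; move/eqP: gt; apply.
by move=> /(_ h Th x xp) H; move/eqP: ht; apply.
Qed.

Definition coord_subspace (I : pred 'I_4) v := forall i, ~~ I i -> v 0 i = 0.

Lemma cone_coord I : cone (coord_subspace I).
Proof. by move=> a v H i /H vi; rewrite mxE vi mulr0. Qed.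

Lemma closed_coord I : zariski_closed (proj (coord_subspace I)).
Proof.
apply: (@closed_proj _ _ [set 'X_i | i in [set i | ~~ I i]]).
  by move=> _ [i _ <-]; exists 1%N; have := XnU_homog i 1; rewrite expr1.
move=> v; split=> [H _ [i Ii <-]|H i Ii]; first by rewrite evXU H.
by rewrite -evXU; apply: H; exists i.
Qed.

Lemma delta_neq0 (i : 'I_4) : delta_mx 0 i != 0 :> V.
Proof.
by apply/eqP => /rowP/(_ i); rewrite !mxE !eqxx => /eqP; rewrite oner_eq0.
Qed.

Lemma coord_delta (I : pred 'I_4) i : I i -> coord_subspace I (delta_mx 0 i).
Proof.
by move=> Ii j; rewrite mxE eqxx /=; case: eqP => [->|//]; rewrite Ii.
Qed.

Lemma irreducible_coord (I : pred 'I_4) i : I i -> irreducible_set (proj (coord_subspace I)).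
Proof.
move=> Ii; apply: irreducible_curves; first exact: cone_coord.
  exists (delta_mx 0 i); [exact: delta_neq0|exact: coord_delta].
move=> v w _ _ Sv Sw.
exists (fun i => (v 0 i)%:P + (w 0 i - v 0 i) *: 'X); split.
- move=> t j Ij; rewrite mxE !hornerEs /= Sv // Sw //; ring.
- by apply/rowP => j; rewrite mxE !hornerEs; ring.
- by apply/rowP => j; rewrite mxE !hornerEs; ring.
Qed.

Lemma coord_lt (I J : pred 'I_4) j : (forall i, I i -> J i) -> J j -> ~~ I j ->
  proj (coord_subspace I) `<` proj (coord_subspace J).
Proof.
move=> IJ Jj Ij; split.
  by move=> p Ip v /Ip Iv i Ji; apply: Iv; apply: contra Ji; apply: IJ.
move=> H; have : proj (coord_subspace J) (point_of (delta_neq0 j)).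
  by apply/proj_point; [exact: cone_coord|exact: coord_delta].
move/H/proj_point => /(_ (@cone_coord I)) /(_ j Ij).
by rewrite mxE !eqxx => /eqP; rewrite oner_eq0.
Qed.

(** The union of the lines joining the last coordinate point to the first k of the
    other three coordinate points. *)
Definition lines k v :=
  (forall i j : 'I_4, (i < 3)%N -> (j < 3)%N -> i != j -> v 0 i * v 0 j = 0) /\
  (forall i : 'I_4, (k <= i < 3)%N -> v 0 i = 0).

Definition plane v := v 0 2 = 0.

(** A smooth conic in the plane v 0 0 = 0, together with the first coordinate point,
    which lies off that plane, when b holds. *)
Definition conic (b : bool) v :=
  (v 0 0 = 0 /\ v 0 2 ^+ 2 = v 0 1 * v 0 3) \/
  [/\ b, v 0 1 = 0, v 0 2 = 0 & v 0 3 = 0].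

Lemma cone_lines k : cone (lines k).
Proof.
move=> a v [H1 H2]; split=> [i j i3 j3 ij|i ik]; last by rewrite mxE H2 ?mulr0.
by rewrite !mxE mulrACA H1 ?mulr0.
Qed.

Lemma cone_plane : cone plane.
Proof. by move=> a v H; rewrite /plane mxE H mulr0. Qed.

Lemma cone_conic b : cone (conic b).
Proof.
move=> a v [[H1 H2]|[H1 H2 H3 H4]]; [left|right]; last first.
  by split; rewrite ?mxE ?H2 ?H3 ?H4 ?mulr0.
by split; rewrite !mxE ?H1 ?mulr0 // exprMn H2; ring.
Qed.

Lemma chain_lines k : (0 < k)%N -> has_chain (proj (lines k)) 1.
Proof.
move=> k0; pose J := pred2 (0 : 'I_4) 3; pose I := pred1 (3 : 'I_4).
have sub : proj (coord_subspace J) `<=` proj (lines k).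
  move=> p Jp v /Jp Jv; split=> [|i /andP[ki i3]].
    elim/ord4P; elim/ord4P => //= _ _ _;
    by rewrite ?(Jv 1) ?(Jv 2) ?mul0r ?mulr0.
  apply: Jv; apply/negP => /orP[]/eqP E; last by rewrite E in i3.
  by move: ki; rewrite E leqNgt k0.
exists (fun i => if i is 0 then proj (coord_subspace I) else proj (coord_subspace J)); split.
  move=> [|[|//]] _.
    split; [exact: closed_coord|exact: (@irreducible_coord I 3)|].
    by move=> p Ip; apply: sub => v /Ip Iv i Ji; apply: Iv; apply: contra Ji => /eqP->.
  by split; [exact: closed_coord|exact: (@irreducible_coord J 0)|].
move=> [|//] _; apply: (@coord_lt _ _ 0) => // i /eqP->.
by rewrite /= ?orbT.
Qed.

Lemma chain_plane : has_chain (proj plane) 2.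
Proof.
pose I0 := pred1 (3 : 'I_4); pose I1 := pred2 (0 : 'I_4) 3.
pose I2 := pred3 (0 : 'I_4) 1 3.
pose I n := match n with 0 => I0 | 1 => I1 | _ => I2 end.
exists (fun i => proj (coord_subspace (I i))); split=> i ile.
  split; [exact: closed_coord| |].
    by apply: (@irreducible_coord _ 3); case: i ile => [|[|[|//]]].
  by move=> p Ip v /Ip; apply; case: i ile {Ip} => [|[|[|//]]].
case: i ile => [|[|//]] _.
  by apply: (@coord_lt _ _ 0) => // i /eqP->; rewrite /= ?orbT.
apply: (@coord_lt _ _ 1) => // i /orP[] /eqP->; by rewrite /= ?orbT.
Qed.

(** Square roots make the usual parametrization of the conic surjective on
    vectors, not only on points. *)
Lemma conic_param v : v 0 0 = 0 -> v 0 2 ^+ 2 = v 0 1 * v 0 3 ->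
  exists s t, v = vec 0 (s ^+ 2) (s * t) (t ^+ 2).
Proof.
move=> v0 vc.
have [v1|v1] := eqVneq (v 0 1) 0.
  exists 0, (sqrtC (v 0 3)); apply: vecP; rewrite vecE ?v0 ?v1 ?sqrtCK //; first by ring.
  by apply/eqP; rewrite mul0r -sqrf_eq0 vc v1 mul0r.
exists (sqrtC (v 0 1)), (v 0 2 / sqrtC (v 0 1)).
have s0 : sqrtC (v 0 1) != 0 by rewrite sqrtC_eq0.
apply: vecP; rewrite vecE ?v0 ?sqrtCK //; first by field.
by rewrite expr_div_n sqrtCK vc; field.
Qed.

Lemma closed_conic : zariski_closed (proj (conic false)).
Proof.
apply: (@closed_proj _ _ [set 'X_0; 'X_2 ^+ 2 - 'X_1 * 'X_3]).
  move=> _ [->|->]; first by exists 1%N; have := XnU_homog 0 1; rewrite expr1.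
  exists 2%N; apply: rpredB; first exact: XnU_homog.
  have := dhomogM (XnU_homog 1 1) (XnU_homog 3 1); by rewrite !expr1.
move=> v; split.
  move=> [[v0 vc]|[//]] _ [->|->]; first by rewrite evXU.
  by rewrite evB evXn evM !evXU vc subrr.
move=> H; left; split; first by rewrite -evXU; apply: H; left.
apply/eqP; rewrite -subr_eq0; apply/eqP.
by have <- := H ('X_2 ^+ 2 - 'X_1 * 'X_3) (or_intror erefl); rewrite evB evXn evM !evXU.
Qed.

Lemma irreducible_conic : irreducible_set (proj (conic false)).
Proof.
apply: irreducible_curves; first exact: cone_conic.
  exists (delta_mx 0 1); first exact: delta_neq0.
  by left; split; rewrite !mxE //= expr0n mulr0.
move=> v w _ _ [[v0 vc]|[]//] [[w0 wc]|[]//].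
have [s [t vE]] := conic_param v0 vc; have [s' [t' wE]] := conic_param w0 wc.
pose S := s%:P + (s' - s) *: 'X; pose T := t%:P + (t' - t) *: 'X.
exists (fun i => [:: 0; S ^+ 2; S * T; T ^+ 2]`_i).
split=> [x||].
- by left; split; rewrite !mxE /= !hornerEs //; ring.
- by rewrite vE; apply: vecP; rewrite vecE !mxE /= /S /T !hornerEs //; ring.
- by rewrite wE; apply: vecP; rewrite vecE !mxE /= /S /T !hornerEs //; ring.
Qed.

Lemma chain_conic b : has_chain (proj (conic b)) 1.
Proof.
pose I := pred1 (1 : 'I_4).
have subI : proj (coord_subspace I) `<=` proj (conic false).
  move=> p Ip v /Ip Iv; left; split; first exact: Iv.
  by rewrite !(Iv 2, Iv 3) // expr0n mulr0.
have sub : proj (conic false) `<=` proj (conic b).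
  by move=> p Ip v /Ip [H|[]//]; left.
exists (fun i => if i is 0 then proj (coord_subspace I) else proj (conic false)); split.
  move=> [|[|//]] _.
    split; [exact: closed_coord|exact: (@irreducible_coord I 1)|].
    by move=> p /subI /sub.
  by split; [exact: closed_conic|exact: irreducible_conic|].
move=> [|//] _; split=> // H.
have : proj (conic false) (point_of (delta_neq0 3)).
  by apply/proj_point; [exact: cone_conic|left; split; rewrite !mxE //= expr0n mul0r].
move/H/proj_point => /(_ (@cone_coord I)) /(_ 3 isT).
by rewrite mxE !eqxx => /eqP; rewrite oner_eq0.
Qed.

End Models.

(** * Planes, lines and conics: Hilbert functions *)

Section ModelsHilbert.
Variable R : realType.
Local Notation C := R[i].
Local Notation V := 'rV[C]_4.
Local Notation Poly := {mpoly C[4]}.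
Implicit Types (g h : Poly) (v w : V) (S : V -> Prop).

(** The tool for proving monomials independent on a locus: along a suitable
    curve in it they become distinct powers of the parameter. *)
Lemma powers_indep (J : finType) (D : pred J) (e : J -> nat) (c : J -> C) :
  {in D &, injective e} ->
  (forall t, \sum_(j | D j) c j * t ^+ e j = 0) -> forall j, D j -> c j = 0.
Proof.
move=> e_inj H j Dj; pose q : {poly C} := \sum_(j | D j) c j *: 'X^(e j).
have q0 : q = 0.
  apply: poly_fun0 => t; rewrite -[RHS](H t) horner_sum.
  by apply: eq_bigr => i _; rewrite hornerZ hornerXn.
move: (congr1 (fun q1 : {poly C} => q1`_(e j)) q0).
rewrite coef0 coef_sum (bigD1 j) //= coefZ coefXn eqxx mulr1 big1 ?addr0 //.
move=> i /andP[Di ne]; rewrite coefZ coefXn; case: eqP => [/e_inj E|].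
  by rewrite E ?eqxx in ne.
by rewrite mulr0.
Qed.

Lemma hilbert_proj S d (J : finType) (b : J -> Poly) : cone S ->
  (forall j, b j \is d.-homog) ->
  (forall m, mdeg m = d ->
    (forall v, S v -> ev 'X_[m] v = 0) \/
    (exists j, forall v, S v -> ev 'X_[m] v = ev (b j) v)) ->
  (forall c : J -> C,
     (forall v, v != 0 -> S v -> \sum_j c j * ev (b j) v = 0) ->
     forall j, c j = 0) ->
  hilbert_function (proj S) d = #|J|.
Proof.
move=> cS hb gen ind; apply: (hilbert_count hb).
  move=> m hm; have hX : ('X_[m] : Poly) \is d.-homog by rewrite dhomogX; apply/eqP.
  case: (gen m hm) => [H|[j H]]; [left|right; exists j].
    by apply/(vanishes_proj cS hX) => v _ /H.
  apply/(vanishes_proj cS); first by apply: rpredB; [exact: hX|exact: hb].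
  by move=> v _ /H E; rewrite evB E subrr.
move=> c Hc; apply: ind => v v0 Sv.
have hs : \sum_j c j *: b j \is d.-homog.
  by apply: rpred_sum => j _; apply: rpredZ.
have := (vanishes_proj cS hs).1 Hc v v0 Sv; rewrite ev_sum => E; rewrite -[RHS]E.
by apply: eq_bigr => j _; rewrite evZ.
Qed.

Lemma card_triangle d : #|{: {i : 'I_d.+1 & 'I_i.+1}}| = 'C(d + 2, 2).
Proof.
rewrite card_tagged (eq_map (g := fun i : 'I_d.+1 => i.+1)); last first.
  by move=> i; rewrite card_ord.
rewrite sumnE big_map big_enum /= -bin2_sum addn2 big_nat_recl // add0n.
by rewrite big_mkord.
Qed.

(** The basis consists of the monomials without the third variable.  Independence is
    tested along a curve on which the two other affine coordinates are t and
    t^(d+1), so that distinct monomials become distinct powers. *)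
Lemma hilbert_plane d : hilbert_function (proj (@plane R)) d = 'C(d + 2, 2).
Proof.
rewrite -card_triangle.
pose b (x : {i : 'I_d.+1 & 'I_i.+1}) : Poly :=
  'X_0 ^+ (d - tag x) * 'X_1 ^+ (tag x - tagged x) * 'X_3 ^+ tagged x.
apply: (@hilbert_proj _ _ _ b); first exact: cone_plane.
- move=> [i j]; rewrite /b /=.
  have := dhomogM (dhomogM (@XnU_homog R 0 (d - i)) (@XnU_homog R 1 (i - j))) (@XnU_homog R 3 j).
  by rewrite -addnA subnK 1?subnK // -ltnS.
- move=> m; rewrite mdeg4 => hm.
  have [m2|m2] := posnP (m 2).
    right; have i_lt : (m 1%R + m 3%R < d.+1)%N by lia.
    have j_lt : (m 3%R < (Ordinal i_lt).+1)%N by rewrite /=; lia.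
    exists (Tagged (fun i : 'I_d.+1 => 'I_i.+1) (Ordinal j_lt)) => v Sv.
    rewrite evX4 /b !evM !evXn !evXU /= m2 expr0 mulr1 addnK.
    by congr (_ ^+ _ * _ * _); lia.
  by left=> v Sv; rewrite evX4 Sv expr0n gtn_eqF // mulr0 mul0r.
move=> c H x.
apply: (@powers_indep _ xpredT (fun x : {i : 'I_d.+1 & 'I_i.+1} =>
   (tag x - tagged x) + d.+1 * tagged x)%N) => //.
  move=> [i j] [i' j'] _ _ /= /digits_inj[].
  - by apply: leq_ltn_trans (leq_subr _ _) _.
  - by apply: leq_ltn_trans (leq_subr _ _) _.
  move=> E1 E2; have ii : i = i'.
    by apply: val_inj; move: (ltn_ord j) (ltn_ord j'); rewrite !ltnS /=; lia.
  by subst i'; congr existT; apply: val_inj.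
move=> t; have /H : vec 1 t 0 (t ^+ d.+1) != 0.
  by apply/eqP => /rowP/(_ 0)/eqP; rewrite vecE mxE oner_eq0.
rewrite /plane vecE => /(_ erefl) E; rewrite -[RHS]E; apply: eq_bigr => y _.
rewrite /b !evM !evXn !evXU !vecE expr1n mul1r; congr (_ * _).
by rewrite exprD exprM.
Qed.

(** On the point (0, s^2, s t, t^2) a monomial takes the value s^(2d-j) t^j, so there
    are 2d + 1 functions to choose from; bb (inl j) is a monomial with this value.
    The power of the first variable takes care of the extra point.  In degree zero
    the constants would be counted twice, hence 0 < d. *)
Lemma hilbert_conic (b : bool) d : (0 < d)%N ->
  hilbert_function (proj (@conic R b)) d = (2 * d + (1 + b))%N.
Proof.
move=> d0; rewrite addnA.
have -> : (2 * d + 1 + b)%N = #|{: 'I_(2 * d + 1) + 'I_b}|.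
  by rewrite card_sum !card_ord.
pose bb (x : 'I_(2 * d + 1) + 'I_b) : Poly := match x with
  | inl j => 'X_1 ^+ (d - uphalf j) * 'X_2 ^+ (odd j) * 'X_3 ^+ j./2
  | inr _ => 'X_0 ^+ d end.
apply: (@hilbert_proj _ _ _ bb); first exact: cone_conic.
- move=> [j|j]; last exact: XnU_homog.
  have := dhomogM (dhomogM (@XnU_homog R 1 (d - uphalf j)) (@XnU_homog R 2 (odd j))) (@XnU_homog
      R 3 j./2).
  rewrite /bb (_ : (_ + _ + _)%N = d) //.
  have := ltn_ord j; rewrite uphalf_half; have := odd_double_half j; lia.
- move=> m; rewrite mdeg4 => hm.
  have [m0|m0] := posnP (m 0).
    right; have j_lt : (m 2%R + 2 * m 3%R < 2 * d + 1)%N by lia.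
    exists (inl (Ordinal j_lt)) => v; case=> [[v0 vc]|[b1 v1 v2 v3]]; last first.
      rewrite evX4 /bb !evM !evXn !evXU v1 v2 v3 m0 expr0 mul1r -!exprD /=.
      by rewrite !expr0n; do 2! case: eqP => //; lia.
    have [s [t ->]] := conic_param v0 vc.
    rewrite evX4 /bb !evM !evXn !evXU !vecE m0 expr0 mul1r /=.
    rewrite !(exprMn _ s t) -!exprM ![_ * (s ^+ _ * t ^+ _)]mulrA -!exprD -!mulrA -!exprD.
    have := odd_double_half (m 2%R + 2 * m 3%R); rewrite uphalf_half.
    by move=> E; congr (s ^+ _ * t ^+ _); lia.
  have van v : v 0 0 = 0 -> ev 'X_[m] v = 0.
    by move=> v0; rewrite evX4 v0 expr0n gtn_eqF // !mul0r.
  have [md|md] := eqVneq (m 0) d; last first.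
    left=> v [[v0 _]|[_ v1 v2 v3]]; first exact: van.
    rewrite evX4 v1 v2 v3 -!mulrA -!exprD expr0n gtn_eqF ?mulr0 //; lia.
  have [b0|b0] := ltnP 0 b; last first.
    by left=> v [[v0 _]|[bT]]; [exact: van|rewrite bT in b0].
  right; exists (inr (Ordinal b0)) => v _; rewrite evX4 /bb evXn evXU md.
  have [-> -> ->] : [/\ m 1%R = 0%N, m 2%R = 0%N & m 3%R = 0%N] by split; lia.
  by rewrite !expr0 !mulr1.
move=> c H.
have cl j : c (inl j) = 0.
  apply: (@powers_indep _ xpredT (fun j : 'I_(2 * d + 1) => j : nat)
            (fun j => c (inl j))) => //.
    by move=> i i' _ _; exact: val_inj.
  move=> t; have /H : vec 0 1 t (t ^+ 2) != 0.
    by apply/eqP => /rowP/(_ 1)/eqP; rewrite vecE mxE oner_eq0.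
  have cv : conic b (vec 0 1 t (t ^+ 2)) by left; rewrite !vecE mul1r.
  move=> /(_ cv); rewrite big_sumType /= [X in _ + X]big1 ?addr0; last first.
    by move=> i _; rewrite evXn evXU vecE expr0n gtn_eqF // mulr0.
  move=> E; rewrite -[RHS]E; apply: eq_bigr => i _; congr (_ * _).
  rewrite !evM !evXn !evXU !vecE expr1n mul1r -exprM -exprD.
  by rewrite [(2 * i./2)%N]mul2n odd_double_half.
move=> [j|j]; first exact: cl.
have bT : b by case: (b) j => // -[].
have /H : vec 1 0 0 0 != 0 :> V.
  by apply/eqP => /rowP/(_ 0)/eqP; rewrite vecE mxE oner_eq0.
have cv : conic b (vec (1 : C) 0 0 0) by right; rewrite !vecE.
move=> /(_ cv); rewrite big_sumType /= big1 ?add0r; last first.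
  by move=> i _; rewrite cl mul0r.
rewrite (bigD1 j) //= big1 ?addr0; last first.
  move=> i /eqP ne; case: ne; apply: val_inj => /=.
  by move: (ltn_ord i) (ltn_ord j) (leq_b1 b); lia.
by rewrite evXn evXU vecE expr1n mulr1.
Qed.

(** On each line through the vertex a form of degree d is a polynomial in one
    parameter; the k polynomials share the constant term, which is the coefficient
    of the d-th power of the last variable. *)
Lemma hilbert_lines k d : (0 < k <= 3)%N ->
  hilbert_function (proj (@lines R k)) d = (k * d + 1)%N.
Proof.
move=> /andP[k0 k3].
have -> : (k * d + 1)%N = #|{: option ('I_k * 'I_d)}|.
  by rewrite card_option card_prod !card_ord addn1.
have k4 : (k <= 4)%N by apply: leq_trans k3 _.
pose w (i : 'I_k) : 'I_4 := widen_ord k4 i.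
have w3 i : (w i < 3)%N by apply: leq_trans (ltn_ord i) k3.
have w_neq3 i : w i != 3 by rewrite neq_ltn w3.
pose b (x : option ('I_k * 'I_d)) : Poly := match x with
  | None => 'X_3 ^+ d
  | Some (i, j) => 'X_(w i) ^+ j.+1 * 'X_3 ^+ (d - j.+1) end.
apply: (@hilbert_proj _ _ _ b); first exact: cone_lines.
- move=> [[i j]|]; last exact: XnU_homog.
  have := dhomogM (@XnU_homog R (w i) j.+1) (@XnU_homog R 3 (d - j.+1)).
  by rewrite subnKC.
- move=> m hm.
  have van i v : (0 < m i)%N -> v 0 i = 0 -> ev 'X_[m] v = 0.
    by move=> mi vi; rewrite evX (bigD1 i) //= vi expr0n gtn_eqF // mul0r.
  have [i /andP[i3 mi]|no] := pickP (fun i : 'I_4 => (i < 3)%N && (0 < m i)%N); last first.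
    have m0 (i : 'I_4) : (i < 3)%N -> m i = 0%N.
      by move=> i3; have := no i; rewrite /= i3 lt0n => /negbFE/eqP.
    right; exists None => v _; rewrite evX4 /b evXn evXU -hm mdeg4.
    by rewrite (m0 0) // (m0 1) // (m0 2) // !expr0 !mul1r.
  have [j /and3P[j3 ij mj]|one] := pickP (fun j : 'I_4 => [&& (j < 3)%N, i != j & (0 < m j)%N]).
    left=> v [vv _]; have /eqP := vv i j i3 j3 ij; rewrite mulf_eq0.
    by case/orP => /eqP; apply: van.
  have [ki|ik] := leqP k i.
    by left=> v [_ vv]; apply: (van i) => //; apply: vv; rewrite ki.
  have i_neq3 : i != 3 by rewrite neq_ltn i3.
  have m0 j : j != i -> j != 3 -> m j = 0%N.
    move=> ji j3; have := one j; rewrite eq_sym ji /= lt0n.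
    rewrite (_ : (j < 3)%N) /=; first by move=> /negbFE/eqP.
    by have := ltn_ord j; move: j3; rewrite -val_eqE /=; lia.
  have dE : d = (m i + m 3%R)%N.
    rewrite -hm mdegE (bigD1 i) //= (bigD1 3) 1?eq_sym //= big1 ?addn0 //.
    by move=> j /andP[]; exact: m0.
  have jd : ((m i).-1 < d)%N by rewrite prednK // dE leq_addr.
  right; exists (Some (Ordinal ik, Ordinal jd)) => v _.
  rewrite /b evM !evXn !evXU /= prednK //.
  have -> : w (Ordinal ik) = i by apply: val_inj.
  rewrite dE addKn evX (bigD1 i) //= (bigD1 3) 1?eq_sym //= big1 ?mulr1 //.
  by move=> j /andP[ji j3]; rewrite m0.
move=> c H.
have key (i0 : 'I_k) x : (if x is Some (i, _) then i == i0 else true) -> c x = 0.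
  pose D (x : option ('I_k * 'I_d)) := if x is Some (i, _) then i == i0 else true.
  apply: (@powers_indep _ D (fun x => if x is Some (_, j) then (nat_of_ord j).+1 else 0%N)).
    move=> [[i j]|] [[i' j']|] //= /eqP-> /eqP-> [E].
    by congr (Some (_, _)); apply: val_inj.
  move=> t.
  pose v : V := \row_i (if i == 3 then 1 else if i == w i0 then t else 0).
  have vw i : v 0 (w i) = if i == i0 then t else 0.
    by rewrite mxE (negPf (w_neq3 i)) -!val_eqE.
  have v0 : v != 0 by apply/eqP => /rowP/(_ 3)/eqP; rewrite !mxE eqxx oner_eq0.
  have Lv : lines k v.
    split=> [i j i3 j3 ij|i /andP[ki i3]]; last first.
      rewrite mxE; case: eqP => [E|_]; first by rewrite E in i3.
      by case: eqP => // E; move: ki; rewrite E leqNgt (ltn_ord i0 : (w i0 < k)%N).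
    rewrite !mxE; case: eqP => [E|_]; first by rewrite E in i3.
    case: eqP => [Ei|]; last by rewrite mul0r.
    case: eqP => [E|_]; first by rewrite E in j3.
    case: eqP => [Ej|]; last by rewrite mulr0.
    by rewrite Ei Ej eqxx in ij.
  rewrite -[RHS](H v v0 Lv) big_mkcond; apply: eq_bigr => -[[i j]|] _ /=; last first.
    by rewrite evXn evXU mxE eqxx expr1n expr0.
  rewrite evM !evXn !evXU vw; case: eqP => _; first by rewrite mxE eqxx expr1n mulr1.
  by rewrite expr0n mul0r mulr0.
by case=> [[i j]|]; [apply: (key i)|apply: (key (Ordinal k0))].
Qed.

Theorem dim_deg_plane : dim_deg (proj (@plane R)) 2 1.
Proof. by apply: surface_dim_deg; [exact: chain_plane|exact: hilbert_plane]. Qed.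

Theorem dim_deg_conic b : dim_deg (proj (@conic R b)) 1 2.
Proof.
by apply: (@curve_dim_deg _ _ 2 (1 + b) 1) => //;
  [exact: chain_conic|exact: hilbert_conic].
Qed.

Theorem dim_deg_lines k : (0 < k <= 3)%N -> dim_deg (proj (@lines R k)) 1 k.
Proof.
move=> k3; have /andP[k0 _] := k3.
by apply: (@curve_dim_deg _ _ k 1 0) => //; [exact: chain_lines|
  move=> d _; exact: hilbert_lines].
Qed.

End ModelsHilbert.

(** * Cubic forms as functions *)

Section CubicFunctions.
Variable R : realType.
Local Notation C := R[i].
Local Notation V := 'rV[C]_4.
Local Notation Poly := {mpoly C[4]}.
Implicit Types (f g h : Poly) (u v w : V) (S : V -> Prop) (F G H : V -> C).

Lemma mdegS_split (m : 'X_{1..4}) d : mdeg m = d.+1 ->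
  exists i m', m = (U_(i) + m')%MM /\ mdeg m' = d.
Proof.
move=> hm; have [i mi] : exists i, (0 < m i)%N.
  apply/existsP; apply: contraPT hm; rewrite negb_exists => /forallP H0.
  by rewrite mdegE big1 // => i _; apply/eqP; have := H0 i; rewrite lt0n negbK.
have le : (U_(i) <= m)%MM.
  by apply/mnm_lepP => j; rewrite mnm1E; case: eqP => [<-|].
exists i, (m - U_(i))%MM; split; first by rewrite addmC submK.
have := hm; rewrite -{1}(submK le) mdegD mdeg1; lia.
Qed.

(** Cubic forms are spanned by products of three variables. *)
Lemma cubic_ind (P : Poly -> Prop) : P 0 ->
  (forall a f g, P f -> P g -> P (a *: f + g)) ->
  (forall i j k, P ('X_i * 'X_j * 'X_k)) ->
  forall f, f \is 3.-homog -> P f.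
Proof.
move=> P0 PD PX f /dhomogP hf; rewrite [f]mpolyE.
have : {subset msupp f <= msupp f} by [].
elim: {-2}(msupp f) => [|m s IH] sub; first by rewrite big_nil.
rewrite big_cons; apply: PD; last by apply: IH => x xs; apply: sub; rewrite inE xs orbT.
have /hf hm := sub m (mem_head _ _).
have [i [m1 [-> h1]]] := mdegS_split (hm : mdeg m = 3).
have [j [m2 [-> h2]]] := mdegS_split h1.
have [k [m3 [-> h3]]] := mdegS_split h2.
move/eqP: h3; rewrite mdeg_eq0 => /eqP->.
by rewrite addm0 !mpolyXD mulrA; apply: PX.
Qed.

Lemma mderivU (l s : 'I_4) : ('X_s : Poly)^`M(l) = (s == l)%:R *: 1.
Proof.
rewrite mderivX mnm1E; case: eqP => [->|]; last by rewrite !scale0r.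
have -> : (U_(l) - U_(l) = 0 :> 'X_{1..4})%MM.
  by apply/mnmP => j; rewrite mnmBE subnn mnm0E.
by rewrite mpolyX0.
Qed.

(** For a cubic F this says that v is singular: the odd part of w |-> F (v + w) is the
    derivative of F at v in the direction w, plus F w.  Phrased without derivatives,
    the condition is visibly compatible with linear changes of coordinates. *)
Definition singular_at F v := forall w, F (v + w) - F (v - w) = 2 * F w.

Lemma deriv_diff f v w : f \is 3.-homog ->
  2 * \sum_i w 0 i * ev (mderiv i f) v = ev f (v + w) - ev f (v - w) - 2 * ev f w.
Proof.
move: f; apply: cubic_ind.
- by rewrite big1 ?mulr0 => [|i _]; rewrite ?mderiv0 /ev !meval0 ?mulr0 ?subrr.
- move=> a f g Hf Hg.
  rewrite (eq_bigr (fun i => a * (w 0 i * ev (mderiv i f) v) + w 0 i * ev (mderiv i g) v)).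
    rewrite big_split -big_distrr /= mulrDr mulrCA Hf Hg !(evD, evZ); ring.
  by move=> i _; rewrite mderivD mderivZ evD evZ; ring.
move=> i j k.
have dX l s : ev (mderiv l 'X_s) v = (s == l)%:R.
  by rewrite mderivU evZ /ev meval1 mulr1.
have pick s (a : C) : \sum_l w 0 l * ((s == l)%:R * a) = w 0 s * a.
  rewrite (bigD1 s) //= eqxx mul1r big1 ?addr0 // => l; rewrite eq_sym => /negPf->.
  by rewrite mul0r mulr0.
rewrite (eq_bigr (fun l => w 0 l * ((i == l)%:R * (v 0 j * v 0 k)) +
   w 0 l * ((j == l)%:R * (v 0 i * v 0 k)) + w 0 l * ((k == l)%:R * (v 0 i * v 0 j)))).
  by rewrite !big_split /= !pick !evM !evXU !mxE; ring.
by move=> l _; rewrite !mderivM !(evD, evM) !dX !evXU; ring.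
Qed.

Lemma singular_atP f v : f \is 3.-homog ->
  singular_at (ev f) v <-> forall i, ev (mderiv i f) v = 0.
Proof.
move=> hf; split=> H.
  move=> i; have := deriv_diff v (delta_mx 0 i) hf; rewrite H subrr.
  rewrite (bigD1 i) //= big1 ?addr0 => [|j ne]; last first.
    by rewrite mxE (negPf ne) andbF mul0r.
  rewrite mxE !eqxx mul1r => /eqP; rewrite mulf_eq0 pnatr_eq0 /= => /eqP //.
move=> w; apply/eqP; rewrite -subr_eq0 -deriv_diff // big1 ?mulr0 // => i _.
by rewrite H mulr0.
Qed.

Lemma singular_locusE f : f \is 3.-homog -> singular_locus f = proj (singular_at (ev f)).
Proof.
move=> hf; apply/seteqP; split=> p H.
  by move=> v vp; apply/(singular_atP v hf) => i; apply: H.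
by move=> i v vp; apply: ((singular_atP v hf).1 (H v vp)).
Qed.

Lemma cone_singular_at f : f \is 3.-homog -> cone (singular_at (ev f)).
Proof.
move=> hf a v /(singular_atP v hf) H; apply/(singular_atP _ hf) => i.
move: f hf i H => f hf i H.
have hd : mderiv i f \is 2.-homog.
  move: f hf {H}; apply: cubic_ind.
  - by rewrite mderiv0 rpred0.
  - by move=> b f g Hf Hg; rewrite mderivD mderivZ; apply: rpredD => //; apply: rpredZ.
  move=> j k l.
  have XX s t : ('X_s * 'X_t : Poly) \is 2.-homog.
    by have := dhomogM (@XnU_homog R s 1) (@XnU_homog R t 1); rewrite !expr1.
  have dX s (q : Poly) : q \is 2.-homog -> ('X_s)^`M(i) * q \is 2.-homog.
    by move=> hq; rewrite mderivU -scalerAl mul1r; apply: rpredZ.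
  rewrite !mderivM mulrDl; apply: rpredD; first apply: rpredD.
  - by rewrite -mulrA; exact: dX (XX _ _).
  - by rewrite mulrAC mulrC; exact: dX (XX _ _).
  - by rewrite mulrC; exact: dX (XX _ _).
by rewrite (ev_homog _ _ hd) H mulr0.
Qed.

(** F is a sum of r cubes of linear forms, whose coefficients are the columns
    of M. *)
Definition cubes_fun F r := exists M : 'M[C]_(4, r),
  forall v, F v = \sum_i (v *m M) 0 i ^+ 3.

Lemma ev_linear_form f v : f \is 1.-homog -> ev f v = \sum_i v 0 i * f@_(U_(i)).
Proof.
move=> /dhomogP hf; rewrite evE.
have /choice[I hI] : forall m : 'X_{1..4}, exists i, m \in msupp f -> m = U_(i)%MM.
  move=> m; have [/hf hm|] := boolP (m \in msupp f); last by exists 0.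
  have [i [m1 [E h1]]] := mdegS_split (hm : mdeg m = 1%N).
  by move/eqP: h1; rewrite mdeg_eq0 => /eqP h1; exists i; rewrite E h1 addm0.
have inj (i j : 'I_4) : (U_(i) == U_(j) :> 'X_{1..4})%MM = (i == j).
  apply/eqP/eqP => [|->//] /mnmP/(_ i); rewrite !mnm1E eqxx.
  by case: eqP.
rewrite (eq_bigr (fun i => \sum_(m <- msupp f) f@_m * (v 0 i * (m == U_(i)%MM)%:R))); last first.
  move=> i _; have [iS|iS] := boolP (U_(i)%MM \in msupp f).
    rewrite (bigD1_seq _ iS) //= eqxx mulr1 big1 ?addr0 1?mulrC // => m /negPf->.
    by rewrite !mulr0.
  rewrite memN_msupp_eq0 // mulr0 big_seq big1 // => m mS.
  case: eqP => [E|]; last by rewrite !mulr0.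
  by rewrite -E mS in iS.
rewrite exchange_big /= big_seq [RHS]big_seq; apply: eq_bigr => m /hI mE.
rewrite -big_distrr /=; congr (_ * _).
move: (I m) mE => i ->; rewrite evXU (bigD1 i) //= eqxx mulr1 big1 ?addr0 // => j ne.
by rewrite inj eq_sym (negPf ne) mulr0.
Qed.

(** Polynomials over an infinite field are determined by their values, so the
    rank can be studied on functions. *)
Lemma sum_of_cubesE f r : sum_of_cubes f r <-> cubes_fun (ev f) r.
Proof.
split=> [[l [hl ->]]|[M HM]].
  exists (\matrix_(i, k) (l k)@_(U_(i))) => v; rewrite ev_sum.
  apply: eq_bigr => k _; rewrite evXn ev_linear_form // mxE; congr (_ ^+ _).
  by apply: eq_bigr => i _; rewrite mxE.
exists (fun k => \sum_i M i k *: 'X_i); split=> [k|].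
  exact: linear_homog (M ^~ k).
apply/eqP; rewrite -subr_eq0; apply/eqP/ev_eq0 => v.
rewrite evB HM ev_sum -sumrB big1 // => k _.
rewrite evXn ev_sum mxE; apply/eqP; rewrite subr_eq0; apply/eqP; congr (_ ^+ _).
by apply: eq_bigr => i _; rewrite evZ evXU mulrC.
Qed.

Lemma cubes_fun_le F r s : (r <= s)%N -> cubes_fun F r -> cubes_fun F s.
Proof.
move=> /subnKC <-; move: (s - r)%N => k [M HM].
exists (row_mx M 0) => v; rewrite HM mul_mx_row mulmx0 big_split_ord /=.
rewrite [X in _ + X]big1 ?addr0 => [|i _]; last first.
  by rewrite row_mxEr mxE expr0n.
by apply: eq_bigr => i _; rewrite row_mxEl.
Qed.

Lemma cubes_funD F G r s : cubes_fun F r -> cubes_fun G s -> cubes_fun (fun v => F v + G v) (r +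
    s).
Proof.
move=> [M HM] [N HN]; exists (row_mx M N) => v; rewrite HM HN mul_mx_row big_split_ord /=.
by congr (_ + _); apply: eq_bigr => i _; rewrite ?row_mxEl ?row_mxEr.
Qed.

(** The scalar is absorbed in the linear form by a cube root. *)
Lemma cubes_fun_cube k (l : V -> C) : (forall a u v, l (a *: u + v) = a * l u + l v) ->
  cubes_fun (fun v => k * l v ^+ 3) 1.
Proof.
move=> lin; pose c : C := 3.-root k.
have ck : c ^+ 3 = k by rewrite rootCK.
exists (\col_i (c * l (delta_mx 0 i))) => v; rewrite big_ord1 mxE.
have l0 : l 0 = 0 by have := lin (-1) 0 0; rewrite scaler0 addr0 mulN1r addNr.
have lsum : l v = \sum_i v 0 i * l (delta_mx 0 i).
  rewrite [v in LHS]row_sum_delta.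
  elim/big_rec2: _ => [//|i y x _ <-]; exact: lin.
rewrite -ck -exprMn lsum big_distrr /=; congr (_ ^+ _).
by apply: eq_bigr => i _; rewrite mxE mulrCA.
Qed.

Lemma eq_cubes_fun F G r : F =1 G -> cubes_fun F r -> cubes_fun G r.
Proof. by move=> E [M HM]; exists M => v; rewrite -E. Qed.

Definition lin_equiv F G := exists2 A : 'M[C]_4, A \in unitmx & forall v, F v = G (v *m A).

Lemma lin_equiv_sym F G : lin_equiv F G -> lin_equiv G F.
Proof.
move=> [A hA E]; exists (invmx A); first by rewrite unitmx_inv.
by move=> v; rewrite E mulmxKV.
Qed.

Lemma lin_equiv_cubes_fun F G r : lin_equiv F G -> cubes_fun F r -> cubes_fun G r.
Proof.
move=> /lin_equiv_sym[A hA E] [M HM]; exists (A *m M) => v.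
by rewrite E HM mulmxA.
Qed.

Lemma singular_at_mul F G A v : A \in unitmx -> (forall v, F v = G (v *m A)) ->
  singular_at F v <-> singular_at G (v *m A).
Proof.
move=> hA E; split=> H w.
  have := H (w *m invmx A); by rewrite !E mulmxDl mulmxBl mulmxKV.
by rewrite !E mulmxDl mulmxBl; apply: H.
Qed.

(** Bounds on the rank are enough: where lo < hi, the same pair (m, d) is possible for
    all ranks in between. *)
Definition has_invariants F m d lo hi :=
  [/\ dim_deg (proj (singular_at F)) m d, forall r, cubes_fun F r -> (lo <= r)%N & cubes_fun F
      hi].

Lemma lin_equiv_invariants F G m d lo hi : lin_equiv F G -> has_invariants G m d lo hi ->
    has_invariants F m d lo hi.
Proof.
move=> FG [H1 H2 H3]; split.
- have [A hA E] := FG.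
  rewrite (eq_proj (S' := fun v => singular_at G (v *m A))); first exact: dim_deg_transport.
  by move=> v; apply: singular_at_mul.
- by move=> r /(lin_equiv_cubes_fun FG)/H2.
- exact: lin_equiv_cubes_fun (lin_equiv_sym FG) H3.
Qed.

End CubicFunctions.

(** * Bounds on the rank *)

Section RankBounds.
Variable R : realType.
Local Notation C := R[i].
Local Notation V := 'rV[C]_4.
Implicit Types (u v w : V) (S : V -> Prop) (F G H : V -> C).

Definition linear_form (c : V) v : C := \sum_i c 0 i * v 0 i.

Lemma cubes_fun_seq (s : seq (C * V)) F :
  (forall v, F v = \sum_(x <- s) x.1 * linear_form x.2 v ^+ 3) -> cubes_fun F (size s).
Proof.
elim: s F => [|[k c] s IH] F HF.
  by exists 0 => v; rewrite HF big_nil big_ord0.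
apply: (@eq_cubes_fun _ (fun v => k * linear_form c v ^+ 3 + \sum_(x <- s) x.1 * linear_form x.2
    v ^+ 3)).
  by move=> v; rewrite HF big_cons.
apply: (@cubes_funD _ _ _ 1); last exact: IH.
apply: cubes_fun_cube => a u v; rewrite /linear_form big_distrr -big_split /=.
by apply: eq_bigr => i _; rewrite !mxE mulrDr mulrCA.
Qed.

Lemma linear_form4 a b c d v :
  linear_form (vec a b c d) v = a * v 0 0 + b * v 0 1 + c * v 0 2 + d * v 0 3.
Proof. by rewrite /linear_form big4 /= !vecE. Qed.

(** The polar trilinear form of a cubic F; it equals 6 F on the diagonal. *)
Definition polar F u v w := F (u + v + w) - F (u + v) - F (u + w) - F (v + w) + F u + F v + F w.

Lemma polar_cubes F r (M : 'M[C]_(4, r)) u v w :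
  (forall v, F v = \sum_j (v *m M) 0 j ^+ 3) ->
  polar F u v w = 6 * \sum_j (u *m M) 0 j * (v *m M) 0 j * (w *m M) 0 j.
Proof.
move=> E; rewrite /polar !E -!(sumrB, big_split) big_distrr /=.
rewrite -?sumrN -?big_split /=.
by apply: eq_bigr => j _; rewrite !mulmxDl !mxE; ring.
Qed.

(** The linear relations between the columns of M, that is, between the linear forms
    whose cubes add up to F. *)
Definition apolar r (M : 'M[C]_(4, r)) (c : 'I_r -> C) :=
  forall t : 'I_4, \sum_j c j * M t j = 0.

Lemma apolarD r (M : 'M[C]_(4, r)) c1 c2 : apolar M c1 -> apolar M c2 ->
  apolar M (fun j => c1 j + c2 j).
Proof.
move=> H1 H2 t; rewrite (eq_bigr (fun j => c1 j * M t j + c2 j * M t j)).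
  by rewrite big_split /= H1 H2 addr0.
by move=> j _; rewrite mulrDl.
Qed.

Lemma apolarZ r (M : 'M[C]_(4, r)) a c : apolar M c -> apolar M (fun j => a * c j).
Proof.
move=> H t; rewrite (eq_bigr (fun j => a * (c j * M t j))).
  by rewrite -big_distrr /= H mulr0.
by move=> j _; rewrite mulrA.
Qed.

Definition unit_vec (i : 'I_4) : V := delta_mx 0 i.

(** The second derivative of a sum of cubes in the directions a and b is 6 times the
    combination of the linear forms with coefficients M a j * M b j. *)
Lemma apolar_mul F r (M : 'M[C]_(4, r)) a b :
  (forall v, F v = \sum_j (v *m M) 0 j ^+ 3) ->
  (forall t, polar F (unit_vec a) (unit_vec b) (unit_vec t) = 0) ->
  apolar M (fun j => M a j * M b j).
Proof.
move=> E H t; have := H t; rewrite (polar_cubes _ _ _ E) /unit_vec -!rowE => /eqP.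
rewrite mulf_eq0 pnatr_eq0 /= => /eqP E0; rewrite -[RHS]E0.
by apply: eq_bigr => j _; rewrite !mxE.
Qed.

Lemma apolar_comb F r (M : 'M[C]_(4, r)) a b c d k :
  (forall v, F v = \sum_j (v *m M) 0 j ^+ 3) ->
  (forall t, polar F (unit_vec a) (unit_vec b) (unit_vec t) + k * polar F (unit_vec c) (unit_vec
      d) (unit_vec t) = 0) ->
  apolar M (fun j => M a j * M b j + k * (M c j * M d j)).
Proof.
move=> E H t; have := H t; rewrite !(polar_cubes _ _ _ E) /unit_vec -!rowE mulrCA -mulrDr => /eqP.
rewrite mulf_eq0 pnatr_eq0 /= => /eqP E0; rewrite -[RHS]E0.
rewrite big_distrr -big_split /=.
by apply: eq_bigr => j _; rewrite !mxE; ring.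
Qed.

(** The variables with index in s are essential: a direction in which all
    derivatives of F vanish has zero coordinates there. *)
Definition essential F (s : seq 'I_4) := uniq s /\
  forall u, (forall v w, polar F u v w = 0) -> forall i, i \in s -> u 0 i = 0.

Lemma kernel_pol F r (M : 'M[C]_(4, r)) u :
  (forall v, F v = \sum_j (v *m M) 0 j ^+ 3) -> u *m M = 0 ->
  forall v w, polar F u v w = 0.
Proof.
move=> E u0 v w; rewrite (polar_cubes _ _ _ E) big1 ?mulr0 // => j _.
by rewrite u0 mxE !mul0r.
Qed.

(** The rows of M indexed by s are independent, because a relation between them
    would be a direction that all the linear forms kill.  The relations between the
    columns therefore form a space of dimension at most r - size s. *)
Lemma apolar_dep F r (M : 'M[C]_(4, r)) s n (c : 'I_n -> 'I_r -> C) :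
  (forall v, F v = \sum_j (v *m M) 0 j ^+ 3) -> essential F s ->
  (forall i, apolar M (c i)) -> (r < size s + n)%N ->
  exists2 l : 'rV[C]_n, l != 0 & forall j, \sum_i l 0 i * c i j = 0.
Proof.
move=> E [us ess] Kc lt.
pose f := tnth (in_tuple s); pose B := rowsub f M.
have f_inj : injective f.
  move=> i j /eqP; rewrite /f !(tnth_nth 0) /= nth_uniq //.
  by move=> /eqP/val_inj.
have freeB : row_free B.
  apply: inj_row_free => l lB.
  pose u : V := l *m rowsub f 1%:M.
  have uM : u *m M = 0 by rewrite /u -mulmxA -[RHS]lB /B mul_rowsub_mx mul1mx.
  have uf i : u 0 (f i) = l 0 i.
    rewrite !mxE (bigD1 i) //= !mxE eqxx mulr1 big1 ?addr0 // => j ne.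
    by rewrite !mxE (inj_eq f_inj) (negPf ne) mulr0.
  apply/rowP => i; rewrite [RHS]mxE -uf.
  by apply: (ess _ (kernel_pol E uM)); rewrite /f mem_tnth.
pose Kx : 'M[C]_(n, r) := \matrix_(i, j) c i j.
have K0 : Kx *m B^T = 0.
  apply/matrixP => i t; rewrite !mxE -[RHS](Kc i (f t)).
  by apply: eq_bigr => j _; rewrite !mxE.
have rk : (\rank Kx < n)%N.
  have := mulmx0_rank_max K0; rewrite mxrank_tr (eqP freeB); lia.
have : kermx Kx != 0.
  rewrite -mxrank_eq0 mxrank_ker subn_eq0 -ltnNge //.
move=> /rowV0Pn[l /sub_kermxP lK l0]; exists l => // j.
have := congr1 (fun m => fun_of_matrix m 0 j) lK; rewrite !mxE => H.
by rewrite -[RHS]H; apply: eq_bigr => i _; rewrite mxE.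
Qed.

Lemma rank_ge_essential F r s : cubes_fun F r -> essential F s -> (size s <= r)%N.
Proof.
move=> [M E] ess; rewrite leqNgt; apply/negP => lt.
have [||l /eqP] := @apolar_dep F r M s 0 (fun _ _ => 0) E ess; first by case.
  by rewrite addn0.
by case; apply/rowP; case.
Qed.

Lemma apolar_dep1 F r (M : 'M[C]_(4, r)) s c :
  (forall v, F v = \sum_j (v *m M) 0 j ^+ 3) -> essential F s ->
  apolar M c -> (r <= size s)%N -> forall j, c j = 0.
Proof.
move=> E ess Kc le j.
have [|l l0 H] := @apolar_dep F r M s 1 (fun _ => c) E ess (fun _ => Kc).
  by rewrite addn1.
have := H j; rewrite big_ord1 => /eqP; rewrite mulf_eq0.
case/orP => [/eqP l00|/eqP //]; case/eqP: l0.
by apply/rowP => i; rewrite ord1 mxE l00.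
Qed.

Lemma apolar_dep2 F r (M : 'M[C]_(4, r)) s c1 c2 :
  (forall v, F v = \sum_j (v *m M) 0 j ^+ 3) -> essential F s ->
  apolar M c1 -> apolar M c2 -> (r <= size s + 1)%N ->
  exists a b, ((a != 0) || (b != 0)) /\ forall j, a * c1 j + b * c2 j = 0.
Proof.
move=> E ess K1 K2 le.
have [||l l0 H] := @apolar_dep F r M s 2 (fun i => if i == 0 then c1 else c2) E ess.
- by move=> i; case: eqP.
- by lia.
exists (l 0 0), (l 0 1); split.
  apply: contraNT l0; rewrite negb_or !negbK => /andP[/eqP l0 /eqP l1].
  apply/eqP/rowP => -[[|[|//]] lti]; rewrite [RHS]mxE;
    [rewrite -[RHS]l0 | rewrite -[RHS]l1]; by congr (l 0 _); apply: val_inj.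
move=> j; rewrite -[RHS](H j) !big_ord_recl big_ord0 addr0 /=.
by congr (_ + l 0 _ * _); apply: val_inj.
Qed.

Lemma apolar_dep3 F r (M : 'M[C]_(4, r)) s c1 c2 c3 :
  (forall v, F v = \sum_j (v *m M) 0 j ^+ 3) -> essential F s ->
  apolar M c1 -> apolar M c2 -> apolar M c3 -> (r <= size s + 2)%N ->
  exists a b c, [|| a != 0, b != 0 | c != 0] /\
    forall j, a * c1 j + b * c2 j + c * c3 j = 0.
Proof.
move=> E ess K1 K2 K3 le.
have [||l l0 H] := @apolar_dep F r M s 3
   (fun i => if i == 0 then c1 else if i == 1 then c2 else c3) E ess.
- by move=> i; case: eqP => // _; case: eqP.
- by lia.
exists (l 0 0), (l 0 1), (l 0 2); split.
  apply: contraNT l0; rewrite !negb_or !negbK => /and3P[/eqP l0 /eqP l1 /eqP l2].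
  apply/eqP/rowP => -[[|[|[|//]]] lti]; rewrite [RHS]mxE;
    [rewrite -[RHS]l0 | rewrite -[RHS]l1 | rewrite -[RHS]l2];
    by congr (l 0 _); apply: val_inj.
move=> j; rewrite -[RHS](H j) !big_ord_recl big_ord0 addr0 /= addrA.
by congr (_ + l 0 _ * _ + l 0 _ * _); apply: val_inj.
Qed.

End RankBounds.

(** * Products of coefficient vectors *)

Section Relations.
Variables (K : fieldType) (I : Type).
Hypothesis two_neq0 : 2 != 0 :> K.
Implicit Types (U T W X Y : I -> K).

Lemma mulf_cancel0 (a x : K) : a != 0 -> a * x = 0 -> x = 0.
Proof. by move=> a0 /eqP; rewrite mulf_eq0 (negPf a0) => /eqP. Qed.

Lemma mulff_eq0 (x : K) : x * x = 0 -> x = 0.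
Proof. by move=> /eqP; rewrite mulf_eq0 orbb => /eqP. Qed.

(** Where W is nonzero, the first relation makes Y a fixed multiple of W; where W is
    zero, the second one makes Q, hence Y, vanish. *)
Lemma proportional_of_relations W Y (Q : I -> K) a b a' b' :
  (exists j, W j != 0) ->
  (a != 0) || (b != 0) -> (forall j, a * (W j * W j) + b * (W j * Y j) = 0) ->
  (a' != 0) || (b' != 0) -> (forall j, a' * (W j * W j) + b' * Q j = 0) ->
  (forall j, W j = 0 -> Q j = Y j * Y j) ->
  exists m, forall j, Y j = m * W j.
Proof.
move=> [j0 w0] ab H1 ab' H2 HQ.
have b0 : b != 0.
  apply: contraTneq ab => b0; rewrite b0 eqxx orbF negbK; apply/eqP.
  have := H1 j0; rewrite b0 mul0r addr0 => /eqP.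
  by rewrite mulf_eq0 mulf_eq0 (negPf w0) !orbF => /eqP.
have b'0 : b' != 0.
  apply: contraTneq ab' => b'0; rewrite b'0 eqxx orbF negbK; apply/eqP.
  have := H2 j0; rewrite b'0 mul0r addr0 => /eqP.
  by rewrite mulf_eq0 mulf_eq0 (negPf w0) !orbF => /eqP.
exists (- (a / b)) => j; have [wj|wj] := eqVneq (W j) 0.
  have := H2 j; rewrite wj HQ // !mul0r mulr0 add0r mulr0 => /(mulf_cancel0 b'0)/mulff_eq0.
  by [].
have := H1 j; rewrite [X in X = 0](_ : _ = W j * (a * W j + b * Y j)); last by ring.
move=> /(mulf_cancel0 wj) E; apply: (mulfI b0).
by apply/eqP; rewrite -subr_eq0 -[X in _ == X]E; apply/eqP; field.
Qed.

Variable P : (I -> K) -> Prop.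
Hypothesis PD : forall c1 c2, P c1 -> P c2 -> P (fun j => c1 j + c2 j).
Hypothesis PZ : forall a c, P c -> P (fun j => a * c j).
Hypothesis dep3 : forall c1 c2 c3, P c1 -> P c2 -> P c3 ->
  exists a b c, [|| a != 0, b != 0 | c != 0] /\
    forall j, a * c1 j + b * c2 j + c * c3 j = 0.

(** P stands for a space of dimension at most two, and products are entrywise.
    Suppose first that U' = U - m W has support disjoint from that of W for some m.
    Then W^2 and U'^2 span P, so membership in P is tested separately on the two
    supports; this gives T = a W on the support of W, T proportional to U' on
    that of U', and T = 0 elsewhere.  If there is no such m, then W^2 and W U span P,
    so all members of P vanish where W does; this gives first U and then T zero there,
    while dividing W T by W gives T as a combination of W and U elsewhere. *)
Lemma dependent_triple W U T X k :
  P (fun j => W j * W j) -> P (fun j => W j * U j) -> P (fun j => U j * U j) ->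
  P (fun j => W j * T j) -> P (fun j => T j * T j + k * (X j * U j)) ->
  P (fun j => X j * W j + (- 2) * (U j * T j)) ->
  exists a b c, [|| a != 0, b != 0 | c != 0] /\
    forall j, a * W j + b * U j + c * T j = 0.
Proof.
move=> WW WU UU WT TT XW.
have [|W0] := EM (exists j, W j != 0); last first.
  exists 1, 0, 0; rewrite oner_eq0; split=> // j.
  rewrite !mul0r !addr0 mul1r; apply/eqP; apply: contrapT => wj.
  by apply: W0; exists j; apply/negP.
move=> [j0 w0].
have [[m Hm]|noA] := EM (exists m, forall j, W j * (U j - m * W j) = 0).
  pose U' j := U j - m * W j.
  have [|U0] := EM (exists j, U' j != 0); last first.
    exists (- m), 1, 0; rewrite oner_eq0 orbT; split=> // j.
    rewrite mul0r addr0 mul1r addrC mulNr; apply/eqP; apply: contrapT => uj.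
    by apply: U0; exists j; apply/negP.
  move=> [j1 u1].
  have w1 : W j1 = 0.
    by apply: (mulf_cancel0 u1); rewrite mulrC; apply: Hm.
  have u0 j : W j != 0 -> U' j = 0 by move=> wj; apply: (mulf_cancel0 wj); apply: Hm.
  have U'U' : P (fun j => U' j * U' j).
    have := PD UU (PD (PZ (- 2 * m) WU) (PZ (m ^+ 2) WW)).
    by congr P; apply/funext => j; rewrite /U'; ring.
  have dep q : P q -> exists a b, forall j, q j = a * (W j * W j) + b * (U' j * U' j).
    move=> Pq; have [a [b [c [abc H]]]] := dep3 WW U'U' Pq.
    have c0 : c != 0.
      apply: contraTneq abc => c0; rewrite c0 eqxx orbF negb_or !negbK.
      apply/andP; split; apply/eqP.
        have := H j0; rewrite u0 // c0 !mul0r mulr0 !addr0 mulrC => /(mulf_cancel0 _); apply.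
        by rewrite mulf_neq0.
      have := H j1; rewrite w1 c0 !mul0r mulr0 !addr0 add0r mulrC => /(mulf_cancel0 _); apply.
      by rewrite mulf_neq0.
    exists (- (a / c)), (- (b / c)) => j; apply: (mulfI c0).
    apply/eqP; rewrite -subr_eq0 -[X in _ == X](H j); apply/eqP; field; exact: c0.
  have [a1 [b1 H1]] := dep _ WT; have [a2 [b2 H2]] := dep _ XW.
  have [a3 [b3 H3]] := dep _ TT.
  (* From the membership of X W - 2 U T, T = kk U' on the support of U'. *)
  pose kk := - b2 / 2.
  exists (- a1 + kk * m), (- kk), 1; rewrite oner_eq0 !orbT; split=> // j.
  rewrite [LHS](_ : _ = T j - a1 * W j - kk * U' j); last by rewrite /U'; ring.
  have [wj|wj] := eqVneq (W j) 0; last first.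
    apply: (mulf_cancel0 wj); rewrite (u0 _ wj).
    have := H1 j; rewrite (u0 _ wj) => E.
    rewrite [LHS](_ : _ = W j * T j - a1 * (W j * W j)); last by ring.
    by rewrite E; ring.
  have Uj : U j = U' j by rewrite /U' wj mulr0 subr0.
  have [uj|uj] := eqVneq (U' j) 0.
    have := H3 j; rewrite Uj uj wj !mulr0 !addr0 => /mulff_eq0->.
    by rewrite ?mulr0 !subr0.
  apply: (mulf_cancel0 uj); apply: (mulf_cancel0 two_neq0); have := H2 j.
  rewrite Uj wj !mulr0 !add0r => E.
  rewrite [LHS](_ : _ = - (- 2 * (U' j * T j)) + b2 * (U' j * U' j)).
    by rewrite E; ring.
  by rewrite /kk; field.
have dep q : P q -> exists a b, forall j, q j = W j * (a * W j + b * U j).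
  move=> Pq; have [a [b [c [abc H]]]] := dep3 WW WU Pq.
  have c0 : c != 0.
    apply: contraTneq abc => c0; rewrite c0 eqxx orbF negb_or !negbK.
    have b0 : b = 0.
      apply/eqP; apply: contrapT => /negP b0; apply: noA; exists (- (a / b)) => j.
      apply: (mulf_cancel0 b0); rewrite -[RHS](H j) c0; field; exact: b0.
    rewrite b0 eqxx andbT; apply/eqP.
    have := H j0; rewrite b0 c0 !mul0r !addr0 mulrC => /(mulf_cancel0 _); apply.
    by rewrite mulf_neq0.
  exists (- (a / c)), (- (b / c)) => j; apply: (mulfI c0).
  apply/eqP; rewrite -subr_eq0 -[X in _ == X](H j); apply/eqP; field; exact: c0.
have [a1 [b1 H1]] := dep _ WT; have [a2 [b2 H2]] := dep _ UU.
have [a3 [b3 H3]] := dep _ TT.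
exists (- a1), (- b1), 1; rewrite oner_eq0 !orbT; split=> // j.
have [wj|wj] := eqVneq (W j) 0.
  have uj : U j = 0 by apply: mulff_eq0; rewrite H2 wj mul0r.
  have := H3 j; rewrite wj uj !mulr0 !mul0r !addr0 => /mulff_eq0->.
  by rewrite mulr0 addr0.
apply: (mulf_cancel0 wj); rewrite [LHS](_ : _ = W j * T j - W j * (a1 * W j + b1 * U j)).
  by rewrite H1 subrr.
by ring.
Qed.

End Relations.

(** * Normal forms and their singular loci *)

Section Families.
Variable R : realType.
Local Notation C := R[i].
Local Notation V := 'rV[C]_4.
Implicit Types (v : V) (G : C -> C -> C -> C -> C).

(** The families below, except plane_quadric, name the coordinates z, y, x, w in this
    order; this puts their singular loci in the position of plane or lines k. *)
Definition coord_fun G v := G (v 0 0) (v 0 1) (v 0 2) (v 0 3).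

Definition triple_plane k (z y x w : C) := k * x ^+ 3.
Definition double_plane (z y x w : C) := x ^+ 2 * w.
Definition concurrent_planes a b (z y x w : C) := x * y * (a * x + b * y).

(** The cone over a nodal cubic when a and b are nonzero. *)
Definition nodal_cone a b (z y x w : C) := x * y * z + a * x ^+ 3 + b * y ^+ 3.
Definition cuspidal_cone k (z y x w : C) := x ^+ 2 * w + k * y ^+ 3.

(** The cone over a conic and a secant line, and for k = 0 the cone over a
    triangle. *)
Definition secant_cone k (z y x w : C) := x * y * z + k * x ^+ 3.

(** The cone over a conic and a tangent line. *)
Definition tangent_cone k (z y x w : C) := x ^+ 2 * w + k * (x * y ^+ 2).

(** The ruled cubic with two pinch points on its double line. *)
Definition ruled (z y x w : C) := y ^+ 2 * z + x ^+ 2 * w.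

(** Cayley's ruled cubic, and for k = 0 a smooth quadric with a tangent plane. *)
Definition cayley k (z y x w : C) := x ^+ 2 * w + x * y * z + k * y ^+ 3.

(** A plane and a quadric meeting in a smooth conic; the quadric is a cone with
    vertex off the plane when a = 0. *)
Definition plane_quadric a (x y z w : C) := x * (a * x ^+ 2 + z ^+ 2 - y * w).

Definition polar_coords G a b c d a' b' c' d' a'' b'' c'' d'' :=
  G (a + a' + a'') (b + b' + b'') (c + c' + c'') (d + d' + d'')
  - G (a + a') (b + b') (c + c') (d + d') - G (a + a'') (b + b'') (c + c'') (d + d'')
  - G (a' + a'') (b' + b'') (c' + c'') (d' + d'') + G a b c d + G a' b' c' d'
  + G a'' b'' c'' d''.

End Families.

(* Unfolds a family down to polynomial arithmetic in its coordinates. *)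
Ltac unf := cbv beta delta [triple_plane double_plane concurrent_planes nodal_cone cuspidal_cone
    secant_cone tangent_cone ruled cayley plane_quadric polar_coords coord_fun].

Section NormalForms.
Variable R : realType.
Local Notation C := R[i].
Local Notation V := 'rV[C]_4.
Implicit Types (u v w : V) (S : V -> Prop) (F : V -> C) (G : C -> C -> C -> C -> C).

(** The numbers g0, g1, g2, g3 are the partial derivatives at v; stating this as a
    polynomial identity leaves it to be checked by ring normalization. *)
Lemma singular_at_grad G v (g0 g1 g2 g3 : C) :
  (forall a b c d : C,
     G (v 0 0 + a) (v 0 1 + b) (v 0 2 + c) (v 0 3 + d) -
     G (v 0 0 - a) (v 0 1 - b) (v 0 2 - c) (v 0 3 - d) - 2 * G a b c d =
     2 * (a * g0 + b * g1 + c * g2 + d * g3)) ->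
  singular_at (coord_fun G) v <-> [/\ g0 = 0, g1 = 0, g2 = 0 & g3 = 0].
Proof.
move=> E.
have two : (2 : C) != 0 by rewrite pnatr_eq0.
have key w : coord_fun G (v + w) - coord_fun G (v - w) - 2 * coord_fun G w =
    2 * (w 0 0 * g0 + w 0 1 * g1 + w 0 2 * g2 + w 0 3 * g3).
  by rewrite /coord_fun !mxE E.
split=> [H|[e0 e1 e2 e3] w]; last first.
  by apply/eqP; rewrite -subr_eq0 key e0 e1 e2 e3 !mulr0 !addr0 mulr0.
have H' w : w 0 0 * g0 + w 0 1 * g1 + w 0 2 * g2 + w 0 3 * g3 = 0.
  by apply: (mulf_cancel0 two); rewrite -key H subrr.
split.
- by have := H' (vec 1 0 0 0); rewrite !vecE !mul0r !addr0 mul1r.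
- by have := H' (vec 0 1 0 0); rewrite !vecE !mul0r !addr0 mul1r add0r.
- by have := H' (vec 0 0 1 0); rewrite !vecE !mul0r !addr0 mul1r !add0r.
- by have := H' (vec 0 0 0 1); rewrite !vecE !mul0r !add0r mul1r.
Qed.

Lemma unit_vecE : (unit_vec R 0 = vec 1 0 0 0) * (unit_vec R 1 = vec 0 1 0 0) *
  (unit_vec R 2 = vec 0 0 1 0) * (unit_vec R 3 = vec 0 0 0 1).
Proof. by split; [split; [split|]|]; apply: vecP; rewrite vecE !mxE. Qed.

Lemma polar_coord_fun G a b c d a' b' c' d' a'' b'' c'' d'' :
  polar (coord_fun G) (vec a b c d) (vec a' b' c' d') (vec a'' b'' c'' d'') =
  polar_coords G a b c d a' b' c' d' a'' b'' c'' d''.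
Proof. by rewrite /polar /coord_fun !vecD !vecE. Qed.

Lemma apolar_mul_coords G r (M : 'M[C]_(4, r)) a b :
  (forall v, coord_fun G v = \sum_j (v *m M) 0 j ^+ 3) ->
  (forall x y z t, polar (coord_fun G) (unit_vec R a) (unit_vec R b) (vec x y z t) = 0) ->
  apolar M (fun j => M a j * M b j).
Proof. by move=> E H; apply: (apolar_mul E) => t; rewrite (vec_eta (unit_vec R t)). Qed.

Lemma apolar_comb_coords G r (M : 'M[C]_(4, r)) a b c d k :
  (forall v, coord_fun G v = \sum_j (v *m M) 0 j ^+ 3) ->
  (forall x y z t, polar (coord_fun G) (unit_vec R a) (unit_vec R b) (vec x y z t) +
     k * polar (coord_fun G) (unit_vec R c) (unit_vec R d) (vec x y z t) = 0) ->
  apolar M (fun j => M a j * M b j + k * (M c j * M d j)).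
Proof. by move=> E H; apply: (apolar_comb E) => t; rewrite (vec_eta (unit_vec R t)). Qed.

(** A relation between the rows of M is a vector killed by all the linear forms, so it
    has no essential coordinates. *)
Lemma row_relation G r (M : 'M[C]_(4, r)) s a b c d :
  (forall v, coord_fun G v = \sum_j (v *m M) 0 j ^+ 3) -> essential (coord_fun G) s ->
  (forall j, a * M 0 j + b * M 1 j + c * M 2 j + d * M 3 j = 0) ->
  forall i, i \in s -> vec a b c d 0 i = 0.
Proof.
move=> E [_ ess] H; apply: ess; apply: (kernel_pol E).
by apply/rowP => j; rewrite !mxE big4 /= !vecE H.
Qed.

Ltac by_gradient g0 g1 g2 g3 :=
  apply: (iff_trans (@singular_at_grad _ _ g0 g1 g2 g3 _));
  [move=> ? ? ? ?; unf; ring|].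

Lemma singular_triple_plane k v : k != 0 -> singular_at (coord_fun (triple_plane k)) v <-> plane
    v.
Proof.
move=> k0; by_gradient (0 : C) (0 : C) (3 * k * v 0 2 ^+ 2) (0 : C).
rewrite /plane; split=> [[_ _ H _]|->]; last by split=> //; ring.
move/eqP: H; rewrite mulf_eq0 mulf_eq0 pnatr_eq0 (negPf k0) /=.
by rewrite sqrf_eq0 => /eqP.
Qed.

Lemma linesP1 v : v 0 1 = 0 -> v 0 2 = 0 -> lines 1 v.
Proof.
move=> v1 v2; split=> [|i].
  by elim/ord4P; elim/ord4P => //= _ _ _; rewrite ?v1 ?v2 ?mul0r ?mulr0.
by elim/ord4P: i.
Qed.

Lemma lines1E v : lines 1 v <-> v 0 1 = 0 /\ v 0 2 = 0.
Proof.
split=> [[_ H]|[]]; last exact: linesP1.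
by split; apply: H.
Qed.

Lemma lines2E v : lines 2 v <-> v 0 0 * v 0 1 = 0 /\ v 0 2 = 0.
Proof.
split=> [[H1 H2]|[v01 v2]]; first by split; [apply: H1|apply: H2].
split=> [|i]; last by elim/ord4P: i.
by elim/ord4P; elim/ord4P => //= _ _ _; rewrite ?v2 ?mul0r ?mulr0 // mulrC.
Qed.

Lemma lines3E v : lines 3 v <->
  [/\ v 0 0 * v 0 1 = 0, v 0 0 * v 0 2 = 0 & v 0 1 * v 0 2 = 0].
Proof.
split=> [[H1 H2]|[v01 v02 v12]]; first by split; apply: H1.
split=> [|i]; last by elim/ord4P: i.
by elim/ord4P; elim/ord4P => //= _ _ _; rewrite // mulrC.
Qed.

Lemma sqr_eq0 (x : C) : x ^+ 2 = 0 -> x = 0.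
Proof. by move/eqP; rewrite sqrf_eq0 => /eqP. Qed.

Lemma singular_double_plane v : singular_at (coord_fun (@double_plane R)) v <-> plane v.
Proof.
by_gradient (0 : C) (0 : C) (2 * v 0 2 * v 0 3) (v 0 2 ^+ 2).
rewrite /plane; split=> [[_ _ _ /sqr_eq0//]|->]; by split=> //; ring.
Qed.

Lemma singular_concurrent_planes a b v : a != 0 -> b != 0 -> singular_at (coord_fun
    (concurrent_planes a b)) v <-> lines 1 v.
Proof.
move=> a0 b0; rewrite lines1E.
by_gradient (0 : C) (a * v 0 2 ^+ 2 + 2 * b * v 0 2 * v 0 1)
   (2 * a * v 0 2 * v 0 1 + b * v 0 1 ^+ 2) (0 : C).
split=> [[_ H1 H2 _]|[-> ->]]; last by split=> //; ring.
have [x0|x0] := eqVneq (v 0 2) 0.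
  split=> //; apply: sqr_eq0; apply: (mulf_cancel0 b0); rewrite -[RHS]H2 x0; ring.
have E : a * v 0 2 + 2 * b * v 0 1 = 0 by apply: (mulf_cancel0 x0); rewrite -[RHS]H1; ring.
have y0 : v 0 1 = 0.
  apply: sqr_eq0; apply: (mulf_cancel0 b0); apply: (@mulf_cancel0 _ 3);
      first by rewrite pnatr_eq0.
  have -> : 3 * (b * v 0 1 ^+ 2) = 2 * v 0 1 * (a * v 0 2 + 2 * b * v 0 1) -
     (2 * a * v 0 2 * v 0 1 + b * v 0 1 ^+ 2) by ring.
  by rewrite E H2 mulr0 subr0.
by split=> //; apply: (mulf_cancel0 a0); rewrite -[RHS]E y0; ring.
Qed.

Lemma singular_nodal_cone a b v : a != 0 -> b != 0 -> singular_at (coord_fun (nodal_cone a b)) v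
    <-> lines 1 v.
Proof.
move=> a0 b0; rewrite lines1E.
by_gradient (v 0 2 * v 0 1) (v 0 2 * v 0 0 + 3 * b * v 0 1 ^+ 2)
   (v 0 1 * v 0 0 + 3 * a * v 0 2 ^+ 2) (0 : C).
split=> [[H0 H1 H2 _]|[-> ->]]; last by split=> //; ring.
have t0 : (3 : C) != 0 by rewrite pnatr_eq0.
case/eqP: H0; rewrite mulf_eq0 => /orP[]/eqP E; rewrite E ?mul0r ?add0r in H1 H2 *.
- by split=> //; apply: sqr_eq0; apply: (mulf_cancel0 _ H1); rewrite mulf_neq0.
- by split=> //; apply: sqr_eq0; apply: (mulf_cancel0 _ H2); rewrite mulf_neq0.
Qed.

Lemma singular_cuspidal_cone k v : k != 0 -> singular_at (coord_fun (cuspidal_cone k)) v <->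
    lines 1 v.
Proof.
move=> k0; rewrite lines1E.
by_gradient (0 : C) (3 * k * v 0 1 ^+ 2) (2 * v 0 2 * v 0 3) (v 0 2 ^+ 2).
split=> [[_ H1 _ /sqr_eq0 ->]|[-> ->]]; last by split=> //; ring.
split=> //; apply: sqr_eq0; apply: (mulf_cancel0 _ H1).
by rewrite mulf_neq0 // pnatr_eq0.
Qed.

Lemma singular_secant_cone k v : k != 0 -> singular_at (coord_fun (secant_cone k)) v <-> lines 2
    v.
Proof.
move=> k0; rewrite lines2E.
by_gradient (v 0 2 * v 0 1) (v 0 2 * v 0 0) (v 0 1 * v 0 0 + 3 * k * v 0 2 ^+ 2) (0 : C).
split=> [[H0 H1 H2 _]|[E ->]]; last by split=> //; rewrite 1?mulrC ?E; ring.
suff v2 : v 0 2 = 0 by move: H2; rewrite v2 expr0n mulr0 addr0 mulrC.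
apply/eqP; apply: contrapT => /negP x0; move/negP: (x0); apply; apply/eqP.
rewrite (mulf_cancel0 x0 H0) mul0r add0r in H2.
by apply: sqr_eq0; apply: (mulf_cancel0 _ H2); rewrite mulf_neq0 // pnatr_eq0.
Qed.

Lemma singular_tangent_cone k v : k != 0 -> singular_at (coord_fun (tangent_cone k)) v <-> lines
    1 v.
Proof.
move=> k0; rewrite lines1E.
by_gradient (0 : C) (2 * k * v 0 2 * v 0 1) (2 * v 0 2 * v 0 3 + k * v 0 1 ^+ 2) (v 0 2 ^+ 2).
split=> [[_ _ H /sqr_eq0 x0]|[-> ->]]; last by split=> //; ring.
split=> //; apply: sqr_eq0; apply: (mulf_cancel0 k0).
by rewrite x0 mulr0 mul0r add0r in H.
Qed.

Lemma singular_triangle_cone v : singular_at (coord_fun (secant_cone 0)) v <-> lines 3 v.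
Proof.
rewrite lines3E.
by_gradient (v 0 2 * v 0 1) (v 0 2 * v 0 0) (v 0 1 * v 0 0) (0 : C).
by split=> [[H0 H1 H2 _]|[H0 H1 H2]]; split=> //; rewrite mulrC.
Qed.

Lemma singular_ruled v : singular_at (coord_fun (@ruled R)) v <-> lines 1 v.
Proof.
rewrite lines1E.
by_gradient (v 0 1 ^+ 2) (2 * v 0 1 * v 0 0) (2 * v 0 2 * v 0 3) (v 0 2 ^+ 2).
split=> [[/sqr_eq0 -> _ _ /sqr_eq0 ->]//|[-> ->]]; by split=> //; ring.
Qed.

Lemma singular_cayley k v : k != 0 -> singular_at (coord_fun (cayley k)) v <-> lines 1 v.
Proof.
move=> k0; rewrite lines1E.
by_gradient (v 0 2 * v 0 1) (v 0 2 * v 0 0 + 3 * k * v 0 1 ^+ 2)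
  (2 * v 0 2 * v 0 3 + v 0 1 * v 0 0) (v 0 2 ^+ 2).
split=> [[_ H1 _ /sqr_eq0 x0]|[-> ->]]; last by split=> //; ring.
split=> //; rewrite x0 mul0r add0r in H1; apply: sqr_eq0; apply: (mulf_cancel0 _ H1).
by rewrite mulf_neq0 // pnatr_eq0.
Qed.

Lemma singular_tangent_quadric v : singular_at (coord_fun (cayley 0)) v <-> lines 2 v.
Proof.
rewrite lines2E.
by_gradient (v 0 2 * v 0 1) (v 0 2 * v 0 0) (2 * v 0 2 * v 0 3 + v 0 1 * v 0 0) (v 0 2 ^+ 2).
split=> [[_ _ H /sqr_eq0 x0]|[E ->]].
  by split=> //; rewrite x0 mulr0 mul0r add0r mulrC in H.
split; try ring; by rewrite mulr0 mul0r add0r mulrC.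
Qed.

Lemma singular_plane_quadric a v : singular_at (coord_fun (plane_quadric a)) v <-> conic (a ==
    0) v.
Proof.
by_gradient (3 * a * v 0 0 ^+ 2 + v 0 2 ^+ 2 - v 0 1 * v 0 3) (- (v 0 0 * v 0 3))
  (2 * v 0 0 * v 0 2) (- (v 0 0 * v 0 1)).
split=> [[H0 H1 H2 H3]|].
  have [x0|x0] := eqVneq (v 0 0) 0.
    left; split=> //; apply/eqP; rewrite -subr_eq0; apply/eqP; rewrite -[RHS]H0 x0; ring.
  have v3 : v 0 3 = 0 by apply: (mulf_cancel0 x0); apply/eqP; rewrite -oppr_eq0 H1.
  have v1 : v 0 1 = 0 by apply: (mulf_cancel0 x0); apply/eqP; rewrite -oppr_eq0 H3.
  have v2 : v 0 2 = 0.
    by apply: (mulf_cancel0 x0); apply: (@mulf_cancel0 _ 2); rewrite ?pnatr_eq0 // mulrA.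
  right; split=> //; apply/eqP; apply: (@mulf_cancel0 _ 3); first by rewrite pnatr_eq0.
  by do 2! apply: (mulf_cancel0 x0); rewrite -[RHS]H0 v1 v2; ring.
move=> [[x0 E]|[/eqP-> -> -> ->]]; last by split; ring.
by rewrite x0 E; split; ring.
Qed.

End NormalForms.

(** * Sums of cubes for the normal forms *)

Section UpperBounds.
Variable R : realType.
Local Notation C := R[i].
Local Notation V := 'rV[C]_4.
Implicit Types (u v w : V) (S : V -> Prop) (F : V -> C) (G : C -> C -> C -> C -> C).

Lemma linear_formP a (c d : V) v : linear_form (a *: c + d) v = a * linear_form c v +
    linear_form d v.
Proof.
rewrite /linear_form big_distrr -big_split /=; apply: eq_bigr => i _.
by rewrite !mxE mulrDl mulrA.
Qed.
Lemma cubes_sq (x w : V) : cubes_fun (fun v => linear_form x v ^+ 2 * linear_form w v) 3.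
Proof.
apply: (@cubes_fun_seq R [:: (6^-1, 1 *: x + w); (6^-1, (-1) *: x + w); (- 3^-1, w)]).
by move=> v; rewrite !big_cons big_nil /= !linear_formP; field.
Qed.

Lemma nonzero_sum2 (c : C) : exists a b, [/\ a != 0, b != 0 & a + b = c].
Proof.
have [->|c1] := eqVneq c 1.
  by exists 2, (-1); rewrite oppr_eq0 oner_eq0 pnatr_eq0; split=> //; ring.
by exists 1, (c - 1); rewrite oner_eq0 subr_eq0 c1; split=> //; ring.
Qed.

Lemma sqrt_quot (a k : C) : a != 0 -> exists b, a * b ^+ 2 = k.
Proof. by move=> a0; exists (sqrtC (k / a)); rewrite sqrtCK mulrC divfK. Qed.

(** The sum a (x + b u)^3 + a (x - b u)^3 is 2 a x^3 + 6 a b^2 x u^2.  The nonzero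
    number a is free, which lets several such pairs add up to any multiple
    of x^3. *)
Lemma cubes_pair (x u : V) k a : a != 0 ->
  cubes_fun (fun v => 2 * a * linear_form x v ^+ 3 + k * (linear_form x v * linear_form u v ^+
      2)) 2.
Proof.
move=> a0; have [b hb] := sqrt_quot (k / 6) a0.
apply: (@cubes_fun_seq R [:: (a, b *: u + x); (a, (- b) *: u + x)]).
move=> v; rewrite !big_cons big_nil /= !linear_formP.
have -> : k = 6 * (a * b ^+ 2) by rewrite hb; field.
by ring.
Qed.

(** Since 4 y z = (y + z)^2 - (y - z)^2, two pairs of cubes suffice, and the
    multiples of x^3 that they bring can be adjusted to sum to k. *)
Lemma cubes_xyz (x y z : V) k :
  cubes_fun (fun v => linear_form x v * linear_form y v * linear_form z v + k * linear_form x v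
      ^+ 3) 4.
Proof.
have [a [b [a0 b0 ab]]] := nonzero_sum2 (k / 2).
have H := cubes_funD (cubes_pair x (1 *: y + z) (4^-1) a0)
             (cubes_pair x ((-1) *: y + z) (- 4^-1) b0).
apply: eq_cubes_fun H => v /=; rewrite !linear_formP.
have -> : k = 2 * (a + b) by rewrite ab; field.
by field.
Qed.

Lemma linear_form_unit_vec i v : linear_form (unit_vec R i) v = v 0 i.
Proof.
rewrite /linear_form (bigD1 i) //= mxE !eqxx mul1r big1 ?addr0 // => j ne.
by rewrite mxE (negPf ne) andbF mul0r.
Qed.

Lemma cubes_triple_plane (k : C) : cubes_fun (coord_fun (triple_plane k)) 1.
Proof.
apply: (@cubes_fun_seq R [:: (k, unit_vec R 2)]) => v.
by rewrite big_cons big_nil /= linear_form_unit_vec addr0.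
Qed.

Lemma cubes_double_plane : cubes_fun (coord_fun (@double_plane R)) 3.
Proof. by apply: eq_cubes_fun (cubes_sq (unit_vec R 2) (unit_vec R 3)) => v;
    rewrite !linear_form_unit_vec. Qed.

(** Over the cube roots of unity, three concurrent planes are the factors of a
    sum of two cubes. *)
Lemma cubes_concurrent_planes (a b : C) : a != 0 -> b != 0 -> cubes_fun (coord_fun
    (concurrent_planes a b)) 2.
Proof.
move=> a0 b0; pose s : C := sqrtC (- 3); have s2 : s ^+ 2 = - 3 by rewrite sqrtCK.
have s0 : s != 0 by rewrite sqrtC_eq0 oppr_eq0 pnatr_eq0.
(* The primitive cube roots of unity. *)
pose o : C := (-1 + s) / 2; pose o2 : C := (-1 - s) / 2.
apply: (@cubes_fun_seq R [:: (- (3 * s * a * b)^-1, (- (o * b)) *: unit_vec R 1 + a *: unit_vec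
    R 2);
                     ((3 * s * a * b)^-1, (- (o2 * b)) *: unit_vec R 1 + a *: unit_vec R 2)]).
move=> v; rewrite !big_cons big_nil /= -[a *: _]addr0 !linear_formP !linear_form_unit_vec.
have -> : linear_form 0 v = 0 by rewrite /linear_form big1 // => i _; rewrite mxE mul0r.
unf; rewrite /o /o2.
apply: (mulfI (_ : 3 * s * a * b * 8 != 0)); first by rewrite !mulf_neq0 // pnatr_eq0.
move: (v 0 1) (v 0 2) => y x.
rewrite [LHS](_ : _ = s * (24 * a * b * (x * y * (a * x + b * y)))); last by ring.
rewrite [RHS](_ : _ = 8 * ((- ((-1 - s) / 2 * b) * y + a * x) ^+ 3 - (- ((-1 + s) / 2 * b) * y +
    a * x) ^+ 3)); last by field; rewrite a0 b0 s0.
have s3 : s ^+ 3 = - 3 * s by rewrite exprS s2 mulrC.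
rewrite [RHS](_ : _ = 8 * (3 * a ^+ 2 * x ^+ 2 * b * y * s + 3 * a * x * b ^+ 2 * y ^+ 2 * s + b
    ^+ 3 * y ^+ 3 * (3 * s + s ^+ 3) / 4)); last by field.
by rewrite s3; field.
Qed.

Lemma cubes_cuspidal_cone (k : C) : cubes_fun (coord_fun (cuspidal_cone k)) 4.
Proof.
have H := @cubes_fun_seq R [:: (k, unit_vec R 1)] (fun v => k * v 0 1 ^+ 3) _.
apply: eq_cubes_fun (cubes_funD (cubes_sq (unit_vec R 2) (unit_vec R 3)) (H _)) => v.
  by rewrite !linear_form_unit_vec.
by rewrite big_cons big_nil /= linear_form_unit_vec addr0.
Qed.

Lemma cubes_secant_cone (k : C) : cubes_fun (coord_fun (secant_cone k)) 4.
Proof. by apply: eq_cubes_fun (cubes_xyz (unit_vec R 2) (unit_vec R 1) (unit_vec R 0) k) => v;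
    rewrite !linear_form_unit_vec. Qed.

Lemma cubes_nodal_cone (a b : C) : cubes_fun (coord_fun (nodal_cone a b)) 7.
Proof.
have H := @cubes_fun_seq R [:: (b, unit_vec R 1)] (fun v => b * v 0 1 ^+ 3) _.
apply: (@cubes_fun_le _ _ 5) => //.
apply: eq_cubes_fun (cubes_funD (cubes_secant_cone a) (H _)) => v; first by unf.
by rewrite big_cons big_nil /= linear_form_unit_vec addr0.
Qed.

(** The pair of cubes for x y^2 brings a multiple of x^3, which is absorbed
    in x^2 w by changing w. *)
Lemma cubes_tangent_cone (k : C) : cubes_fun (coord_fun (tangent_cone k)) 5.
Proof.
apply: eq_cubes_fun (cubes_funD (cubes_sq (unit_vec R 2) ((- 2) *: unit_vec R 2 + unit_vec R 3))
   (cubes_pair (unit_vec R 2) (unit_vec R 1) k (oner_neq0 _))) => v.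
by rewrite !linear_formP !linear_form_unit_vec; unf; ring.
Qed.

Lemma cubes_ruled : cubes_fun (coord_fun (@ruled R)) 6.
Proof.
apply: eq_cubes_fun (cubes_funD (cubes_sq (unit_vec R 1) (unit_vec R 0)) (cubes_sq (unit_vec R
    2) (unit_vec R 3))) => v.
by rewrite !linear_form_unit_vec.
Qed.

(** The term k y^3 is absorbed in the four cubes for x y z. *)
Lemma cubes_cayley (k : C) : cubes_fun (coord_fun (cayley k)) 7.
Proof.
apply: eq_cubes_fun (cubes_funD (cubes_sq (unit_vec R 2) (unit_vec R 3)) (cubes_xyz (unit_vec R
    1) (unit_vec R 2) (unit_vec R 0) k)) => v.
by rewrite !linear_form_unit_vec; unf; ring.
Qed.

Lemma cubes_plane_quadric (k : C) : cubes_fun (coord_fun (plane_quadric k)) 6.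
Proof.
have [a [b' [a0 b'0 ab']]] := nonzero_sum2 (k / 2).
have [b [c [b0 c0 bc]]] := nonzero_sum2 b'.
have H := cubes_funD (cubes_pair (unit_vec R 0) (unit_vec R 2) 1 a0) (cubes_funD
   (cubes_pair (unit_vec R 0) (1 *: unit_vec R 1 + unit_vec R 3) (- 4^-1) b0)
   (cubes_pair (unit_vec R 0) ((-1) *: unit_vec R 1 + unit_vec R 3) (4^-1) c0)).
apply: eq_cubes_fun H => v /=; rewrite !linear_formP !linear_form_unit_vec; unf.
have -> : k = 2 * (a + (b + c)) by rewrite bc ab'; field.
by field.
Qed.

End UpperBounds.

(** * Lower bounds on the rank of the normal forms *)

Section LowerBounds.
Variable R : realType.
Local Notation C := R[i].
Local Notation V := 'rV[C]_4.
Implicit Types (u v w : V) (S : V -> Prop) (F : V -> C) (G : C -> C -> C -> C -> C).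
Implicit Types (a b k : C).

Lemma essentialP G s : uniq s ->
  (forall a b c d,
    (forall x y z t x' y' z' t', polar_coords G a b c d x y z t x' y' z' t' = 0) ->
    forall i, i \in s -> vec a b c d 0 i = 0) ->
  essential (coord_fun G) s.
Proof.
move=> us H; split=> // u Hu i si; rewrite (vec_eta u); apply: H => // *.
by rewrite -polar_coord_fun -vec_eta.
Qed.

Ltac coef_zero n e := apply: (@mulf_cancel0 _ n); [idtac | rewrite -[RHS]e; unf; ring].

Lemma essential_triple_plane k : k != 0 -> essential (coord_fun (triple_plane k)) [:: 2].
Proof.
move=> k0; apply: essentialP => // a b c d H; elim/ord4P => // _; rewrite vecE.
coef_zero (6 * k) (H 0 0 1 0 0 0 1 0); by rewrite mulf_neq0 // pnatr_eq0.
Qed.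

Lemma essential_double_plane : essential (coord_fun (@double_plane R)) [:: 2; 3].
Proof.
apply: essentialP => // a b c d H; elim/ord4P => // _; rewrite vecE.
  coef_zero (2 : C) (H 0 0 1 0 0 0 0 1); by rewrite pnatr_eq0.
coef_zero (2 : C) (H 0 0 1 0 0 0 1 0); by rewrite pnatr_eq0.
Qed.

Lemma essential_concurrent_planes a0 b0 : a0 != 0 -> b0 != 0 -> essential (coord_fun
    (@concurrent_planes R a0 b0)) [:: 1; 2].
Proof.
move=> ha hb; apply: essentialP => // a b c d H.
have E1 := H 0 1 0 0 0 1 0 0; have E2 := H 0 0 1 0 0 0 1 0.
have E3 := H 0 0 1 0 0 1 0 0.
have c0 : c = 0 by coef_zero (2 * b0) E1; rewrite mulf_neq0 // pnatr_eq0.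
have b1 : b = 0 by coef_zero (2 * a0) E2; rewrite mulf_neq0 // pnatr_eq0.
by elim/ord4P => // _; rewrite vecE.
Qed.

Lemma essential_nodal_cone a0 b0 : essential (coord_fun (nodal_cone a0 b0)) [:: 0; 1; 2].
Proof.
apply: essentialP => // a b c d H.
have c0 : c = 0 by coef_zero (1 : C) (H 1 0 0 0 0 1 0 0); rewrite oner_eq0.
have b1 : b = 0 by coef_zero (1 : C) (H 1 0 0 0 0 0 1 0); rewrite oner_eq0.
have a1 : a = 0 by coef_zero (1 : C) (H 0 1 0 0 0 0 1 0); rewrite oner_eq0.
by elim/ord4P => // _; rewrite vecE.
Qed.

Lemma essential_cuspidal_cone k : k != 0 -> essential (coord_fun (cuspidal_cone k)) [:: 1; 2; 3].
Proof.
move=> k0; apply: essentialP => // a b c d H.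
have b1 : b = 0 by coef_zero (6 * k) (H 0 1 0 0 0 1 0 0); rewrite mulf_neq0 // pnatr_eq0.
have c0 : c = 0 by coef_zero (2 : C) (H 0 0 1 0 0 0 0 1); rewrite pnatr_eq0.
have d0 : d = 0 by coef_zero (2 : C) (H 0 0 1 0 0 0 1 0); rewrite pnatr_eq0.
by elim/ord4P => // _; rewrite vecE.
Qed.

Lemma essential_tangent_cone k : k != 0 -> essential (coord_fun (tangent_cone k)) [:: 1; 2; 3].
Proof.
move=> k0; apply: essentialP => // a b c d H.
have b1 : b = 0 by coef_zero (2 * k) (H 0 1 0 0 0 0 1 0); rewrite mulf_neq0 // pnatr_eq0.
have c0 : c = 0 by coef_zero (2 : C) (H 0 0 1 0 0 0 0 1); rewrite pnatr_eq0.
have d0 : d = 0 by coef_zero (2 : C) (H 0 0 1 0 0 0 1 0); rewrite pnatr_eq0.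
by elim/ord4P => // _; rewrite vecE.
Qed.

Lemma essential_ruled : essential (coord_fun (@ruled R)) [:: 0; 1; 2; 3].
Proof.
apply: essentialP => // a b c d H; elim/ord4P => // _; rewrite vecE.
- coef_zero (2 : C) (H 0 1 0 0 0 1 0 0); by rewrite pnatr_eq0.
- coef_zero (2 : C) (H 0 1 0 0 1 0 0 0); by rewrite pnatr_eq0.
- coef_zero (2 : C) (H 0 0 1 0 0 0 0 1); by rewrite pnatr_eq0.
- coef_zero (2 : C) (H 0 0 1 0 0 0 1 0); by rewrite pnatr_eq0.
Qed.

Lemma essential_cayley k : essential (coord_fun (cayley k)) [:: 0; 1; 2; 3].
Proof.
apply: essentialP => // a b c d H.
have c0 : c = 0 by coef_zero (1 : C) (H 1 0 0 0 0 1 0 0); rewrite oner_eq0.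
have b1 : b = 0 by coef_zero (1 : C) (H 1 0 0 0 0 0 1 0); rewrite oner_eq0.
have d0 : d = 0 by coef_zero (2 : C) (H 0 0 1 0 0 0 1 0); rewrite pnatr_eq0.
have a1 : a = 0.
  apply: (@mulf_cancel0 _ 1); first by rewrite oner_eq0.
  by rewrite -[RHS](H 0 1 0 0 0 0 1 0) b1 c0 d0; unf; ring.
by elim/ord4P => // _; rewrite vecE.
Qed.

Lemma essential_plane_quadric k : essential (coord_fun (plane_quadric k)) [:: 0; 1; 2; 3].
Proof.
apply: essentialP => // a b c d H.
have a1 : a = 0 by coef_zero (2 : C) (H 0 0 1 0 0 0 1 0); rewrite pnatr_eq0.
have b1 : b = 0 by coef_zero (-1 : C) (H 1 0 0 0 0 0 0 1); rewrite oppr_eq0 oner_eq0.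
have c0 : c = 0 by coef_zero (2 : C) (H 1 0 0 0 0 0 1 0); rewrite pnatr_eq0.
have d0 : d = 0 by coef_zero (-1 : C) (H 1 0 0 0 0 1 0 0); rewrite oppr_eq0 oner_eq0.
by elim/ord4P => // _; rewrite vecE.
Qed.

Ltac polar_ring := move=> *; rewrite ?unit_vecE !polar_coord_fun; unf; ring.

Lemma row_nonzero G r (M : 'M[C]_(4, r)) s i :
  (forall v, coord_fun G v = \sum_j (v *m M) 0 j ^+ 3) -> essential (coord_fun G) s ->
  i \in s -> exists j, M i j != 0.
Proof.
move=> E [_ ess] si; apply: contrapT => no.
have : unit_vec R i 0 i = 0.
  apply: (ess _ _ i si); apply: (kernel_pol E).
  rewrite /unit_vec -rowE; apply/rowP => j; rewrite !mxE; apply/eqP.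
  by apply: contrapT => /negP nonzero_coef; apply: no; exists j.
by rewrite mxE !eqxx => /eqP; rewrite oner_eq0.
Qed.

(** A singular point with an essential coordinate gives a nonzero relation between the
    columns, the entrywise square of a row of M. *)
Lemma rank_sing G r s i : cubes_fun (coord_fun G) r -> essential (coord_fun G) s -> i \in s ->
  (forall x y z t, polar (coord_fun G) (unit_vec R i) (unit_vec R i) (vec x y z t) = 0) ->
  (size s < r)%N.
Proof.
move=> [M E] ess si H; rewrite ltnNge; apply/negP => le.
have [j] := row_nonzero E ess si.
have := apolar_dep1 E ess (apolar_mul_coords E H) le j => /mulff_eq0->.
by rewrite eqxx.
Qed.

Lemma rank_ge_double_plane r : cubes_fun (coord_fun (@double_plane R)) r -> (3 <= r)%N.
Proof. move=> H; apply: (@rank_sing _ _ _ 3 H essential_double_plane isT); polar_ring. Qed.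

Lemma rank_ge_nodal_cone a b r : cubes_fun (coord_fun (nodal_cone a b)) r -> (4 <= r)%N.
Proof. move=> H; apply: (@rank_sing _ _ _ 0 H (essential_nodal_cone a b) isT); polar_ring. Qed.

Lemma secant_cone_nodal k : coord_fun (secant_cone k) =1 coord_fun (nodal_cone k 0).
Proof. by move=> v; unf; rewrite mul0r addr0. Qed.

Lemma rank_ge_secant_cone k r : cubes_fun (coord_fun (secant_cone k)) r -> (4 <= r)%N.
Proof. by move/(eq_cubes_fun (secant_cone_nodal k))/rank_ge_nodal_cone. Qed.

Lemma rank_ge_cuspidal_cone k r : k != 0 -> cubes_fun (coord_fun (cuspidal_cone k)) r -> (4 <=
    r)%N.
Proof. move=> k0 H; apply: (@rank_sing _ _ _ 3 H (essential_cuspidal_cone k0) isT);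
    polar_ring. Qed.

Lemma rank_ge_concurrent_planes a b r : a != 0 -> b != 0 -> cubes_fun (coord_fun
    (concurrent_planes a b)) r -> (2 <= r)%N.
Proof. by move=> a0 b0 H; exact: (rank_ge_essential H (essential_concurrent_planes a0 b0)). Qed.

Lemma rank_ge_triple_plane k r : k != 0 -> cubes_fun (coord_fun (triple_plane k)) r -> (1 <= r)%N.
Proof. by move=> k0 H; exact: (rank_ge_essential H (essential_triple_plane k0)). Qed.

Lemma rank_ge_tangent_cone k r : k != 0 -> cubes_fun (coord_fun (tangent_cone k)) r -> (5 <= r)%N.
Proof.
move=> k0 [M E]; rewrite leqNgt; apply/negP => lt.
have ess := essential_tangent_cone k0.
have WW : apolar M (fun j => M 3 j * M 3 j) by apply: (apolar_mul_coords E); polar_ring.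
have WY : apolar M (fun j => M 3 j * M 1 j) by apply: (apolar_mul_coords E); polar_ring.
have YX : apolar M (fun j => M 1 j * M 1 j + (- k) * (M 3 j * M 2 j)).
  by apply: (apolar_comb_coords E); polar_ring.
have [a [b [ab H1]]] := apolar_dep2 E ess WW WY lt.
have [a' [b' [ab' H2]]] := apolar_dep2 E ess WW YX lt.
have [||m Hm] := proportional_of_relations _ ab H1 ab' H2.
- exact: (row_nonzero E ess).
- by move=> j ->; rewrite mul0r mulr0 addr0.
have Z : forall i, i \in [:: 1; 2; 3 : 'I_4] -> vec 0 1 0 (- m) 0 i = 0.
  by apply: (row_relation E ess) => j; rewrite Hm; ring.
by have /eqP := Z 1 isT; rewrite vecE oner_eq0.
Qed.

Lemma rank_ge_ruled r : cubes_fun (coord_fun (@ruled R)) r -> (6 <= r)%N.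
Proof.
move=> [M E]; rewrite leqNgt; apply/negP => lt.
have ess := essential_ruled.
have WW : apolar M (fun j => M 3 j * M 3 j) by apply: (apolar_mul_coords E); polar_ring.
have WZ : apolar M (fun j => M 3 j * M 0 j) by apply: (apolar_mul_coords E); polar_ring.
have ZZ : apolar M (fun j => M 0 j * M 0 j) by apply: (apolar_mul_coords E); polar_ring.
have [a [b [ab H1]]] := apolar_dep2 E ess WW WZ lt.
have [a' [b' [ab' H2]]] := apolar_dep2 E ess WW ZZ lt.
have [||m Hm] := proportional_of_relations _ ab H1 ab' H2 => //.
  exact: (row_nonzero E ess).
have Z : forall i, i \in [:: 0; 1; 2; 3 : 'I_4] -> vec 1 0 0 (- m) 0 i = 0.
  by apply: (row_relation E ess) => j; rewrite Hm; ring.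
by have /eqP := Z 0 isT; rewrite vecE oner_eq0.
Qed.

Lemma rank_ge_plane_quadric k r : cubes_fun (coord_fun (plane_quadric k)) r -> (6 <= r)%N.
Proof.
move=> [M E]; rewrite leqNgt; apply/negP => lt.
have ess := essential_plane_quadric k.
have WW : apolar M (fun j => M 1 j * M 1 j) by apply: (apolar_mul_coords E); polar_ring.
have WZ : apolar M (fun j => M 1 j * M 2 j) by apply: (apolar_mul_coords E); polar_ring.
have ZZ : apolar M (fun j => M 2 j * M 2 j + 2 * (M 1 j * M 3 j)).
  by apply: (apolar_comb_coords E); polar_ring.
have [a [b [ab H1]]] := apolar_dep2 E ess WW WZ lt.
have [a' [b' [ab' H2]]] := apolar_dep2 E ess WW ZZ lt.
have [||m Hm] := proportional_of_relations _ ab H1 ab' H2.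
- exact: (row_nonzero E ess).
- by move=> j ->; rewrite mul0r mulr0 addr0.
have Z : forall i, i \in [:: 0; 1; 2; 3 : 'I_4] -> vec 0 (- m) 1 0 0 i = 0.
  by apply: (row_relation E ess) => j; rewrite Hm; ring.
by have /eqP := Z 2 isT; rewrite vecE oner_eq0.
Qed.

Lemma rank_ge_cayley k r : cubes_fun (coord_fun (cayley k)) r -> (7 <= r)%N.
Proof.
move=> [M E]; rewrite leqNgt; apply/negP => lt.
have ess := essential_cayley k.
have two : (2 : C) != 0 by rewrite pnatr_eq0.
have key := @dependent_triple _ _ two (apolar M) (@apolarD _ _ M)
   (@apolarZ _ _ M) (fun c1 c2 c3 K1 K2 K3 => apolar_dep3 E ess K1 K2 K3 lt)
   (fun j => M 3 j) (fun j => M 0 j) (fun j => M 1 j) (fun j => M 2 j) (- (6 * k)).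
have [||||||a [b [c [abc H]]]] := key.
- by apply: (apolar_mul_coords E); polar_ring.
- by apply: (apolar_mul_coords E); polar_ring.
- by apply: (apolar_mul_coords E); polar_ring.
- by apply: (apolar_mul_coords E); polar_ring.
- by apply: (apolar_comb_coords E); polar_ring.
- by apply: (apolar_comb_coords E); polar_ring.
have Z : forall i, i \in [:: 0; 1; 2; 3 : 'I_4] -> vec b c 0 a 0 i = 0.
  by apply: (row_relation E ess) => j; rewrite -[RHS](H j); ring.
move: abc; have := Z 0 isT; have := Z 1 isT; have := Z 3 isT; rewrite !vecE => -> -> ->.
by rewrite eqxx.
Qed.

End LowerBounds.

(** * Cubics singular along a line *)

Section Classify.
Variable R : realType.
Local Notation C := R[i].
Local Notation V := 'rV[C]_4.
Implicit Types (u v w : V) (S : V -> Prop) (F : V -> C) (G : C -> C -> C -> C -> C).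
Implicit Types (a b k : C).

Lemma invariants_of F m d lo hi (S : V -> Prop) : (forall v, singular_at F v <-> S v) ->
  dim_deg (proj S) m d -> (forall r, cubes_fun F r -> (lo <= r)%N) -> cubes_fun F hi ->
  has_invariants F m d lo hi.
Proof. by move=> E D L U; split=> //; rewrite (eq_proj E). Qed.

Lemma invariants_triple_plane k : k != 0 -> has_invariants (coord_fun (triple_plane k)) 2 1 1 1.
Proof.
move=> k0; apply: (invariants_of (fun v => singular_triple_plane v k0));
    first exact: dim_deg_plane.
  by move=> r; exact: rank_ge_triple_plane.
exact: cubes_triple_plane.
Qed.

Lemma invariants_double_plane : has_invariants (coord_fun (@double_plane R)) 2 1 3 3.
Proof.
apply: (invariants_of (@singular_double_plane R)); [exact: dim_deg_plane|exact:
    rank_ge_double_plane|exact: cubes_double_plane].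
Qed.

Lemma invariants_concurrent_planes a b : a != 0 -> b != 0 -> has_invariants (coord_fun
    (concurrent_planes a b)) 1 1 2 2.
Proof.
move=> a0 b0; apply: (invariants_of (fun v => singular_concurrent_planes v a0 b0));
    first exact: dim_deg_lines.
  by move=> r; exact: rank_ge_concurrent_planes.
exact: cubes_concurrent_planes.
Qed.

Lemma invariants_nodal_cone a b : a != 0 -> b != 0 -> has_invariants (coord_fun (nodal_cone a
    b)) 1 1 4 7.
Proof.
move=> a0 b0; apply: (invariants_of (fun v => singular_nodal_cone v a0 b0));
    first exact: dim_deg_lines.
  by move=> r; exact: rank_ge_nodal_cone.
exact: cubes_nodal_cone.
Qed.

Lemma invariants_cuspidal_cone k : k != 0 -> has_invariants (coord_fun (cuspidal_cone k)) 1 1 4 4.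
Proof.
move=> k0; apply: (invariants_of (fun v => singular_cuspidal_cone v k0));
    first exact: dim_deg_lines.
  by move=> r; exact: rank_ge_cuspidal_cone.
exact: cubes_cuspidal_cone.
Qed.

Lemma invariants_secant_cone k : k != 0 -> has_invariants (coord_fun (secant_cone k)) 1 2 4 4.
Proof.
move=> k0; apply: (invariants_of (fun v => singular_secant_cone v k0));
    first exact: dim_deg_lines.
  by move=> r; exact: rank_ge_secant_cone.
exact: cubes_secant_cone.
Qed.

Lemma invariants_tangent_cone k : k != 0 -> has_invariants (coord_fun (tangent_cone k)) 1 1 5 5.
Proof.
move=> k0; apply: (invariants_of (fun v => singular_tangent_cone v k0));
    first exact: dim_deg_lines.
  by move=> r; exact: rank_ge_tangent_cone.
exact: cubes_tangent_cone.
Qed.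

Lemma invariants_triangle_cone : has_invariants (coord_fun (@secant_cone R 0)) 1 3 4 4.
Proof.
apply: (invariants_of (@singular_triangle_cone R)); first exact: dim_deg_lines.
  by move=> r; exact: rank_ge_secant_cone.
exact: cubes_secant_cone.
Qed.

Lemma invariants_ruled : has_invariants (coord_fun (@ruled R)) 1 1 6 6.
Proof.
apply: (invariants_of (@singular_ruled R)); [exact: dim_deg_lines|exact: rank_ge_ruled|exact:
    cubes_ruled].
Qed.

Lemma invariants_cayley k : k != 0 -> has_invariants (coord_fun (cayley k)) 1 1 7 7.
Proof.
move=> k0; apply: (invariants_of (fun v => singular_cayley v k0)); first exact: dim_deg_lines.
  by move=> r; exact: rank_ge_cayley.
exact: cubes_cayley.
Qed.

Lemma invariants_tangent_quadric : has_invariants (coord_fun (@cayley R 0)) 1 2 7 7.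
Proof.
apply: (invariants_of (@singular_tangent_quadric R)); first exact: dim_deg_lines.
  by move=> r; exact: rank_ge_cayley.
exact: cubes_cayley.
Qed.

Lemma invariants_plane_quadric k : has_invariants (coord_fun (plane_quadric k)) 1 2 6 6.
Proof.
apply: (invariants_of (@singular_plane_quadric R k)); first exact: dim_deg_conic.
  by move=> r; exact: rank_ge_plane_quadric.
exact: cubes_plane_quadric.
Qed.

(** The conclusion of the classification in a form that is invariant under linear
    changes of coordinates and can be read off from a normal form. *)
Definition classified F := (exists v, F v != 0) ->
  exists m d lo hi, has_invariants F m d lo hi /\
    forall r, (lo <= r <= hi)%N -> (m, d) \in listed_pairs r.

Lemma invariants_classified F m d lo hi : has_invariants F m d lo hi ->
  (forall r, (lo <= r <= hi)%N -> (m, d) \in listed_pairs r) -> classified F.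
Proof. by move=> H L _; exists m, d, lo, hi. Qed.

Ltac listed := by do 8! [case=> //].

Lemma classified_triple_plane k : classified (coord_fun (triple_plane k)).
Proof.
have [->|k0] := eqVneq k 0.
  by case=> v; rewrite /coord_fun /triple_plane mul0r eqxx.
by apply: (invariants_classified (invariants_triple_plane k0)); listed.
Qed.
Lemma classified_double_plane : classified (coord_fun (@double_plane R)).
Proof. by apply: (invariants_classified invariants_double_plane); listed. Qed.
Lemma classified_concurrent_planes a b : a != 0 -> b != 0 -> classified (coord_fun
    (concurrent_planes a b)).
Proof. by move=> a0 b0; apply: (invariants_classified (invariants_concurrent_planes a0 b0));
    listed. Qed.
Lemma classified_cuspidal_cone k : k != 0 -> classified (coord_fun (cuspidal_cone k)).
Proof. by move=> k0; apply: (invariants_classified (invariants_cuspidal_cone k0)); listed. Qed.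
Lemma classified_secant_cone k : classified (coord_fun (secant_cone k)).
Proof.
have [->|k0] := eqVneq k 0; first by apply: (invariants_classified invariants_triangle_cone);
    listed.
by apply: (invariants_classified (invariants_secant_cone k0)); listed.
Qed.
Lemma classified_tangent_cone k : k != 0 -> classified (coord_fun (tangent_cone k)).
Proof. by move=> k0; apply: (invariants_classified (invariants_tangent_cone k0)); listed. Qed.
Lemma classified_ruled : classified (coord_fun (@ruled R)).
Proof. by apply: (invariants_classified invariants_ruled); listed. Qed.
Lemma classified_cayley k : classified (coord_fun (cayley k)).
Proof.
have [->|k0] := eqVneq k 0; first by apply: (invariants_classified invariants_tangent_quadric);
    listed.
by apply: (invariants_classified (invariants_cayley k0)); listed.
Qed.
Lemma classified_plane_quadric k : classified (coord_fun (plane_quadric k)).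
Proof. by apply: (invariants_classified (invariants_plane_quadric k)); listed. Qed.

Lemma lin_equiv_classified F F' : lin_equiv F F' -> classified F' -> classified F.
Proof.
move=> E cl [v Fv]; have [|m [d [lo [hi [H1 H2]]]]] := cl.
  by have [A hA EA] := E; exists (v *m A); rewrite -EA.
by exists m, d, lo, hi; split=> //; apply: lin_equiv_invariants H1.
Qed.

Lemma lin_equiv_coord_fun G G' (c0 c1 c2 c3 : V) :
  (forall x y z t, linear_form c0 (vec x y z t) = 0 -> linear_form c1 (vec x y z t) = 0 ->
     linear_form c2 (vec x y z t) = 0 -> linear_form c3 (vec x y z t) = 0 ->
     [/\ x = 0, y = 0, z = 0 & t = 0]) ->
  (forall x y z t, G x y z t = G' (linear_form c0 (vec x y z t)) (linear_form c1 (vec x y z t))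
     (linear_form c2 (vec x y z t)) (linear_form c3 (vec x y z t))) ->
  lin_equiv (coord_fun G) (coord_fun G').
Proof.
move=> inj E.
pose A : 'M[C]_4 := \matrix_(i, j) [:: c0; c1; c2; c3]`_j 0 i.
have vA v : v *m A = vec (linear_form c0 v) (linear_form c1 v) (linear_form c2 v) (linear_form
    c3 v).
  by apply: vecP; rewrite vecE mxE; apply: eq_bigr => i _; rewrite mxE /= mulrC.
exists A.
  rewrite -row_free_unit; apply: inj_row_free => v; rewrite vA => H0.
  have e (j : 'I_4) : (vec (linear_form c0 v) (linear_form c1 v) (linear_form c2 v) (linear_form
      c3 v)) 0 j = 0.
    by rewrite H0 mxE.
  have := inj (v 0 0) (v 0 1) (v 0 2) (v 0 3); rewrite -vec_eta.
  have := e 0; have := e 1; have := e 2; have := e 3; rewrite !vecE.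
  move=> -> -> -> -> []// x0 x1 x2 x3.
  by apply: vecP; rewrite mxE.
by move=> v; rewrite vA /coord_fun !vecE E -vec_eta.
Qed.

(** Arguments are in the order y, x, while coefficients are in increasing powers
    of y. *)
Definition quad2 p0 p1 p2 (y x : C) : C := p0 * x ^+ 2 + p1 * x * y + p2 * y ^+ 2.
Definition cubic2 c0 c1 c2 c3 (y x : C) : C :=
  c0 * x ^+ 3 + c1 * x ^+ 2 * y + c2 * x * y ^+ 2 + c3 * y ^+ 3.

(** The cubics singular along the line x = y = 0, for a binary cubic c and binary
    quadrics p and q. *)
Definition line_cubic (c p q : C -> C -> C) (z y x w : C) : C := c y x + p y x * z + q y x * w.

Lemma det2_inj a b c d (y x : C) : a * d - b * c != 0 ->
  a * y + b * x = 0 -> c * y + d * x = 0 -> y = 0 /\ x = 0.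
Proof.
move=> D E1 E2; split; apply: (mulf_cancel0 D).
  rewrite [LHS](_ : _ = d * (a * y + b * x) - b * (c * y + d * x)); last by ring.
  by rewrite E1 E2 !mulr0 subr0.
rewrite [LHS](_ : _ = a * (c * y + d * x) - c * (a * y + b * x)); last by ring.
by rewrite E1 E2 !mulr0 subr0.
Qed.

Lemma quad2_subst a b c d p0 p1 p2 : a * d - b * c != 0 -> exists p0' p1' p2',
  forall y x, quad2 p0 p1 p2 y x = quad2 p0' p1' p2' (a * y + b * x) (c * y + d * x).
Proof.
move=> D; pose D' := (a * d - b * c)^-1.
pose e := d * D'; pose f := - b * D'; pose g := - c * D'; pose h := a * D'.
exists (p0 * h ^+ 2 + p1 * h * f + p2 * f ^+ 2),
  (2 * p0 * g * h + p1 * (g * f + h * e) + 2 * p2 * e * f),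
  (p0 * g ^+ 2 + p1 * g * e + p2 * e ^+ 2) => y x.
by rewrite /quad2 /e /f /g /h /D'; field.
Qed.

Lemma cubic2_subst a b c d c0 c1 c2 c3 : a * d - b * c != 0 -> exists c0' c1' c2' c3',
  forall y x, cubic2 c0 c1 c2 c3 y x = cubic2 c0' c1' c2' c3' (a * y + b * x) (c * y + d * x).
Proof.
move=> D; pose D' := (a * d - b * c)^-1.
pose e := d * D'; pose f := - b * D'; pose g := - c * D'; pose h := a * D'.
exists (c0 * h ^+ 3 + c1 * h ^+ 2 * f + c2 * h * f ^+ 2 + c3 * f ^+ 3),
  (3 * c0 * h ^+ 2 * g + c1 * (h ^+ 2 * e + 2 * h * g * f) +
   c2 * (g * f ^+ 2 + 2 * h * e * f) + 3 * c3 * e * f ^+ 2),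
  (3 * c0 * h * g ^+ 2 + c1 * (2 * h * g * e + g ^+ 2 * f) +
   c2 * (h * e ^+ 2 + 2 * g * e * f) + 3 * c3 * e ^+ 2 * f),
  (c0 * g ^+ 3 + c1 * g ^+ 2 * e + c2 * g * e ^+ 2 + c3 * e ^+ 3) => y x.
rewrite [RHS](_ : _ = cubic2 c0 c1 c2 c3 (e * (a * y + b * x) + f * (c * y + d * x))
   (g * (a * y + b * x) + h * (c * y + d * x))); last by rewrite /cubic2; ring.
by congr cubic2; rewrite /e /f /g /h /D'; field.
Qed.

Ltac expand_forms := rewrite ?linear_form4 ?vecE.
Ltac expand_line_cubic := unf; rewrite /line_cubic /quad2 /cubic2; expand_forms.

Lemma line_cubic_gl2 a b c d (k p q k' p' q' : C -> C -> C) : a * d - b * c != 0 ->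
  (forall y x, k y x = k' (a * y + b * x) (c * y + d * x)) ->
  (forall y x, p y x = p' (a * y + b * x) (c * y + d * x)) ->
  (forall y x, q y x = q' (a * y + b * x) (c * y + d * x)) ->
  lin_equiv (coord_fun (line_cubic k p q)) (coord_fun (line_cubic k' p' q')).
Proof.
move=> D Hk Hp Hq.
apply: (@lin_equiv_coord_fun _ _ (vec 1 0 0 0) (vec 0 a b 0) (vec 0 c d 0) (vec 0 0 0 1)) => z y
    x w; expand_forms.
  rewrite !(mul0r, mul1r, addr0, add0r) => -> E1 E2 ->.
  by have [-> ->] := det2_inj D E1 E2.
by rewrite /line_cubic !(mul0r, mul1r, addr0, add0r) Hk Hp Hq.
Qed.

(** The term x^2 w absorbs all terms divisible by x^2.  If y^2 occurs in p, a change
    of y and z also removes the rest of p and of the cubic.  Otherwise p becomes x y,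
    which absorbs x y^2, or zero, and only the terms x y^2 and y^3 of the cubic
    remain. *)
Lemma classified_square_x c0 c1 c2 c3 p0 p1 p2 :
  classified (coord_fun (line_cubic (cubic2 c0 c1 c2 c3) (quad2 p0 p1 p2) (fun y x => x ^+ 2))).
Proof.
have [p20|p2n] := eqVneq p2 0; last first.
  pose e := p1 / (2 * p2).
  refine (lin_equiv_classified _ classified_ruled).
  (* In terms of y + e x, which completes the square in p, the coefficient of
     x^2 (y + e x) in the binary cubic. *)
  pose f := c1 + 3 * e ^+ 2 * c3 - 2 * e * c2.
  apply: (@lin_equiv_coord_fun _ _ (vec p2 c3 (c2 - 2 * e * c3) 0) (vec 0 1 e 0) (vec 0 0 1 0)
    (vec (p0 - p2 * e ^+ 2) f (f * e + c0 - c1 * e + c2 * e ^+ 2 - c3 * e ^+ 3) 1)) => z y x w;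
        expand_line_cubic.
    rewrite !(mul0r, mul1r, addr0, add0r) => E0 E x0; rewrite x0 !(mulr0, addr0, add0r) in E E0 *.
    rewrite E !(mulr0, addr0, add0r) in E0 *; have z0 := mulf_cancel0 p2n E0.
    by rewrite z0 mulr0 add0r => ->.
  have -> : p1 = 2 * p2 * e by rewrite /e; field.
  by rewrite /f; ring.
have [p10|p1n] := eqVneq p1 0; last first.
  refine (lin_equiv_classified _ (@classified_cayley c3)).
  apply: (@lin_equiv_coord_fun _ _ (vec p1 c2 0 0) (vec 0 1 0 0) (vec 0 0 1 0) (vec p0 c1 c0 1))
      => z y x w; expand_line_cubic.
    rewrite !(mul0r, mul1r, addr0, add0r) => E0 y0 x0; rewrite y0 x0 !(mulr0, addr0, add0r) in
        E0 *.
    by have z0 := mulf_cancel0 p1n E0; rewrite z0 mulr0 add0r => ->.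
  by rewrite p20; ring.
have [c30|c3n] := eqVneq c3 0; last first.
  pose e := c2 / (3 * c3).
  refine (lin_equiv_classified _ (classified_cuspidal_cone c3n)).
  apply: (@lin_equiv_coord_fun _ _ (vec 1 0 0 0) (vec 0 1 e 0) (vec 0 0 1 0)
    (vec p0 (c1 - 3 * c3 * e ^+ 2) (c0 - c3 * e ^+ 3) 1)) => z y x w; expand_line_cubic.
    rewrite !(mul0r, mul1r, addr0, add0r) => -> E x0; rewrite x0 !(mulr0, addr0, add0r) in E *.
    by rewrite E mulr0 add0r => ->.
  by rewrite p20 p10 /e; field.
have [c20|c2n] := eqVneq c2 0; last first.
  refine (lin_equiv_classified _ (classified_tangent_cone c2n)).
  apply: (@lin_equiv_coord_fun _ _ (vec 1 0 0 0) (vec 0 1 0 0) (vec 0 0 1 0)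
    (vec p0 c1 c0 1)) => z y x w; expand_line_cubic.
    by rewrite !(mul0r, mul1r, addr0, add0r) => -> -> ->; rewrite !(mulr0, add0r) => ->.
  by rewrite p20 p10 c30; ring.
refine (lin_equiv_classified _ classified_double_plane).
apply: (@lin_equiv_coord_fun _ _ (vec 1 0 0 0) (vec 0 1 0 0) (vec 0 0 1 0)
    (vec p0 c1 c0 1)) => z y x w; expand_line_cubic.
  by rewrite !(mul0r, mul1r, addr0, add0r) => -> -> ->; rewrite !(mulr0, add0r) => ->.
by rewrite p20 p10 c30 c20; ring.
Qed.

(** The zero binary form; a constant keeps it recognizable under rewriting. *)
Definition zero2 (y x : C) : C := 0.

Lemma classified_swap (p k : C -> C -> C) : classified (coord_fun (line_cubic k zero2 p)) ->
    classified (coord_fun (line_cubic k p zero2)).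
Proof.
apply: lin_equiv_classified.
apply: (@lin_equiv_coord_fun _ _ (vec 0 0 0 1) (vec 0 1 0 0) (vec 0 0 1 0) (vec 1 0 0 0)) => z y
    x w; expand_forms.
  by rewrite !(mul0r, mul1r, addr0, add0r) => -> -> -> ->.
by rewrite /line_cubic /zero2 !(mul0r, mul1r, addr0, add0r).
Qed.

(** The term x y z absorbs the terms x^2 y and x y^2 of the binary cubic. *)
Lemma classified_hyperbolic c0 c1 c2 c3 :
  classified (coord_fun (line_cubic (cubic2 c0 c1 c2 c3) (fun y x => x * y) zero2)).
Proof.
have E : lin_equiv (coord_fun (line_cubic (cubic2 c0 c1 c2 c3) (fun y x => x * y) zero2))
    (coord_fun (nodal_cone c0 c3)).
  apply: (@lin_equiv_coord_fun _ _ (vec 1 c2 c1 0) (vec 0 1 0 0) (vec 0 0 1 0) (vec 0 0 0 1)) =>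
      z y x w; expand_line_cubic.
    rewrite !(mul0r, mul1r, addr0, add0r) => E y0 x0 ->; rewrite y0 x0 in E *.
    by rewrite !(mulr0, addr0) in E.
  by rewrite /zero2; ring.
refine (lin_equiv_classified E _).
have [->|c3n] := eqVneq c3 0.
  refine (lin_equiv_classified _ (@classified_secant_cone c0)).
  by exists 1%:M; rewrite ?unitmx1 // => v; rewrite mulmx1; unf; ring.
have [->|c0n] := eqVneq c0 0; last first.
  by apply: (invariants_classified (invariants_nodal_cone c0n c3n)); listed.
refine (lin_equiv_classified _ (@classified_secant_cone c3)).
apply: (@lin_equiv_coord_fun _ _ (vec 1 0 0 0) (vec 0 0 1 0) (vec 0 1 0 0) (vec 0 0 0 1)) => z y
    x w; expand_line_cubic.
  by rewrite !(mul0r, mul1r, addr0, add0r) => -> -> -> ->.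
ring.
Qed.

Lemma quad_roots b c : exists r s : C, r + s = b /\ r * s = c.
Proof.
pose d := sqrtC (b ^+ 2 - 4 * c); have d2 : d ^+ 2 = b ^+ 2 - 4 * c by rewrite sqrtCK.
exists ((b + d) / 2), ((b - d) / 2); split; first by field.
rewrite [LHS](_ : _ = (b ^+ 2 - d ^+ 2) / 4); last by field.
by rewrite d2; field.
Qed.

(** The quadratic factor splits; the cases are the possible coincidences among the
    three linear factors. *)
Lemma classified_linear_factor p0 p1 p2 : classified (coord_fun (line_cubic (fun y x => x *
    quad2 p0 p1 p2 y x) zero2 zero2)).
Proof.
have [p20|p2n] := eqVneq p2 0.
  have [p10|p1n] := eqVneq p1 0.
    refine (lin_equiv_classified _ (@classified_triple_plane p0)).
    exists 1%:M; rewrite ?unitmx1 // => v; rewrite mulmx1; expand_line_cubic.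
    by rewrite p10 p20 /zero2; ring.
  refine (lin_equiv_classified _ classified_double_plane).
  apply: (@lin_equiv_coord_fun _ _ (vec 1 0 0 0) (vec 0 0 0 1) (vec 0 0 1 0) (vec 0 p1 p0 0)) =>
      z y x w; expand_line_cubic.
    rewrite !(mul0r, mul1r, addr0, add0r) => -> -> x0; rewrite x0 !(mulr0, addr0).
    by move=> /(mulf_cancel0 p1n)->.
  by rewrite p20 /zero2; ring.
have [r [s [rs1 rs2]]] := quad_roots (- (p1 / p2)) (p0 / p2).
have p1E : p1 = - p2 * (r + s) by rewrite rs1; field.
have p0E : p0 = p2 * (r * s) by rewrite rs2; field.
have [rs|rs] := eqVneq r s.
  refine (lin_equiv_classified _ classified_double_plane).
  apply: (@lin_equiv_coord_fun _ _ (vec 1 0 0 0) (vec 0 0 0 1) (vec 0 1 (- r) 0) (vec 0 0 p2 0))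
      => z y x w; expand_line_cubic.
    rewrite !(mul0r, mul1r, addr0, add0r) => -> -> E /(mulf_cancel0 p2n) x0.
    by rewrite x0 mulr0 addr0 in E.
  by rewrite /zero2 p0E p1E rs; ring.
have ac : p2 * (r - s) != 0 by rewrite mulf_neq0 // subr_eq0.
refine (lin_equiv_classified _ (classified_concurrent_planes ac p2n)).
apply: (@lin_equiv_coord_fun _ _ (vec 1 0 0 0) (vec 0 1 (- r) 0) (vec 0 0 1 0) (vec 0 0 0 1)) =>
    z y x w; expand_line_cubic.
  rewrite !(mul0r, mul1r, addr0, add0r) => -> E x0 ->; rewrite x0 !(mulr0, addr0) in E.
  by rewrite E x0.
by rewrite /zero2 p0E p1E; ring.
Qed.

Lemma classified_binary c0 c1 c2 c3 : classified (coord_fun (line_cubic (cubic2 c0 c1 c2 c3)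
    zero2 zero2)).
Proof.
have [c30|c3n] := eqVneq c3 0.
  refine (lin_equiv_classified _ (@classified_linear_factor c0 c1 c2)).
  exists 1%:M; rewrite ?unitmx1 // => v; rewrite mulmx1; expand_line_cubic.
  by rewrite c30 /zero2; ring.
(* A root t of the dehomogenized cubic gives the factor y - t x, and the other
   factor has the coefficients fed to quad2_subst below. *)
pose P (i : nat) : C := - [:: c0; c1; c2]`_i / c3.
have [t] := @solve_monicpoly C 3 P isT.
rewrite !big_ord_recl big_ord0 /P /= /bump /= !addn0 expr0 expr1 mulr1 addr0 => ht.
have c0E : c0 = - (c1 * t + c2 * t ^+ 2 + c3 * t ^+ 3).
  by rewrite ht; field.
have D : 0 * 0 - 1 * 1 != 0 :> C by rewrite mul0r sub0r mulr1 oppr_eq0 oner_eq0.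
have D1 : 0 * (- t) - 1 * 1 != 0 :> C by rewrite mul0r sub0r mulr1 oppr_eq0 oner_eq0.
have [p0 [p1 [p2 Hp]]] := quad2_subst (c1 + c2 * t + c3 * t ^+ 2) (c2 + c3 * t) c3 D1.
refine (lin_equiv_classified _ (@classified_linear_factor p0 p1 p2)).
apply: (line_cubic_gl2 D1) => // y x; rewrite -Hp /cubic2 /quad2 c0E; ring.
Qed.

Lemma square_form q0 q1 q2 : q1 ^+ 2 = 4 * (q0 * q2) ->
  exists a b, forall y x, quad2 q0 q1 q2 y x = (a * y + b * x) ^+ 2.
Proof.
move=> E; pose b := sqrtC q0; have b2 : b ^+ 2 = q0 by rewrite sqrtCK.
have [b0|bn] := eqVneq b 0.
  have q00 : q0 = 0 by rewrite -b2 b0 expr0n.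
  have q10 : q1 = 0 by apply: sqr_eq0; rewrite E q00 mul0r mulr0.
  (* A square root of q0 that vanishes forces q1 = 0, so only y^2 is left. *)
  exists (sqrtC q2), 0 => y x; rewrite /quad2 q00 q10.
  rewrite [RHS](_ : _ = sqrtC q2 ^+ 2 * y ^+ 2); last by ring.
  by rewrite sqrtCK; ring.
exists (q1 / (2 * b)), b => y x; rewrite /quad2 -b2.
have -> : q2 = q1 ^+ 2 / (4 * b ^+ 2) by rewrite E -b2; field.
by field.
Qed.

Lemma extend_linear a b : (a != 0) || (b != 0) -> exists c d : C, c * b - d * a != 0.
Proof.
have [a0|an] := eqVneq a 0 => /= [bn|_]; last by exists 0, 1; rewrite mul0r sub0r oppr_eq0 mul1r.
by exists 1, 0; rewrite mul0r subr0 mul1r.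
Qed.

Lemma classified_square c0 c1 c2 c3 p0 p1 p2 a b : (a != 0) || (b != 0) ->
  classified (coord_fun (line_cubic (cubic2 c0 c1 c2 c3) (quad2 p0 p1 p2) (fun y x => (a * y + b
      * x) ^+ 2))).
Proof.
move=> /extend_linear[c [d D]].
have [c0' [c1' [c2' [c3' Hc]]]] := cubic2_subst c0 c1 c2 c3 D.
have [p0' [p1' [p2' Hp]]] := quad2_subst p0 p1 p2 D.
by refine (lin_equiv_classified (line_cubic_gl2 D Hc Hp _) (@classified_square_x _ _ _ _ _ _ _)).
Qed.

Lemma eq_classified F F' : F =1 F' -> classified F' -> classified F.
Proof.
by move=> E; apply: lin_equiv_classified; exists 1%:M; rewrite ?unitmx1 // => v; rewrite mulmx1.
Qed.

Lemma classified_one_quadric c0 c1 c2 c3 p0 p1 p2 :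
  classified (coord_fun (line_cubic (cubic2 c0 c1 c2 c3) (quad2 p0 p1 p2) zero2)).
Proof.
have [disc|disc] := eqVneq (p1 ^+ 2) (4 * (p0 * p2)).
  have [a [b Hab]] := square_form disc.
  apply: classified_swap.
  have [ab|] := boolP ((a != 0) || (b != 0)).
    have := @classified_square c0 c1 c2 c3 0 0 0 a b ab; apply: eq_classified => v.
    by rewrite /coord_fun /line_cubic Hab /zero2 /quad2; ring.
  rewrite negb_or !negbK => /andP[/eqP a0 /eqP b0].
  have := @classified_binary c0 c1 c2 c3; apply: eq_classified => v.
  by rewrite /coord_fun /line_cubic Hab a0 b0 /zero2; ring.
have [a [b [c [d [D Hp]]]]] : exists a b c d, a * d - b * c != 0 /\
    forall y x, quad2 p0 p1 p2 y x = (c * y + d * x) * (a * y + b * x).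
  have [p20|p2n] := eqVneq p2 0.
    exists p1, p0, 0, 1; rewrite mulr1 mulr0 subr0; split.
      by apply: contraNneq disc => ->; rewrite p20 !mulr0 expr0n.
    by move=> y x; rewrite /quad2 p20; ring.
  have [r [s [rs1 rs2]]] := quad_roots (- (p1 / p2)) (p0 / p2).
  have p1E : p1 = - p2 * (r + s) by rewrite rs1; field.
  have p0E : p0 = p2 * (r * s) by rewrite rs2; field.
  exists p2, (- p2 * r), 1, (- s); split; last by move=> y x; rewrite /quad2 p0E p1E; ring.
  rewrite [X in X != 0](_ : _ = p2 * (r - s)); last by ring.
  rewrite mulf_neq0 // subr_eq0; apply: contraNneq disc => rs.
  by rewrite p1E p0E rs; apply/eqP; ring.
have [c0' [c1' [c2' [c3' Hc]]]] := cubic2_subst c0 c1 c2 c3 D.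
by refine (lin_equiv_classified (line_cubic_gl2 D Hc Hp _) (@classified_hyperbolic _ _ _ _)).
Qed.

Lemma classified_square_or_zero c0 c1 c2 c3 p0 p1 p2 a b :
  classified (coord_fun (line_cubic (cubic2 c0 c1 c2 c3) (quad2 p0 p1 p2) (fun y x => (a * y + b
      * x) ^+ 2))).
Proof.
have [ab|] := boolP ((a != 0) || (b != 0)); first exact: classified_square.
rewrite negb_or !negbK => /andP[/eqP a0 /eqP b0].
have := @classified_one_quadric c0 c1 c2 c3 p0 p1 p2; apply: eq_classified => v.
by rewrite /coord_fun /line_cubic a0 b0 /zero2; ring.
Qed.

(** A combination of p and q has zero discriminant, hence is a square; a change of
    z and w makes it one of the two coefficients. *)
Theorem classified_singular_line c0 c1 c2 c3 p0 p1 p2 q0 q1 q2 :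
  classified (coord_fun (line_cubic (cubic2 c0 c1 c2 c3) (quad2 p0 p1 p2) (quad2 q0 q1 q2))).
Proof.
have [disc|A0] := eqVneq (p1 ^+ 2) (4 * (p0 * p2)).
  have [a [b Hab]] := square_form disc.
  refine (lin_equiv_classified _ (@classified_square_or_zero c0 c1 c2 c3 q0 q1 q2 a b)).
  apply: (@lin_equiv_coord_fun _ _ (vec 0 0 0 1) (vec 0 1 0 0) (vec 0 0 1 0) (vec 1 0 0 0)) => z
      y x w; expand_forms.
    by rewrite !(mul0r, mul1r, addr0, add0r) => -> -> -> ->.
  by rewrite /line_cubic !(mul0r, mul1r, addr0, add0r) Hab; ring.
pose A := p1 ^+ 2 - 4 * (p0 * p2).
have An : A != 0 by rewrite subr_eq0.
pose B := 2 * p1 * q1 - 4 * (p0 * q2 + q0 * p2).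
pose D := q1 ^+ 2 - 4 * (q0 * q2).
have [r [s [rs1 rs2]]] := quad_roots (- (B / A)) (D / A).
have rE : A * r ^+ 2 + B * r + D = 0.
  have -> : B = - A * (r + s) by rewrite rs1; field.
  have -> : D = A * (r * s) by rewrite rs2; field.
  by ring.
have disc : (r * p1 + q1) ^+ 2 = 4 * ((r * p0 + q0) * (r * p2 + q2)).
  by apply/eqP; rewrite -subr_eq0 -[X in _ == X]rE /A /B /D; apply/eqP; ring.
have [a [b Hab]] := square_form disc.
refine (lin_equiv_classified _ (@classified_square_or_zero c0 c1 c2 c3 p0 p1 p2 a b)).
apply: (@lin_equiv_coord_fun _ _ (vec 1 0 0 (- r)) (vec 0 1 0 0) (vec 0 0 1 0) (vec 0 0 0 1)) =>
    z y x w; expand_forms.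
  rewrite !(mul0r, mul1r, addr0, add0r) => E -> -> w0; rewrite w0 in E *.
  by rewrite mulr0 addr0 in E.
by rewrite /line_cubic !(mul0r, mul1r, addr0, add0r) -Hab /quad2; ring.
Qed.

End Classify.

(** * Collinear, coplanar and general singular points *)

Section Geometry.
Variable R : realType.
Local Notation C := R[i].
Local Notation V := 'rV[C]_4.
Local Notation Poly := {mpoly C[4]}.
Implicit Types (f : Poly) (u v w : V) (S : V -> Prop) (F : V -> C).

Definition independent2 u v := forall a b, a *: u + b *: v = 0 -> a = 0 /\ b = 0.
Definition independent3 u v w := forall a b c, a *: u + b *: v + c *: w = 0 ->
  [/\ a = 0, b = 0 & c = 0].
Definition independent4 u v w x := forall a b c d, a *: u + b *: v + c *: w + d *: x = 0 ->
  [/\ a = 0, b = 0, c = 0 & d = 0].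

Lemma not_in_span (s : seq V) : (size s < 4)%N -> exists v, v \notin <<s>>%VS.
Proof.
move=> lt; apply: contrapT => no.
suff : (\dim {: V} <= size s)%N by rewrite dimvf /dim /= mul1n leqNgt lt.
apply: leq_trans (dim_span s); apply/dimvS/subvP => v _.
by apply: contrapT => /negP nv; apply: no; exists v.
Qed.

Lemma independent3_extend u v : independent2 u v -> exists w, independent3 u v w.
Proof.
move=> H; have [w nw] := @not_in_span [:: u; v] isT.
exists w => a b c E; have c0 : c = 0.
  apply/eqP; apply: contraNT nw => c0.
  have -> : w = c^-1 *: (- (a *: u + b *: v)).
    by rewrite -[X in - X](addrK (c *: w)) E sub0r opprK scalerA mulVf ?scale1r.
  by rewrite rpredZ // rpredN rpredD // rpredZ // memv_span // !inE eqxx ?orbT.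
by move: E; rewrite c0 scale0r addr0 => /H[-> ->].
Qed.

Lemma independent4_extend u v w : independent3 u v w -> exists x, independent4 u v w x.
Proof.
move=> H; have [x nx] := @not_in_span [:: u; v; w] isT.
exists x => a b c d E; have d0 : d = 0.
  apply/eqP; apply: contraNT nx => d0.
  have -> : x = d^-1 *: (- (a *: u + b *: v + c *: w)).
    by rewrite -[X in - X](addrK (d *: x)) E sub0r opprK scalerA mulVf ?scale1r.
  by rewrite rpredZ // rpredN !rpredD // rpredZ // memv_span // !inE eqxx ?orbT.
by move: E; rewrite d0 scale0r addr0 => /H[-> -> ->].
Qed.

Lemma independent4_basis u v w x : independent4 u v w x -> exists2 A : 'M[C]_4, A \in unitmx &
  forall a b c d, vec a b c d *m A = a *: u + b *: v + c *: w + d *: x.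
Proof.
move=> H; pose A : 'M[C]_4 := \matrix_(i < 4) nth 0 [:: u; v; w; x] i.
have AE a b c d : vec a b c d *m A = a *: u + b *: v + c *: w + d *: x.
  by apply/rowP => j; rewrite mxE big4 /= !vecE !mxE.
exists A => //; rewrite -row_free_unit; apply: inj_row_free => y.
rewrite (vec_eta y) AE => /H[-> -> -> ->]; apply: vecP; by rewrite vecE mxE.
Qed.

(** The cubic form with coefficient ai at the cube of the i-th variable, bij at the
    square of the i-th times the j-th, and di at the product of the three variables
    other than the i-th. *)
Definition general_cubic (a0 a1 a2 a3 b01 b02 b03 b10 b12 b13 b20 b21 b23 b30 b31 b32 d0 d1 d2 d3
    x y z t : C) : C :=
  a0 * x ^+ 3 + a1 * y ^+ 3 + a2 * z ^+ 3 + a3 * t ^+ 3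
  + b01 * x ^+ 2 * y + b02 * x ^+ 2 * z + b03 * x ^+ 2 * t
  + b10 * y ^+ 2 * x + b12 * y ^+ 2 * z + b13 * y ^+ 2 * t
  + b20 * z ^+ 2 * x + b21 * z ^+ 2 * y + b23 * z ^+ 2 * t
  + b30 * t ^+ 2 * x + b31 * t ^+ 2 * y + b32 * t ^+ 2 * z
  + d0 * y * z * t + d1 * x * z * t + d2 * x * y * t + d3 * x * y * z.

Lemma cubic_tensor f : f \is 3.-homog -> exists c : 'I_4 -> 'I_4 -> 'I_4 -> C,
  forall v, ev f v = \sum_i \sum_j \sum_k c i j k * (v 0 i * v 0 j * v 0 k).
Proof.
move: f; apply: cubic_ind.
- exists (fun _ _ _ => 0) => v; rewrite /ev meval0.
  by rewrite big1 // => i _; rewrite big1 // => j _; rewrite big1 // => k _; rewrite mul0r.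
- move=> a f g [c Hc] [d Hd]; exists (fun i j k => a * c i j k + d i j k) => v.
  rewrite evD evZ Hc Hd big_distrr -big_split; apply: eq_bigr => i _ /=.
  rewrite big_distrr -big_split; apply: eq_bigr => j _ /=.
  rewrite big_distrr -big_split; apply: eq_bigr => k _ /=.
  by rewrite /=; ring.
move=> i0 j0 k0.
exists (fun i j k => [&& i == i0, j == j0 & k == k0]%:R) => v.
rewrite (bigD1 i0) //= (bigD1 j0) //= (bigD1 k0) //= !eqxx mul1r !evM !evXU.
rewrite !big1 ?addr0 // => [i /negPf ni|j /negPf nj|k /negPf nk].
- rewrite big1 // => j _; rewrite big1 // => k _; by rewrite ni mul0r.
- rewrite big1 // => k _; by rewrite nj mul0r.
by rewrite nk mul0r.
Qed.

Lemma cubic20 f : f \is 3.-homog ->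
  exists a0 a1 a2 a3 b01 b02 b03 b10 b12 b13 b20 b21 b23 b30 b31 b32 d0 d1 d2 d3,
  ev f =1 coord_fun (general_cubic a0 a1 a2 a3 b01 b02 b03 b10 b12 b13 b20 b21 b23 b30 b31 b32
      d0 d1 d2 d3).
Proof.
move=> /cubic_tensor[c H].
exists (c 0 0 0), (c 1 1 1), (c 2 2 2), (c 3 3 3).
exists (c 0 0 1 + c 0 1 0 + c 1 0 0), (c 0 0 2 + c 0 2 0 + c 2 0 0), (c 0 0 3 + c 0 3 0 + c 3 0
    0).
exists (c 1 1 0 + c 1 0 1 + c 0 1 1), (c 1 1 2 + c 1 2 1 + c 2 1 1), (c 1 1 3 + c 1 3 1 + c 3 1
    1).
exists (c 2 2 0 + c 2 0 2 + c 0 2 2), (c 2 2 1 + c 2 1 2 + c 1 2 2), (c 2 2 3 + c 2 3 2 + c 3 2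
    2).
exists (c 3 3 0 + c 3 0 3 + c 0 3 3), (c 3 3 1 + c 3 1 3 + c 1 3 3), (c 3 3 2 + c 3 2 3 + c 2 3
    3).
exists (c 1 2 3 + c 1 3 2 + c 2 1 3 + c 2 3 1 + c 3 1 2 + c 3 2 1).
exists (c 0 2 3 + c 0 3 2 + c 2 0 3 + c 2 3 0 + c 3 0 2 + c 3 2 0).
exists (c 1 0 3 + c 1 3 0 + c 0 1 3 + c 0 3 1 + c 3 1 0 + c 3 0 1).
exists (c 1 2 0 + c 1 0 2 + c 2 1 0 + c 2 0 1 + c 0 1 2 + c 0 2 1).
move=> v; rewrite H /coord_fun /general_cubic !big4 /=.
move: (v 0 0) (v 0 1) (v 0 2) (v 0 3) => x y z t.
by ring.
Qed.

Lemma singular_at_vec G x y z t : singular_at (coord_fun G) (vec x y z t) -> forall a b c d : C,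
  G (x + a) (y + b) (z + c) (t + d) - G (x - a) (y - b) (z - c) (t - d)
  - 2 * G a b c d = 0.
Proof.
move=> H a b c d; have := H (vec a b c d); rewrite /coord_fun !mxE /= => ->.
by rewrite subrr.
Qed.

Ltac coef_zero n e := apply: (@mulf_cancel0 _ n); [idtac | rewrite -[RHS]e /general_cubic; ring].
Ltac nonzero_coef := by rewrite ?mulf_neq0 // pnatr_eq0.

Section SingularCoordinatePoints.
Variables a0 a1 a2 a3 b01 b02 b03 b10 b12 b13 b20 b21 b23 b30 b31 b32 d0 d1 d2 d3 : C.
Let G := general_cubic a0 a1 a2 a3 b01 b02 b03 b10 b12 b13 b20 b21 b23 b30 b31 b32 d0 d1 d2 d3.

Lemma singular_e0 : singular_at (coord_fun G) (vec 1 0 0 0) ->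
  [/\ a0 = 0, b01 = 0, b02 = 0 & b03 = 0].
Proof.
move=> /singular_at_vec H; rewrite /G in H; split.
- coef_zero (6 : C) (H 1 0 0 0); nonzero_coef.
- coef_zero (2 : C) (H 0 1 0 0); nonzero_coef.
- coef_zero (2 : C) (H 0 0 1 0); nonzero_coef.
- coef_zero (2 : C) (H 0 0 0 1); nonzero_coef.
Qed.

Lemma singular_e1 : singular_at (coord_fun G) (vec 0 1 0 0) ->
  [/\ a1 = 0, b10 = 0, b12 = 0 & b13 = 0].
Proof.
move=> /singular_at_vec H; rewrite /G in H; split.
- coef_zero (6 : C) (H 0 1 0 0); nonzero_coef.
- coef_zero (2 : C) (H 1 0 0 0); nonzero_coef.
- coef_zero (2 : C) (H 0 0 1 0); nonzero_coef.
- coef_zero (2 : C) (H 0 0 0 1); nonzero_coef.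
Qed.

Lemma singular_e2 : singular_at (coord_fun G) (vec 0 0 1 0) ->
  [/\ a2 = 0, b20 = 0, b21 = 0 & b23 = 0].
Proof.
move=> /singular_at_vec H; rewrite /G in H; split.
- coef_zero (6 : C) (H 0 0 1 0); nonzero_coef.
- coef_zero (2 : C) (H 1 0 0 0); nonzero_coef.
- coef_zero (2 : C) (H 0 1 0 0); nonzero_coef.
- coef_zero (2 : C) (H 0 0 0 1); nonzero_coef.
Qed.

Lemma singular_e3 : singular_at (coord_fun G) (vec 0 0 0 1) ->
  [/\ a3 = 0, b30 = 0, b31 = 0 & b32 = 0].
Proof.
move=> /singular_at_vec H; rewrite /G in H; split.
- coef_zero (6 : C) (H 0 0 0 1); nonzero_coef.
- coef_zero (2 : C) (H 1 0 0 0); nonzero_coef.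
- coef_zero (2 : C) (H 0 1 0 0); nonzero_coef.
- coef_zero (2 : C) (H 0 0 1 0); nonzero_coef.
Qed.

End SingularCoordinatePoints.

Lemma equiv_linear_subst f A : A \in unitmx -> lin_equiv (ev f) (ev (linear_subst A f)).
Proof. by move=> hA; apply: lin_equiv_sym; exists A => // v; rewrite ev_linear_subst. Qed.

Lemma singular_at_linear_subst f A v : A \in unitmx ->
  singular_at (ev (linear_subst A f)) v <-> singular_at (ev f) (v *m A).
Proof. by move=> hA; apply: singular_at_mul => // w; rewrite ev_linear_subst. Qed.

Lemma eq_singular_at F F' v : F =1 F' -> singular_at F v -> singular_at F' v.
Proof. by move=> E H w; rewrite -!E. Qed.

(** The partial derivatives are quadrics; having three zeros on a line, they
    vanish on it. *)
Lemma classified_three_collinear f u v a b : f \is 3.-homog -> independent2 u v -> a != 0 -> b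
    != 0 ->
  singular_at (ev f) u -> singular_at (ev f) v -> singular_at (ev f) (a *: u + b *: v) ->
  classified (ev f).
Proof.
move=> hf uv a0 b0 Su Sv Sab.
have [w /independent4_extend[x /independent4_basis[A hA HA]]] := independent3_extend uv.
refine (lin_equiv_classified (equiv_linear_subst f hA) _).
have [c0 [c1 [c2 [c3 [b01 [b02 [b03 [b10 [b12 [b13 [b20 [b21 [b23 [b30 [b31 [b32
  [d0 [d1 [d2 [d3 HG]]]]]]]]]]]]]]]]]]]] := cubic20 (linear_subst_homog A hf).
have S0 : singular_at (ev (linear_subst A f)) (vec 1 0 0 0).
  by apply/(singular_at_linear_subst _ _ hA); rewrite HA !scale0r !addr0 scale1r.
have S1 : singular_at (ev (linear_subst A f)) (vec 0 1 0 0).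
  by apply/(singular_at_linear_subst _ _ hA); rewrite HA !scale0r !addr0 add0r scale1r.
have S2 : singular_at (ev (linear_subst A f)) (vec a b 0 0).
  by apply/(singular_at_linear_subst _ _ hA); rewrite HA !scale0r !addr0.
have [z0 z1 z2 z3] := singular_e0 (eq_singular_at HG S0).
have [z4 z5 z6 z7] := singular_e1 (eq_singular_at HG S1).
have H2 := singular_at_vec (eq_singular_at HG S2).
subst c0 c1 b01 b02 b03 b10 b12 b13.
have z8 : d3 = 0 by coef_zero (2 * (a * b)) (H2 0 0 1 0); nonzero_coef.
have z9 : d2 = 0 by coef_zero (2 * (a * b)) (H2 0 0 0 1); nonzero_coef.
subst d2 d3.
apply: (eq_classified HG).
refine (lin_equiv_classified _ (@classified_singular_line _ c3 b32 b23 c2 b30 d1 b20 b31 d0 b21)).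
apply: (@lin_equiv_coord_fun _ _ _ (vec 1 0 0 0) (vec 0 0 1 0) (vec 0 0 0 1) (vec 0 1 0 0)) => p
    q r t;
  rewrite ?linear_form4 ?vecE !(mul0r, mul1r, addr0, add0r).
  by move=> -> -> -> ->.
by rewrite /line_cubic /cubic2 /quad2 /general_cubic; ring.
Qed.

Definition no_three f := forall u v a b, independent2 u v -> a != 0 -> b != 0 ->
  singular_at (ev f) u -> singular_at (ev f) v -> singular_at (ev f) (a *: u + b *: v) -> False.

(** Here u, v, w become the first three coordinate points, and the plane through
    them has equation t = 0 for the last coordinate t.  The fourth point makes f
    divisible by t.  The quadratic factor restricts to the plane as
    d2 x y + d1 x z + d0 y z; if a coefficient vanished, the singular locus would
    contain a line joining two of the points.  Completing squares then removes the
    mixed terms with t. *)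
Lemma classified_four_coplanar f u v w a b c : f \is 3.-homog -> no_three f ->
  independent3 u v w -> a != 0 -> b != 0 -> c != 0 ->
  singular_at (ev f) u -> singular_at (ev f) v -> singular_at (ev f) w ->
  singular_at (ev f) (a *: u + b *: v + c *: w) -> classified (ev f).
Proof.
move=> hf no uvw a0 b0 c0 Su Sv Sw Sabc.
have [x /independent4_basis[A hA HA]] := independent4_extend uvw.
refine (lin_equiv_classified (equiv_linear_subst f hA) _).
have [e0 [e1 [e2 [e3 [b01 [b02 [b03 [b10 [b12 [b13 [b20 [b21 [b23 [b30 [b31 [b32
  [d0 [d1 [d2 [d3 HG]]]]]]]]]]]]]]]]]]]] := cubic20 (linear_subst_homog A hf).
have S0 : singular_at (ev (linear_subst A f)) (vec 1 0 0 0).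
  by apply/(singular_at_linear_subst _ _ hA); rewrite HA !scale0r !addr0 scale1r.
have S1 : singular_at (ev (linear_subst A f)) (vec 0 1 0 0).
  by apply/(singular_at_linear_subst _ _ hA); rewrite HA !scale0r !addr0 add0r scale1r.
have S2 : singular_at (ev (linear_subst A f)) (vec 0 0 1 0).
  by apply/(singular_at_linear_subst _ _ hA); rewrite HA !scale0r !addr0 !add0r scale1r.
have S3 : singular_at (ev (linear_subst A f)) (vec a b c 0).
  by apply/(singular_at_linear_subst _ _ hA); rewrite HA !scale0r !addr0.
have [z0 z1 z2 z3] := singular_e0 (eq_singular_at HG S0).
have [z4 z5 z6 z7] := singular_e1 (eq_singular_at HG S1).
have [z8 z9 z10 z11] := singular_e2 (eq_singular_at HG S2).
have H3 := singular_at_vec (eq_singular_at HG S3).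
subst e0 e1 e2 b01 b02 b03 b10 b12 b13 b20 b21 b23.
have z12 : d3 = 0 by coef_zero (6 * (a * b * c)) (H3 a b c 0); nonzero_coef.
subst d3.
have Sg (x0 x1 x2 : C) : d1 * x0 * x2 + d2 * x0 * x1 + d0 * x1 * x2 = 0 ->
    singular_at (ev f) (x0 *: u + x1 *: v + x2 *: w).
  move=> E; have -> : x0 *: u + x1 *: v + x2 *: w = vec x0 x1 x2 0 *m A.
    by rewrite HA scale0r addr0.
  apply/(singular_at_linear_subst _ _ hA); apply: (eq_singular_at (fsym HG)).
  apply: (iffRL (@singular_at_grad _ _ _ 0 0 0 (d1 * x0 * x2 + d2 * x0 * x1 + d0 * x1 * x2) _)).
    by move=> p q r t; rewrite !vecE /general_cubic; ring.
  by [].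
have one : (1 : C) != 0 by rewrite oner_eq0.
have d0n : d0 != 0.
  apply/eqP => E; apply: (no v w 1 1) => //.
    by move=> p q E'; have [] := uvw 0 p q; rewrite ?scale0r ?add0r.
  by have := Sg 0 1 1; rewrite scale0r add0r; apply; rewrite E; ring.
have d1n : d1 != 0.
  apply/eqP => E; apply: (no u w 1 1) => //.
    by move=> p q E'; have [] := uvw p 0 q; rewrite ?scale0r ?addr0.
  by have := Sg 1 0 1; rewrite scale0r addr0; apply; rewrite E; ring.
have d2n : d2 != 0.
  apply/eqP => E; apply: (no u v 1 1) => //.
    by move=> p q E'; have [] := uvw p q 0; rewrite ?scale0r ?addr0.
  by have := Sg 1 1 0; rewrite scale0r addr0; apply; rewrite E; ring.
apply: (eq_classified HG).
(* The restricted quadric is s^2 x^2 - y1 y3 with y1 = - y - (d1 / d0) x and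
   y3 = d2 x + d0 z; the numbers l, m, n are the shifts of the three squares by
   multiples of t. *)
pose s := sqrtC (- (d1 * d2) / d0); have s2 : s ^+ 2 = - (d1 * d2) / d0 by rewrite sqrtCK.
have sn : s != 0.
  by rewrite sqrtC_eq0 mulf_neq0 ?invr_eq0 // oppr_eq0 mulf_neq0.
clearbody s; pose m := - b32 / d0; pose n := b31.
pose l := (b30 - n * d1 / d0 + m * d2) / (2 * s).
refine (lin_equiv_classified _ (@classified_plane_quadric _ (e3 - l ^+ 2 + m * n))).
apply: (@lin_equiv_coord_fun _ _ _ (vec 0 0 0 1) (vec (- (d1 / d0)) (-1) 0 m) (vec s 0 0 l)
   (vec d2 0 d0 n)) => p q r t; rewrite ?linear_form4 ?vecE !(mul0r, mul1r, addr0, add0r).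
  move=> ->; rewrite !mulr0 !addr0 => E1 /(mulf_cancel0 sn) p0.
  move: E1; rewrite p0 !mulr0 !add0r mulN1r => /eqP; rewrite oppr_eq0 => /eqP-> /(mulf_cancel0
      d0n) ->.
  by [].
rewrite /plane_quadric [RHS](_ : _ = t * ((e3 - l ^+ 2 + m * n) * t ^+ 2 + (s ^+ 2 * p ^+ 2 + 2
    * s * l * p * t + l ^+ 2 * t ^+ 2)
   - (- (d1 / d0) * p + -1 * q + m * t) * (d2 * p + d0 * r + n * t))); last by ring.
rewrite s2 /general_cubic.
have -> : 2 * s * l = b30 - n * d1 / d0 + m * d2 by rewrite /l; field; rewrite ?sn ?d0n.
by rewrite /m /n; field.
Qed.

(** Only the four products of three variables survive at the coordinate points.
    At a fifth point with nonzero coordinates, multiplying the i-th derivative by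
    the i-th coordinate shows that any three of the four terms sum to zero. *)
Lemma classified_general_position f u v w x a b c d : f \is 3.-homog ->
  independent4 u v w x -> a != 0 -> b != 0 -> c != 0 -> d != 0 ->
  singular_at (ev f) u -> singular_at (ev f) v -> singular_at (ev f) w -> singular_at (ev f) x ->
  singular_at (ev f) (a *: u + b *: v + c *: w + d *: x) -> classified (ev f).
Proof.
move=> hf uvwx a0 b0 c0 dn Su Sv Sw Sx Sabc.
have [A hA HA] := independent4_basis uvwx.
refine (lin_equiv_classified (equiv_linear_subst f hA) _).
have [e0 [e1 [e2 [e3 [b01 [b02 [b03 [b10 [b12 [b13 [b20 [b21 [b23 [b30 [b31 [b32
  [d0 [d1 [d2 [d3 HG]]]]]]]]]]]]]]]]]]]] := cubic20 (linear_subst_homog A hf).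
have S0 : singular_at (ev (linear_subst A f)) (vec 1 0 0 0).
  by apply/(singular_at_linear_subst _ _ hA); rewrite HA !scale0r !addr0 scale1r.
have S1 : singular_at (ev (linear_subst A f)) (vec 0 1 0 0).
  by apply/(singular_at_linear_subst _ _ hA); rewrite HA !scale0r !addr0 add0r scale1r.
have S2 : singular_at (ev (linear_subst A f)) (vec 0 0 1 0).
  by apply/(singular_at_linear_subst _ _ hA); rewrite HA !scale0r !addr0 !add0r scale1r.
have S3 : singular_at (ev (linear_subst A f)) (vec 0 0 0 1).
  by apply/(singular_at_linear_subst _ _ hA); rewrite HA !scale0r !add0r scale1r.
have S4 : singular_at (ev (linear_subst A f)) (vec a b c d).
  by apply/(singular_at_linear_subst _ _ hA); rewrite HA.
have [z0 z1 z2 z3] := singular_e0 (eq_singular_at HG S0).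
have [z4 z5 z6 z7] := singular_e1 (eq_singular_at HG S1).
have [z8 z9 z10 z11] := singular_e2 (eq_singular_at HG S2).
have [z12 z13 z14 z15] := singular_e3 (eq_singular_at HG S3).
have H4 := singular_at_vec (eq_singular_at HG S4).
subst e0 e1 e2 e3 b01 b02 b03 b10 b12 b13 b20 b21 b23 b30 b31 b32.
pose D0 := d0 * b * c * d; pose D1 := d1 * a * c * d.
pose D2 := d2 * a * b * d; pose D3 := d3 * a * b * c.
have E0 : D1 + D2 + D3 = 0.
  apply: (@mulf_cancel0 _ 2); first nonzero_coef.
  rewrite [LHS](_ : _ = a * (2 * (d1 * c * d + d2 * b * d + d3 * b * c)));
      last by rewrite /D1 /D2 /D3; ring.
  by rewrite -[RHS](mulr0 a) -[0 in RHS](H4 1 0 0 0) /general_cubic; ring.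
have E1 : D0 + D2 + D3 = 0.
  apply: (@mulf_cancel0 _ 2); first nonzero_coef.
  rewrite [LHS](_ : _ = b * (2 * (d0 * c * d + d2 * a * d + d3 * a * c)));
      last by rewrite /D0 /D2 /D3; ring.
  by rewrite -[RHS](mulr0 b) -[0 in RHS](H4 0 1 0 0) /general_cubic; ring.
have E2 : D0 + D1 + D3 = 0.
  apply: (@mulf_cancel0 _ 2); first nonzero_coef.
  rewrite [LHS](_ : _ = c * (2 * (d0 * b * d + d1 * a * d + d3 * a * b)));
      last by rewrite /D0 /D1 /D3; ring.
  by rewrite -[RHS](mulr0 c) -[0 in RHS](H4 0 0 1 0) /general_cubic; ring.
have E3 : D0 + D1 + D2 = 0.
  apply: (@mulf_cancel0 _ 2); first nonzero_coef.
  rewrite [LHS](_ : _ = d * (2 * (d0 * b * c + d1 * a * c + d2 * a * b)));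
      last by rewrite /D0 /D1 /D2; ring.
  by rewrite -[RHS](mulr0 d) -[0 in RHS](H4 0 0 0 1) /general_cubic; ring.
have three : (3 : C) != 0 by nonzero_coef.
have y0 : d0 = 0.
  apply: (@mulf_cancel0 _ (3 * (b * c * d))); first nonzero_coef.
  rewrite [LHS](_ : _ = (D0 + D1 + D2) + (D0 + D1 + D3) + (D0 + D2 + D3) - 2 * (D1 + D2 + D3));
      last by rewrite /D0 /D1 /D2 /D3; ring.
  by rewrite E0 E1 E2 E3; ring.
have y1 : d1 = 0.
  apply: (@mulf_cancel0 _ (3 * (a * c * d))); first nonzero_coef.
  rewrite [LHS](_ : _ = (D0 + D1 + D2) + (D0 + D1 + D3) - 2 * (D0 + D2 + D3) + (D1 + D2 + D3));
      last by rewrite /D0 /D1 /D2 /D3; ring.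
  by rewrite E0 E1 E2 E3; ring.
have y2 : d2 = 0.
  apply: (@mulf_cancel0 _ (3 * (a * b * d))); first nonzero_coef.
  rewrite [LHS](_ : _ = (D0 + D1 + D2) - 2 * (D0 + D1 + D3) + (D0 + D2 + D3) + (D1 + D2 + D3));
      last by rewrite /D0 /D1 /D2 /D3; ring.
  by rewrite E0 E1 E2 E3; ring.
have y3 : d3 = 0.
  apply: (@mulf_cancel0 _ (3 * (a * b * c))); first nonzero_coef.
  rewrite [LHS](_ : _ = - 2 * (D0 + D1 + D2) + (D0 + D1 + D3) + (D0 + D2 + D3) + (D1 + D2 +
      D3)); last by rewrite /D0 /D1 /D2 /D3; ring.
  by rewrite E0 E1 E2 E3; ring.
case=> y /negP; case; apply/eqP.
by rewrite HG /coord_fun /general_cubic y0 y1 y2 y3; ring.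
Qed.

End Geometry.

(** * The classification and the theorem *)

Section Conclusion.
Variable R : realType.
Local Notation C := R[i].
Local Notation V := 'rV[C]_4.
Local Notation Poly := {mpoly C[4]}.
Implicit Types (f : Poly) (u v w : V) (S : V -> Prop) (F : V -> C).

Definition off_line u v := v \notin <[u]>%VS.

Lemma off_line_independent u v : u != 0 -> off_line u v -> independent2 u v.
Proof.
move=> u0 uv a b E; have b0 : b = 0.
  apply/eqP; apply: contraNT uv => b0.
  have -> : v = b^-1 *: (- (a *: u)).
    by rewrite -[X in - X](addrK (b *: v)) E sub0r opprK scalerA mulVf ?scale1r.
  by rewrite rpredZ // rpredN rpredZ // memv_line.
split=> //; move: E; rewrite b0 scale0r addr0 => /eqP.
by rewrite scaler_eq0 (negPf u0) orbF => /eqP.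
Qed.

Lemma on_line_scale a u v : v = a *: u -> ~~ off_line u v.
Proof. by move=> ->; rewrite negbK rpredZ // memv_line. Qed.

Lemma distinct_points_off_line (p q : P3 R) u v : p <> q -> u != 0 -> v != 0 ->
  val p = <[u]>%VS -> val q = <[v]>%VS -> off_line u v.
Proof.
move=> pq u0 v0 pu qv; apply/negP => vu; apply: pq; apply: val_inj.
rewrite pu qv; apply/esym/eqP; rewrite eqEdim -memvE vu /=.
by rewrite !dim_vline u0 v0.
Qed.

Lemma five_points S : infinite_set (proj S) -> exists v : 'I_5 -> V,
  [/\ forall i, v i != 0, forall i, S (v i) & forall i j, i != j -> off_line (v i) (v j)].
Proof.
move=> inf; have pick B : finite_set B -> exists p, proj S p /\ ~ B p.
  by move=> /(infinite_setD inf)/infinite_setN0[p [H1 H2]]; exists p.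
have [p0 [S0 _]] := pick _ (finite_set0 _).
have [p1 [S1 N1]] := pick _ (finite_set1 p0).
have [p2 [S2 N2]] := pick _ (finite_set2 p0 p1).
have [p3 [S3 N3]] := pick _ (finite_set3 p0 p1 p2).
have [p4 [S4 N4]] := pick _ (finite_set4 p0 p1 p2 p3).
pose p (i : 'I_5) := nth p0 [:: p0; p1; p2; p3; p4] i.
have /choice[v Hv] : forall i, exists v, v != 0 /\ val (p i) = <[v]>%VS.
  by move=> i; have [v v0 pv] := P3_generator (p i); exists v.
have neq (i j : 'I_5) : (i < j)%N -> p i <> p j.
  have M1 : p0 <> p1 by move=> E; apply: N1; rewrite E.
  have M2 : p0 <> p2 /\ p1 <> p2.
    by split=> E; apply: N2; rewrite -E; [left|right].
  have M3 : [/\ p0 <> p3, p1 <> p3 & p2 <> p3].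
    by split=> E; apply: N3; rewrite -E; [left; left|left; right|right].
  have M4 : [/\ p0 <> p4, p1 <> p4, p2 <> p4 & p3 <> p4].
    by split=> E; apply: N4; rewrite -E;
      [left; left; left|left; left; right|left; right|right].
  move: M2 M3 M4 => [? ?] [? ? ?] [? ? ? ?].
  by case: i j => [[|[|[|[|[|//]]]]] ?] [[|[|[|[|[|//]]]]] ?].
exists v; split=> [i|i|i j]; first by have [] := Hv i.
  have [_ pv] := Hv i; have : proj S (p i) by case: i {pv} => [[|[|[|[|[|//]]]]] ?].
  by apply; rewrite pv memv_line.
have [vi0 pi] := Hv i; have [vj0 pj] := Hv j.
rewrite neq_ltn => /orP[/neq ij|/neq ij]; apply: (distinct_points_off_line _ vi0 vj0 pi pj) => //.
by move=> E; apply: ij.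
Qed.

(** Five singular points suffice.  A dependency between them with a vanishing
    coefficient involves fewer points, and is handled by the collinear or coplanar
    case. *)
Theorem infinite_classified f : f \is 3.-homog ->
  infinite_set (singular_locus f) -> classified (ev f).
Proof.
move=> hf; rewrite singular_locusE // => /five_points[v [v0 Sv nv]].
apply: contrapT => ncl.
have no3 : no_three f.
  by move=> u w a b uw a0 b0 Su Sw Suw; apply: ncl; apply: classified_three_collinear uw a0 b0
      Su Sw Suw.
have two u w x a b : u != 0 -> off_line u w -> off_line u x -> off_line w x ->
    singular_at (ev f) u -> singular_at (ev f) w -> singular_at (ev f) x -> x = a *: u + b *: w
        -> False.
  move=> u0 uw ux wx Su Sw Sx E.
  have [a0|a0] := eqVneq a 0.
    by move: wx; apply/negP; apply: (@on_line_scale b); rewrite E a0 scale0r add0r.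
  have [b0|b0] := eqVneq b 0.
    by move: ux; apply/negP; apply: (@on_line_scale a); rewrite E b0 scale0r addr0.
  by apply: (no3 u w a b) => //; [exact: off_line_independent|rewrite -E].
have li u w x : u != 0 -> off_line u w -> off_line u x -> off_line w x ->
    singular_at (ev f) u -> singular_at (ev f) w -> singular_at (ev f) x -> independent3 u w x.
  move=> u0 uw ux wx Su Sw Sx a b c E.
  have c0 : c = 0.
    apply/eqP; apply: contrapT => /negP c0.
    apply: (two u w x (- (c^-1 * a)) (- (c^-1 * b))) => //.
    rewrite -[x]scale1r -(mulVf c0) -scalerA -[c *: x](addKr (a *: u + b *: w)) E addr0.
    by rewrite scalerN scalerDr !scalerA opprD !scaleNr.
  move: E; rewrite c0 scale0r addr0 => /(off_line_independent u0 uw)[-> ->] //.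
have three u w x y a b c : u != 0 -> w != 0 -> x != 0 -> off_line u w -> off_line u x ->
    off_line w x ->
    off_line u y -> off_line w y -> off_line x y ->
    singular_at (ev f) u -> singular_at (ev f) w -> singular_at (ev f) x -> singular_at (ev f) y
        ->
    y = a *: u + b *: w + c *: x -> False.
  move=> u0 w0 x0 uw ux wx uy wy xy Su Sw Sx Sy E.
  have [a0|a0] := eqVneq a 0.
    by apply: (two w x y b c) => //; rewrite E a0 scale0r add0r.
  have [b0|b0] := eqVneq b 0.
    by apply: (two u x y a c) => //; rewrite E b0 scale0r addr0.
  have [c0|c0] := eqVneq c 0.
    by apply: (two u w y a b) => //; rewrite E c0 scale0r addr0.
  apply: ncl; apply: (classified_four_coplanar hf no3 (li u w x _ _ _ _ _ _ _) a0 b0 c0) => //.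
  by rewrite -E.
pose i0 : 'I_5 := 0; pose i1 : 'I_5 := 1; pose i2 : 'I_5 := 2.
pose i3 : 'I_5 := 3; pose i4 : 'I_5 := 4.
have l3 : independent3 (v i0) (v i1) (v i2) by apply: li => //; apply: nv.
have l4 : independent4 (v i0) (v i1) (v i2) (v i3).
  move=> a b c d E.
  have d0 : d = 0.
    apply/eqP; apply: contrapT => /negP d0.
    apply: (@three (v i0) (v i1) (v i2) (v i3) (- (d^-1 * a)) (- (d^-1 * b)) (- (d^-1 * c)));
      rewrite ?v0 ?nv //.
    rewrite -[v i3]scale1r -(mulVf d0) -scalerA.
    rewrite -[d *: v i3](addKr (a *: v i0 + b *: v i1 + c *: v i2)) E addr0.
    by rewrite scalerN !scalerDr !scalerA !opprD !scaleNr.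
  by move: E; rewrite d0 scale0r addr0 => /l3[-> -> ->].
have [A hA HA] := independent4_basis l4.
pose y := v i4 *m invmx A.
have E : v i4 = y 0 0 *: v i0 + y 0 1 *: v i1 + y 0 2 *: v i2 + y 0 3 *: v i3.
  by rewrite -HA -vec_eta /y mulmxKV.
have [a0|a0] := eqVneq (y 0 0) 0.
  apply: (@three (v i1) (v i2) (v i3) (v i4) (y 0 1) (y 0 2) (y 0 3)); rewrite ?v0 ?nv //.
  by rewrite {1}E a0 scale0r add0r.
have [b0|b0] := eqVneq (y 0 1) 0.
  apply: (@three (v i0) (v i2) (v i3) (v i4) (y 0 0) (y 0 2) (y 0 3)); rewrite ?v0 ?nv //.
  by rewrite {1}E b0 scale0r addr0.
have [c0|c0] := eqVneq (y 0 2) 0.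
  apply: (@three (v i0) (v i1) (v i3) (v i4) (y 0 0) (y 0 1) (y 0 3)); rewrite ?v0 ?nv //.
  by rewrite {1}E c0 scale0r addr0.
have [d0|d0] := eqVneq (y 0 3) 0.
  apply: (@three (v i0) (v i1) (v i2) (v i4) (y 0 0) (y 0 1) (y 0 2)); rewrite ?v0 ?nv //.
  by rewrite {1}E d0 scale0r addr0.
apply: ncl; apply: (classified_general_position hf l4 a0 b0 c0 d0) => //.
by rewrite -E.
Qed.

Lemma cubes_fun_poly F r : cubes_fun F r -> exists2 f : Poly, f \is 3.-homog & ev f =1 F.
Proof.
move=> [M HM]; exists (\sum_k (\sum_i M i k *: 'X_i) ^+ 3).
  apply: rpred_sum => k _; have := dhomogMn 3 (@linear_homog R (M ^~ k)).
  by rewrite mul1n.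
move=> v; rewrite HM ev_sum; apply: eq_bigr => k _; rewrite evXn ev_sum mxE.
by congr (_ ^+ _); apply: eq_bigr => i _; rewrite evZ evXU mulrC.
Qed.

Lemma infinite_family S (v : nat -> V) (i j : 'I_4) : (forall n, S (v n)) -> cone S ->
  (forall n, v n 0 i = 1) -> (forall n, v n 0 j = n%:R) -> infinite_set (proj S).
Proof.
move=> Sv cS vi vj.
have v0 n : v n != 0.
  by apply/eqP => E; have := vi n; rewrite E mxE => /eqP; rewrite eq_sym oner_eq0.
pose p n := point_of (v0 n).
have p_inj : injective p.
  move=> m n /(congr1 val) /= E; have : v m \in <[v n]>%VS by rewrite -E memv_line.
  move=> /vlineP[a va]; have := vi m; rewrite va mxE vi mulr1 => a1.
  have := vj m; rewrite va mxE vj a1 mul1r => /eqP; rewrite eqr_nat => /eqP //.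
move=> fin; apply: infinite_nat.
have : finite_set (range p).
  by apply: sub_finite_set fin => _ [n _ <-]; apply/proj_point.
by rewrite /finite_set; move=> [n Hn]; exists n; rewrite -(card_eql (inj_card_eq (in2W p_inj))).
Qed.

Lemma pair_occurs G m d r (v : nat -> V) (i j : 'I_4) : has_invariants (@coord_fun R G) m d r r ->
  (exists v, coord_fun G v != 0) ->
  (forall n, singular_at (coord_fun G) (v n)) ->
  (forall n, v n 0 i = 1) -> (forall n, v n 0 j = n%:R) ->
  exists f : Poly, [/\ cubic_surface f, infinite_set (singular_locus f), has_rank f r,
     dimension (singular_locus f) = m & degree (singular_locus f) = d%:R].
Proof.
move=> [[dm dg] lo hi] [x nx] Sv vi vj.
have [f hf Ef] := cubes_fun_poly hi.
have FE : ev f = coord_fun G by apply/funext.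
have SE : singular_locus f = proj (singular_at (coord_fun G)) by rewrite singular_locusE // FE.
exists f; split; rewrite ?SE //.
- split=> //; apply: contraNneq nx => f0; rewrite -Ef f0; apply/eqP; exact: meval0.
- apply: (infinite_family Sv _ vi vj); rewrite -FE; exact: cone_singular_at.
- split; first by apply/sum_of_cubesE; rewrite FE.
  by move=> s /sum_of_cubesE; rewrite FE; apply: lo.
Qed.

End Conclusion.

Theorem theorem3p3 (R : realType) (r : nat) (m : nat) (e : rat) :
  (exists f : {mpoly R[i][4]},
     [/\ cubic_surface f,
         infinite_set (singular_locus f),
         has_rank f r,
         dimension (singular_locus f) = m &
         degree (singular_locus f) = e])
  <->
  (exists2 d : nat, (m, d) \in listed_pairs r & e = d%:R).
Proof.
split=> [[f [[f0 hf] inf [hr hmin] dm dg]]|[d]].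
  have [|m' [d [lo [hi [[[dm' dg'] Hlo Hhi] L]]]]] := infinite_classified hf inf.
    apply: contrapT => H; move/eqP: f0; apply; apply: ev_eq0 => v.
    by apply/eqP; apply: contrapT => /negP nv; apply: H; exists v.
  rewrite -singular_locusE // in dm' dg'.
  exists d; last by rewrite -dg dg'.
  rewrite -dm dm'; apply: L; apply/andP; split.
    by apply: Hlo; apply/sum_of_cubesE.
  by apply: hmin; apply/sum_of_cubesE.
have one : (1 : R[i]) != 0 by rewrite oner_eq0.
have nzv G (v : 'rV[R[i]]_4) : coord_fun G v = 1 -> exists v, coord_fun G v != 0.
  by move=> E; exists v; rewrite E.
pose L n := vec (1 : R[i]) 0 0 n%:R.
have L0 n : L n 0 0 = 1 by rewrite vecE.
have L3 n : L n 0 3 = n%:R by rewrite vecE.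
have Ll n : lines 1 (L n) by apply: linesP1; rewrite vecE.
have LP n : plane (L n) by rewrite /plane vecE.
have fin G d0 : has_invariants (@coord_fun R G) m d0 r r -> d0 = d -> e = d%:R ->
   (exists v, coord_fun G v != 0) -> (forall n, singular_at (coord_fun G) (L n)) ->
   exists f : {mpoly R[i][4]}, [/\ cubic_surface f, infinite_set (singular_locus f),
     has_rank f r, dimension (singular_locus f) = m & degree (singular_locus f) = e].
  by move=> H <- -> nonzero_coef Sv; apply: pair_occurs H nonzero_coef Sv L0 L3.
case: r fin => [|[|[|[|[|[|[|[|//]]]]]]]] fin //=; rewrite !inE.
- move=> /eqP[Em Ed] ee; subst m d; apply: (fin _ _ (invariants_triple_plane one)) => //.
    by apply: (nzv _ (vec 0 0 1 0)); rewrite /coord_fun /triple_plane !vecE; ring.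
  by move=> n; apply/singular_triple_plane.
- move=> /eqP[Em Ed] ee; subst m d; apply: (fin _ _ (invariants_concurrent_planes one one)) => //.
    exists (vec 0 1 1 0); rewrite /coord_fun /concurrent_planes !vecE.
    by rewrite [X in X != 0](_ : _ = 2) ?pnatr_eq0 //; ring.
  by move=> n; apply/singular_concurrent_planes.
- move=> /eqP[Em Ed] ee; subst m d; apply: (fin _ _ (@invariants_double_plane R)) => //.
    by apply: (nzv _ (vec 0 0 1 1)); rewrite /coord_fun /double_plane !vecE; ring.
  by move=> n; apply/singular_double_plane.
- case/or3P => /eqP[Em Ed] ee; subst m d.
  + apply: (fin _ _ (invariants_cuspidal_cone one)) => //.
      by apply: (nzv _ (vec 0 1 0 0)); rewrite /coord_fun /cuspidal_cone !vecE; ring.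
    by move=> n; apply/singular_cuspidal_cone.
  + apply: (fin _ _ (invariants_secant_cone one)) => //.
      by apply: (nzv _ (vec 0 0 1 0)); rewrite /coord_fun /secant_cone !vecE; ring.
    by move=> n; apply/singular_secant_cone => //; apply/lines2E; rewrite !vecE mulr0.
  + apply: (fin _ _ (@invariants_triangle_cone R)) => //.
      by apply: (nzv _ (vec 1 1 1 0)); rewrite /coord_fun /secant_cone !vecE; ring.
    by move=> n; apply/singular_triangle_cone/lines3E; rewrite !vecE !mulr0.
- move=> /eqP[Em Ed] ee; subst m d; apply: (fin _ _ (invariants_tangent_cone one)) => //.
    by apply: (nzv _ (vec 0 0 1 1)); rewrite /coord_fun /tangent_cone !vecE; ring.
  by move=> n; apply/singular_tangent_cone.
- case/orP => /eqP[Em Ed] ee; subst m d.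
  + apply: (fin _ _ (@invariants_ruled R)) => //.
      by apply: (nzv _ (vec 0 0 1 1)); rewrite /coord_fun /ruled !vecE; ring.
    by move=> n; apply/singular_ruled.
  + rewrite ee; apply: (@pair_occurs _ _ _ _ _ (fun n => vec 0 1 n%:R (n%:R ^+ 2)) 1 2
      (invariants_plane_quadric 1)).
    * by apply: (nzv _ (vec 1 0 0 0)); rewrite /coord_fun /plane_quadric !vecE; ring.
    * by move=> n; apply/singular_plane_quadric; left; rewrite !vecE mul1r.
    * by move=> n; rewrite vecE.
    * by move=> n; rewrite vecE.
- case/orP => /eqP[Em Ed] ee; subst m d.
  + apply: (fin _ _ (invariants_cayley one)) => //.
      by apply: (nzv _ (vec 0 1 0 0)); rewrite /coord_fun /cayley !vecE; ring.
    by move=> n; apply/singular_cayley.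
  + apply: (fin _ _ (@invariants_tangent_quadric R)) => //.
      by apply: (nzv _ (vec 0 0 1 1)); rewrite /coord_fun /cayley !vecE; ring.
    by move=> n; apply/singular_tangent_quadric/lines2E; rewrite !vecE mulr0.
Qed.
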